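(* Let $c_o\in\mathbf{R}$. An immersion $X:\Sigma\to\mathbf{R}^3$ is critical for the Helfrich energy $\mathcal{H}[\Sigma]=\int_\Sigma(H+c_o)^2\,d\Sigma$ with respect to compactly supported variations if and only if the modified conformal Gauss map $Y^{c_o}:\Sigma\to\mathbf{S}^4_1$ satisfies $$\Delta Y^{c_o}+\lVert dY^{c_o}\rVert^2\,Y^{c_o}=2c_o\,l^T,$$ where $l^T$ denotes the projection of the constant light-like vector $l:=(0,0,0,1,1)$ to $\mathbf{S}^4_1$, and the metric on $\Sigma$ is the one induced by the immersion $X$. Consequently, the immersion $X$ is critical for the Helfrich energy $\mathcal{H}$ if and only if the map $Y^{c_o}$ is critical for the energy $$\mathcal{F}[Z]:=\int_\Sigma\left(\lVert dZ\rVert^2+4c_o\,U(Z)\right)d\Sigma,\qquad U(Z):=Z_4-Z_5,$$ among maps $Z:\Sigma\to\mathbf{S}^4_1$, with respect to compactly supported variations.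
   Context: $\Sigma$ is a compact, connected, oriented surface with smooth boundary and $X:\Sigma\to\mathbf{R}^3$ is an immersion of class $\mathcal{C}^4$ up to the boundary, with unit normal $\nu$ (oriented so that $\nu$ points out of convex domains). $H$ is the mean curvature with sign convention $2H=-\mathrm{tr}(d\nu)$, equivalently $\Delta X=2H\nu$ (the round sphere of radius $R$ with outward normal has $H=-1/R$), and $K$ is the Gaussian curvature. Criticality for $\mathcal{H}$ with respect to compactly supported variations means that $\Delta H+2(H+c_o)(H[H-c_o]-K)=0$ in the interior of $\Sigma$. $(\mathbf{E}^5_1,\langle\,,\rangle)$ is the five-dimensional Minkowski space of signature $(+,+,+,+,-)$ and $\mathbf{S}^4_1:=\{Y\in\mathbf{E}^5_1 : \langle Y,Y\rangle=1\}$ is de Sitter space. Let $q:=X\cdot\nu$ be the support function, $X^2:=X\cdot X$ and $$\underline{X}:=\left(X,\frac{X^2-1}{2},\frac{X^2+1}{2}\right)\in\mathbf{E}^5_1 .$$ The modified conformal Gauss map is $$Y^{c_o}:=(H+c_o)\,\underline{X}+(\nu,q,q),$$ which takes values in $\mathbf{S}^4_1$. Here $\Delta$ (acting componentwise) is the Laplacian of the metric induced by $X$; $\lVert dZ\rVert^2=\sum_i\langle dZ(e_i),dZ(e_i)\rangle$ for a local orthonormal frame $e_1,e_2$ of that metric; and $l^T=l-\langle Y^{c_o},l\rangle Y^{c_o}$ is the tangential projection of $l$ to $\mathbf{S}^4_1$ at $Y^{c_o}$. *)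

(* Defs.v *)
From HB Require Import structures.
From mathcomp Require Import all_boot all_order all_algebra.
From mathcomp Require Import all_classical all_reals all_analysis.
Import Order.TTheory GRing.Theory Num.Theory.
Import numFieldNormedType.Exports.

Set Implicit Arguments.
Unset Strict Implicit.
Unset Printing Implicit Defensive.

Local Open Scope classical_set_scope.
Local Open Scope ring_scope.

(* Derivative of f at x in direction e along D only.  At interior points of D
   it is 'D_e f x; for D relatively open in a closed half-plane, e a coordinate
   vector and x on the boundary line, it is the (possibly one-sided) partial
   derivative, so that functions of class C^k up to the boundary can be
   differentiated at boundary points too. *)
Section DerivativesAlong.
Context {R : realType} {V W : normedModType R}.

Definition quotient_along (D : set V) (f : V -> W) (e x : V) :
    set_system W :=
  (fun h : R => h^-1 *: (f (h *: e + x) - f x))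
    @ within [set h : R | D (h *: e + x)] 0^'.

Definition derivable_along (D : set V) (f : V -> W) (e x : V) : Prop :=
  cvg (quotient_along D f e x).

Definition deriv_along (D : set V) (f : V -> W) (e x : V) : W :=
  lim (quotient_along D f e x).

(* The sequence B lists a basis of the finite-dimensional space V. *)
Fixpoint class_C (B : seq V) (k : nat) (D : set V) (f : V -> W) : Prop :=
  {within D, continuous f} /\
  if k is k'.+1 then
    forall e, e \in B ->
      (forall x, D x -> derivable_along D f e x) /\
      class_C B k' D (deriv_along D f e)
  else True.

End DerivativesAlong.

Section Plane.
Context {R : realType}.

Definition dir1 : R * R := (1, 0).
Definition dir2 : R * R := (0, 1).
Definition dirs2 : seq (R * R) := [:: dir1; dir2].
Definition dirs3 : seq (R * (R * R)) := [:: (1, 0); (0, dir1); (0, dir2)].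
Definition half_plane : set (R * R) := [set z | 0 <= z.2].

End Plane.

Record chart (R : realType) (T : Type) := Chart {
  cdom : set T;
  cmap : T -> R * R;
  cinv : R * R -> T }.

Definition cimg (R : realType) (T : Type) (c : chart R T) : set (R * R) :=
  cmap c @` cdom c.

Definition is_chart (R : realType) (T : topologicalType) (c : chart R T) :=
  [/\ open (cdom c),
      exists2 O : set (R * R), open O & cimg c = O `&` half_plane,
      {within cdom c, continuous (cmap c)},
      {within cimg c, continuous (cinv c)} &
      forall p, cdom c p -> cinv c (cmap c p) = p].

Definition overlap (R : realType) (T : Type) (c c' : chart R T) :
    set (R * R) :=
  [set z | cimg c z /\ cdom c' (cinv c z)].

Definition transition (R : realType) (T : Type) (c c' : chart R T) :
    R * R -> R * R :=
  cmap c' \o cinv c.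

Definition oriented_compatible (R : realType) (T : Type) (c c' : chart R T) :=
  let D := overlap c c' in
  let t := transition c c' in
  (forall k, class_C dirs2 k D t) /\
  (forall z, D z ->
     let t1 := deriv_along D t dir1 z in
     let t2 := deriv_along D t dir2 z in
     0 < t1.1 * t2.2 - t2.1 * t1.2).

(* Compact connected oriented smooth surfaces with (possibly empty) boundary;
   the oriented smooth atlas is {chart_at p | p}, with values in the closed
   upper half-plane.  Second countability follows from compactness. *)
Record surface (R : realType) := Surface {
  carrier :> ptopologicalType;
  chart_at : carrier -> chart R carrier;
  surface_hausdorff : hausdorff_space carrier;
  surface_compact : compact [set: carrier];
  surface_connected : connected [set: carrier];
  chart_at_dom : forall p, cdom (chart_at p) p;
  chart_at_chart : forall p, is_chart (chart_at p);
  chart_at_compatible : forall p q,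
    oriented_compatible (chart_at p) (chart_at q) }.

Definition surface_interior (R : realType) (S : surface R) : set S :=
  [set p | 0 < (cmap (chart_at p) p).2].

Definition local (R : realType) (T U : Type) (c : chart R T) (f : T -> U) :
    R * R -> U := f \o cinv c.

Definition surface_C (R : realType) (S : surface R) (W : normedModType R)
    (k : nat) (f : S -> W) : Prop :=
  forall p,
    class_C dirs2 k (cimg (chart_at p)) (local (chart_at p) f).

Section Euclidean3.
Context {R : realType}.

Definition dot (u v : 'rV[R]_3) : R := \sum_(i < 3) u 0 i * v 0 i.

(* Indices are added modulo 3. *)
Definition cross (u v : 'rV[R]_3) : 'rV[R]_3 :=
  \row_(i < 3) (u 0 (i + 1) * v 0 (i + 2%:R) - u 0 (i + 2%:R) * v 0 (i + 1)).

End Euclidean3.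

Section Minkowski.
Context {R : realType}.

Definition mk5 (x : 'rV[R]_3) (a b : R) : 'rV[R]_5 :=
  row_mx x (row_mx a%:M b%:M).

Definition mink (u v : 'rV[R]_5) : R :=
  \sum_(i < 5) (if i == ord_max then - (u 0 i * v 0 i) else u 0 i * v 0 i).

Definition deSitter : set 'rV[R]_5 := [set y | mink y y = 1].

Definition lvec : 'rV[R]_5 := mk5 0 1 1.

Definition deSitter_proj (y v : 'rV[R]_5) : 'rV[R]_5 := v - mink y v *: y.

Definition potential (z : 'rV[R]_5) : R := z 0 (inord 3) - z 0 (inord 4).

End Minkowski.

Section Geometry.
Context {R : realType} {S : surface R}.
Implicit Types (X : S -> 'rV[R]_3) (c : chart R S) (z : R * R) (p : S).

Definition partial1 (W : normedModType R) c (f : S -> W) : R * R -> W :=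
  deriv_along (cimg c) (local c f) dir1.
Definition partial2 (W : normedModType R) c (f : S -> W) : R * R -> W :=
  deriv_along (cimg c) (local c f) dir2.

Definition immersion (k : nat) X : Prop :=
  surface_C k X /\
  forall p, let z := cmap (chart_at p) p in
    row_free (col_mx (partial1 (chart_at p) X z) (partial2 (chart_at p) X z)).

(* First fundamental form in the chart c. *)
Definition g11 X c z : R := dot (partial1 c X z) (partial1 c X z).
Definition g12 X c z : R := dot (partial1 c X z) (partial2 c X z).
Definition g22 X c z : R := dot (partial2 c X z) (partial2 c X z).
Definition area_density X c z : R :=
  Num.sqrt (g11 X c z * g22 X c z - g12 X c z ^+ 2).

(* Orthonormal frame of the induced metric obtained from the coordinate frame
   by Gram-Schmidt; tangent vectors are given by their coordinates. *)
Definition frame1 X c z : R * R := ((Num.sqrt (g11 X c z))^-1, 0).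
Definition frame2 X c z : R * R :=
  (- g12 X c z / (Num.sqrt (g11 X c z) * area_density X c z),
   Num.sqrt (g11 X c z) / area_density X c z).

Definition dmap (W : normedModType R) c (f : S -> W) z (a : R * R) : W :=
  a.1 *: partial1 c f z + a.2 *: partial2 c f z.

Definition d1 (W : normedModType R) X (f : S -> W) p : W :=
  let c := chart_at p in let z := cmap c p in dmap c f z (frame1 X c z).
Definition d2 (W : normedModType R) X (f : S -> W) p : W :=
  let c := chart_at p in let z := cmap c p in dmap c f z (frame2 X c z).

(* Laplace-Beltrami operator of the induced metric in local coordinates:
   G^-1 * \sum_(i, j) d_i (G * g^ij * d_j f), where G is the area density, so
   that G * g^11 = g22 / G, G * g^12 = - g12 / G and G * g^22 = g11 / G. *)
Definition laplace (W : normedModType R) X (f : S -> W) p : W :=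
  let c := chart_at p in
  let G := area_density X c in
  let flux1 z := (g22 X c z / G z) *: partial1 c f z
                 - (g12 X c z / G z) *: partial2 c f z in
  let flux2 z := (g11 X c z / G z) *: partial2 c f z
                 - (g12 X c z / G z) *: partial1 c f z in
  let z0 := cmap c p in
  (G z0)^-1 *: (deriv_along (cimg c) flux1 dir1 z0
                + deriv_along (cimg c) flux2 dir2 z0).

(* Unit normal compatible with the orientation of the surface. *)
Definition normal X p : 'rV[R]_3 :=
  let c := chart_at p in
  let n := cross (partial1 c X (cmap c p)) (partial2 c X (cmap c p)) in
  (Num.sqrt (dot n n))^-1 *: n.

(* 2H = - tr(d nu) and K = det(d nu), where d nu is the endomorphism of the
   tangent plane whose matrix in the orthonormal frame has entries
   <d nu(e_i), dX(e_j)>. *)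
Definition mean_curvature X p : R :=
  - (dot (d1 X (normal X) p) (d1 X X p)
     + dot (d2 X (normal X) p) (d2 X X p)) / 2%:R.

Definition gauss_curvature X p : R :=
  dot (d1 X (normal X) p) (d1 X X p) * dot (d2 X (normal X) p) (d2 X X p)
  - dot (d1 X (normal X) p) (d2 X X p) * dot (d2 X (normal X) p) (d1 X X p).

Definition support_function X p : R := dot (X p) (normal X p).

Definition lightcone_lift X p : 'rV[R]_5 :=
  mk5 (X p) ((dot (X p) (X p) - 1) / 2%:R) ((dot (X p) (X p) + 1) / 2%:R).

Definition conformal_gauss_map (co : R) X p : 'rV[R]_5 :=
  (mean_curvature X p + co) *: lightcone_lift X p
  + mk5 (normal X p) (support_function X p) (support_function X p).

(* Euler-Lagrange equation of \int (H + co)^2 for compactly supported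
   variations. *)
Definition helfrich_critical (co : R) X : Prop :=
  forall p, surface_interior p ->
    let H := mean_curvature X in
    let K := gauss_curvature X in
    laplace X (H : S -> R^o) p
    + 2%:R * (H p + co) * (H p * (H p - co) - K p) = 0.

Definition dnorm2 X (Z : S -> 'rV[R]_5) p : R :=
  mink (d1 X Z p) (d1 X Z p) + mink (d2 X Z p) (d2 X Z p).

Local Notation borel := (g_sigma_algebraType (@open S)).

(* The area measure of the induced metric is the unique Borel measure with
   density sqrt(det g) in every chart. *)
Definition area_measure X (mu : {measure set borel -> \bar R}) : Prop :=
  forall p (A : set borel), measurable A -> A `<=` cdom (chart_at p) ->
    (mu A = \int[(@lebesgue_measure R \x @lebesgue_measure R)%E]_(z in
      cmap (chart_at p) @` A) (area_density X (chart_at p) z)%:E)%E.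

Definition energy (co : R) X (mu : {measure set borel -> \bar R})
    (Z : S -> 'rV[R]_5) : R :=
  \int[mu]_(p in [set: borel]) (dnorm2 X Z p + 4%:R * co * potential (Z p)).

(* Compactly supported variations (Z t), |t| < eps, of Y among maps into the
   de Sitter space, of class C^2 jointly in t and the point. *)
Definition variation (eps : R) (Y : S -> 'rV[R]_5)
    (Z : R -> S -> 'rV[R]_5) : Prop :=
  let I := [set t : R | - eps < t < eps] in
  [/\ Z 0 = Y,
      forall t p, I t -> deSitter (Z t p),
      forall p, class_C dirs3 2
                  (I `*` cimg (chart_at p))
                  (fun tz : R * (R * R) => local (chart_at p) (Z tz.1) tz.2) &
      exists K : set S, [/\ compact K, K `<=` @surface_interior R S &
        forall t p, I t -> ~ K p -> Z t p = Y p]].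

Definition energy_critical (co : R) X (mu : {measure set borel -> \bar R})
    (Y : S -> 'rV[R]_5) : Prop :=
  [/\ surface_C 2 Y, forall p, deSitter (Y p) &
      forall (eps : R) (Z : R -> S -> 'rV[R]_5), 0 < eps ->
        variation eps Y Z ->
        is_derive (0 : R) (1 : R) (fun t => energy co X mu (Z t)) 0].

End Geometry.

(* Main.v *)
Require Import Defs.
From HB Require Import structures.
From mathcomp Require Import all_boot all_order all_algebra.
From mathcomp Require Import all_classical all_reals all_analysis.
From mathcomp Require Import measurable_realfun.
From mathcomp Require Import ring lra.
From mathcomp Require finmap.
Import Order.TTheory GRing.Theory Num.Theory.
Import numFieldNormedType.Exports.
Local Open Scope classical_set_scope.
Local Open Scope ring_scope.

(** Both equivalences come from one pointwise identity. Let E be the left-hand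
    side of the Euler-Lagrange equation of the Helfrich energy, and let C be the
    embedding of Euclidean space into the light cone. For every immersion
    - Laplacian of Y + |dY|^2 Y - 2 co l^T = E C(X)
    ([tension_identity]; in coordinates [gauss_map_tension]). It is a computation
    with the vector-valued fluxes, that is the density times the gradient: the
    fluxes of X and of the normal are cross products of first derivatives of X
    and of the normal, so that in their divergence the second derivatives cancel
    as mixed partial derivatives agree, and what is left is the trace and the
    determinant of the shape operator. As C(X) vanishes nowhere, the tension
    equation for Y means E = 0. The tension equation is stated on all of the
    surface and criticality only in its interior; E is continuous, and interior
    points are dense ([helfrich_el_vanishes]).

    Geometric quantities at a point are defined in the chart centred there. To
    differentiate them they have to be known in a fixed chart, hence the proof
    that normal, curvatures, Laplacian and squared norm of a differential do not
    depend on the chart. For the Laplacian this says that the divergence of a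
    flux transforms like a density, because the rows of the cofactor matrix of
    the Jacobian are divergence free ([lap_chart]). Charts take values in a closed
    half-plane, so the calculus needed (chain rule, equality of mixed partial
    derivatives, mean values) is done for derivatives along a set, up to its
    boundary.

    For the second equivalence, let Z_t be a variation of Y in de Sitter space
    and V its initial velocity. The energy is differentiated under the integral
    sign; its density is jointly smooth in time and point, its rate of change is
    bounded by compactness, and the area is finite ([energy_is_derive]). The
    derivative is the integral of 2 <dY, dV> + 4 co <V, l>. Green's formula
    ([green_formula]) turns <dY, dV> into -<Laplacian of Y, V>: it follows from the
    divergence theorem in a box of a chart, after cutting V into pieces with bump
    functions. By the tension identity, and since V is orthogonal to Y, the first
    variation is
    - the integral of -2 E <C(X), V>
    ([first_variation]). If E = 0, then Y is critical. Conversely, the velocity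
    can be prescribed enough to detect E: the null rotations, Lorentz
    transformations that fix l and act on the light cone as translations, move Y
    inside de Sitter space, and the one in the i-th direction, localized by a bump
    b, has <C(X), V> = b nu_i, with nu the normal. If E is not zero at an interior
    point, choose i with nu_i not zero there and b supported where E nu_i keeps
    its sign: the first variation is then not zero ([critical_helfrich]). *)

Set Implicit Arguments.
Unset Strict Implicit.
Unset Printing Implicit Defensive.

(** * Derivatives along a direction inside a set *)

Section DirectionalDerivatives.
Context {R : realType}.

(** A relation rather than a limit, so that the rules of calculus apply before
    limits are known to exist or to be unique. *)
Definition has_deriv {V W : normedModType R} (D : set V) (f : V -> W)
  (e x : V) (l : W) : Prop := quotient_along D f e x --> l.

(** The times h at which x + h e is available in D; the filter has to be
    proper for derivatives along D to be unique. *)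
Definition times {V : normedModType R} (D : set V) (e x : V) :
  set_system R := within [set h : R | D (h *: e + x)] 0^'.

Definition reachable {V : normedModType R} (D : set V) (e x : V) : Prop :=
  ProperFilter (times D e x).

Section General.
Context {V W : normedModType R}.
Implicit Types (D : set V) (f g : V -> W) (e x : V) (l m : W) (a b : V -> R).

#[global] Instance times_filter D e x : Filter (times D e x).
Proof. exact: within_filter. Qed.

Lemma deriv_alongE D f e x l :
  reachable D e x -> has_deriv D f e x l -> deriv_along D f e x = l.
Proof. by move=> pf; apply: cvg_lim. Qed.

Lemma has_deriv_unique D f e x l m : reachable D e x ->
  has_deriv D f e x l -> has_deriv D f e x m -> l = m.
Proof. by move=> r /(deriv_alongE r) <- /(deriv_alongE r). Qed.

Lemma has_deriv_derivable D f e x l :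
  has_deriv D f e x l -> derivable_along D f e x.
Proof. by move=> h; apply/cvg_ex; exists l. Qed.

Lemma derivable_has_deriv D f e x :
  derivable_along D f e x -> has_deriv D f e x (deriv_along D f e x).
Proof. by []. Qed.

Lemma quotient_along_near D D' f g e x : (\forall y \near x, D y <-> D' y) ->
  (\forall y \near x, D y -> f y = g y) -> f x = g x ->
  quotient_along D f e x = quotient_along D' g e x.
Proof.
move=> DD' fg fgx.
have line (P : set V) : (\forall y \near x, P y) ->
    \forall h \near (0 : R)^', P (h *: e + x).
  move=> nP.
  have cl : (h *: e + x) @[h --> (0 : R)] --> x.
    rewrite -[X in _ --> X]add0r -(scale0r e).
    by apply: cvgD; [apply: cvgZr_tmp; exact: cvg_id|exact: cvg_cst].
  by rewrite near_withinE; near=> h => _; near: h; exact: (cl P nP).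
have quo (P Q : set V) (u v : V -> W) (A : set W) :
    (\forall y \near x, P y <-> Q y) -> (\forall y \near x, P y -> u y = v y) ->
    u x = v x -> (quotient_along P u e x) A -> (quotient_along Q v e x) A.
  move=> PQ uv uvx H.
  have {}H : \forall h \near (0 : R)^', P (h *: e + x) ->
    A (h^-1 *: (u (h *: e + x) - u x)) by exact: H.
  change (\forall h \near (0 : R)^', Q (h *: e + x) ->
    A (h^-1 *: (v (h *: e + x) - v x))).
  near=> h => Qh.
  have Ph : P (h *: e + x) by apply/(near (line _ PQ) h).
  by rewrite -uvx -(near (line _ uv) h) //; exact: (near H h).
apply/seteqP; split => A; apply: quo => //.
  by near do apply: iff_sym.
near=> y => D'y; symmetry; apply: (near fg y) => //.
exact/(near DD' y).
Unshelve. all: by end_near. Qed.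

Lemma has_deriv_near D D' f g e x l : (\forall y \near x, D y <-> D' y) ->
  (\forall y \near x, D y -> f y = g y) -> f x = g x ->
  has_deriv D f e x l -> has_deriv D' g e x l.
Proof. by move=> h1 h2 h3; rewrite /has_deriv (quotient_along_near e h1 h2 h3). Qed.

Lemma deriv_along_near D D' f g e x : (\forall y \near x, D y <-> D' y) ->
  (\forall y \near x, D y -> f y = g y) -> f x = g x ->
  deriv_along D f e x = deriv_along D' g e x.
Proof.
by move=> h1 h2 h3; rewrite /deriv_along (quotient_along_near e h1 h2 h3).
Qed.

Lemma has_deriv_ext D f g e x l : D x -> (forall y, D y -> f y = g y) ->
  has_deriv D f e x l -> has_deriv D g e x l.
Proof. by move=> Dx fg; apply: has_deriv_near; [near=> y|near=> y|exact: fg]; [|exact: fg].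
Unshelve. all: by end_near. Qed.

Lemma deriv_along_ext D f g e x : D x -> (forall y, D y -> f y = g y) ->
  deriv_along D f e x = deriv_along D g e x.
Proof. by move=> Dx fg; apply: deriv_along_near; [near=> y|near=> y|exact: fg]; [|exact: fg].
Unshelve. all: by end_near. Qed.

Lemma times_cvg0 D e x : h @[h --> times D e x] --> (0 : R).
Proof.
move=> A nA; change (\forall h \near (0 : R)^', D (h *: e + x) -> A h).
rewrite near_withinE; near=> h => _ _; near: h; exact: nA.
Unshelve. all: by end_near. Qed.

Lemma has_deriv_cvg D f e x l : has_deriv D f e x l ->
  f (h *: e + x) @[h --> times D e x] --> f x.
Proof.
move=> dl.
have : (h *: (h^-1 *: (f (h *: e + x) - f x)) + f x)
    @[h --> times D e x] --> 0 *: l + f x.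
  by apply: cvgD; [apply: cvgZ => //; exact: times_cvg0|exact: cvg_cst].
rewrite scale0r add0r; apply: cvg_trans.
apply: near_eq_cvg; rewrite /times near_withinE.
near=> h => _; rewrite scalerA divff ?scale1r ?subrK//.
by near: h; exact: nbhs_dnbhs_neq.
Unshelve. all: by end_near. Qed.

Lemma has_deriv_cst D (w : W) e x : has_deriv D (fun=> w) e x 0.
Proof.
rewrite /has_deriv /quotient_along; under eq_fun do rewrite subrr scaler0.
exact: cvg_cst.
Qed.

Lemma has_derivD D f g e x l m : has_deriv D f e x l -> has_deriv D g e x m ->
  has_deriv D (fun y => f y + g y) e x (l + m).
Proof.
move=> df dg; rewrite /has_deriv /quotient_along.
under eq_fun do rewrite opprD addrACA scalerDr.
exact: cvgD.
Qed.

Lemma has_derivN D f e x l : has_deriv D f e x l ->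
  has_deriv D (fun y => - f y) e x (- l).
Proof.
move=> df; rewrite /has_deriv /quotient_along.
under eq_fun do rewrite -opprD scalerN.
exact: cvgN.
Qed.

Lemma has_derivB D f g e x l m : has_deriv D f e x l -> has_deriv D g e x m ->
  has_deriv D (fun y => f y - g y) e x (l - m).
Proof. by move=> df dg; apply: has_derivD => //; exact: has_derivN. Qed.

Lemma has_derivZ D (a : V -> R) f e x (da : R) l :
  has_deriv D a e x da -> has_deriv D f e x l ->
  has_deriv D (fun y => a y *: f y) e x (da *: f x + a x *: l).
Proof.
move=> dA df; rewrite /has_deriv /quotient_along.
have -> : (fun h : R => h^-1 *: (a (h *: e + x) *: f (h *: e + x) - a x *: f x))
  = (fun h : R => (h^-1 *: (a (h *: e + x) - a x)) *: f (h *: e + x)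
       + a x *: (h^-1 *: (f (h *: e + x) - f x))).
  apply/funext => h; rewrite [a x *: (_ *: _)]scalerA [a x * _]mulrC -scalerA.
  have -> : forall (u : R) (w : W), (h^-1 *: u) *: w = h^-1 *: (u *: w).
    by move=> u w; rewrite scalerA.
  rewrite -scalerDr; congr (_ *: _).
  by rewrite scalerBl scalerBr addrA subrK.
apply: cvgD; first by apply: cvgZ => //; exact: has_deriv_cvg df.
exact: cvgZl_tmp.
Qed.

Lemma has_derivZl D (c : R) f e x l : has_deriv D f e x l ->
  has_deriv D (fun y => c *: f y) e x (c *: l).
Proof.
move=> df; rewrite /has_deriv /quotient_along.
under eq_fun do rewrite -scalerBr scalerA mulrC -scalerA.
exact: cvgZl_tmp.
Qed.

End General.

Section Scalar.
Context {V : normedModType R}.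
Implicit Types (D : set V) (a b : V -> R) (e x : V).

Lemma has_deriv_cst_scalar D (c : R) e x : has_deriv D (fun=> c) e x (0 : R).
Proof. exact: has_deriv_cst. Qed.

Lemma has_derivM D a b e x (da db : R) :
  has_deriv D a e x da -> has_deriv D b e x db ->
  has_deriv D (fun y => a y * b y) e x (da * b x + a x * db).
Proof. exact: has_derivZ. Qed.

Lemma has_deriv_sum {W : normedModType R} (I : Type) (r : seq I) D
    (f : I -> V -> W) e x (l : I -> W) :
  (forall i, has_deriv D (f i) e x (l i)) ->
  has_deriv D (fun y => \sum_(i <- r) f i y) e x (\sum_(i <- r) l i).
Proof.
move=> df; elim: r => [|i r IH].
  by rewrite big_nil; under eq_fun do rewrite big_nil; exact: has_deriv_cst.
by rewrite big_cons; under eq_fun do rewrite big_cons; exact: has_derivD.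
Qed.

(** The difference quotient of phi, extended by its limit, is continuous at a
    x; this covers the case where a takes the value a x at points close to x. *)
Lemma has_deriv_comp D a e x (da dphi : R) (phi : R -> R) :
  has_deriv D a e x da -> is_derive (a x) 1 phi dphi ->
  has_deriv D (fun y => phi (a y)) e x (dphi * da).
Proof.
move=> dA dphix.
pose psi u := if u == a x then dphi else (u - a x)^-1 * (phi u - phi (a x)).
have psiE u : phi u - phi (a x) = psi u * (u - a x).
  rewrite /psi; case: eqP => [->|/eqP ne]; first by rewrite !subrr mulr0.
  by rewrite mulrC mulrA divff ?mul1r// subr_eq0.
have psic : psi u @[u --> a x] --> psi (a x).
  apply/continuous_withinNshiftx; rewrite {2}/psi eqxx.
  have [+ +] := dphix; rewrite /derivable /derive => c <-.
  apply: cvg_trans c; apply: near_eq_cvg.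
  near=> h; rewrite /= /psi.
  have h0 : h != 0 by near: h; exact: nbhs_dnbhs_neq.
  rewrite -subr_eq0 addrK (negbTE h0).
  by rewrite /GRing.scale /= mulr1.
rewrite /has_deriv /quotient_along.
under eq_fun do rewrite psiE /GRing.scale/= mulrCA.
apply: cvgM => //.
have -> : dphi = psi (a x) by rewrite /psi eqxx.
apply: cvg_comp psic; exact: has_deriv_cvg dA.
Unshelve. all: by end_near. Qed.

Lemma has_derivV D a e x (da : R) : a x != 0 -> has_deriv D a e x da ->
  has_deriv D (fun y => (a y)^-1) e x (- (a x) ^- 2 * da).
Proof.
move=> ax0 dA; apply: (has_deriv_comp (phi := GRing.inv)) => //.
have := is_deriveV ax0 (is_derive_id (a x) (1 : R)).
by rewrite /GRing.scale /= mulr1.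
Qed.

Lemma has_deriv_sqrt D a e x (da : R) : 0 < a x -> has_deriv D a e x da ->
  has_deriv D (fun y => Num.sqrt (a y)) e x ((2 * Num.sqrt (a x))^-1 * da).
Proof.
by move=> ax0 dA; apply: (has_deriv_comp (phi := Num.sqrt)) => //; exact: is_derive1_sqrt.
Qed.

End Scalar.

Section Components.
Context {V : normedModType R}.
Implicit Types (D : set V) (e x : V).

Lemma cvg_rowP {T : Type} (F : set_system T) {FF : Filter F} n
    (f : T -> 'rV[R]_n) (l : 'rV[R]_n) :
  f t @[t --> F] --> l <-> forall i, f t 0 i @[t --> F] --> l 0 i.
Proof.
split=> [fl i|fl].
  have c : (fun M : 'rV[R]_n => M 0 i) M @[M --> l] --> l 0 i.
    exact: coord_continuous.
  exact: (cvg_comp _ _ fl c).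
apply/cvg_ballP => eps e0.
have H : F [set t | forall i, ball (l 0 i) eps (f t 0 i)].
  apply: (@filter_forall T 'I_n
    (fun i => [set t | ball (l 0 i) eps (f t 0 i)]) F FF) => i.
  by have /cvg_ballP/(_ _ e0) := fl i.
suff : F [set t | ball l eps (f t)] by [].
by apply: filterS H => t Ht; split=> // i j; rewrite (ord1 i); exact: Ht.
Qed.

Lemma has_deriv_rowP n D (f : V -> 'rV[R]_n) e x l :
  has_deriv D f e x l <-> forall i, has_deriv D (fun y => f y 0 i) e x (l 0 i).
Proof.
rewrite /has_deriv /quotient_along.
rewrite (@cvg_rowP _ (times D e x) _); split=> h i; have := h i.
  by under eq_fun do rewrite !mxE.
by under [in X in _ -> X]eq_fun do rewrite !mxE.
Qed.

Lemma has_deriv_fst D (f : V -> R * R) e x l :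
  has_deriv D f e x l -> has_deriv D (fun y => (f y).1) e x l.1.
Proof.
by move=> df; exact: (cvg_comp _ _ df (@cvg_fst _ _ (nbhs l.1) (nbhs l.2) _)).
Qed.

Lemma has_deriv_snd D (f : V -> R * R) e x l :
  has_deriv D f e x l -> has_deriv D (fun y => (f y).2) e x l.2.
Proof.
by move=> df; exact: (cvg_comp _ _ df (@cvg_snd _ _ (nbhs l.1) (nbhs l.2) _)).
Qed.

End Components.
End DirectionalDerivatives.

(** * Functions of class C^k along a set *)

Section ClassC.
Context {R : realType}.

(** One-sided motion is enough for derivatives along D to be unique; it is
    available on a half-plane up to the boundary line. *)
Definition accessible {V : normedModType R} (B : seq V) (D : set V) : Prop :=
  forall e, e \in B -> forall x, D x -> \forall h \near 0^'+, D (h *: e + x).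

Lemma nbhs_at_right (P : set R) (x : R) :
  (\forall h \near x, P h) -> \forall h \near x^'+, P h.
Proof.
move=> nP; rewrite near_withinE; near=> h => _; near: h; exact: nP.
Unshelve. all: by end_near. Qed.

Lemma dnbhs_at_right (P : set R) (x : R) :
  (\forall h \near x^', P h) -> \forall h \near x^'+, P h.
Proof.
rewrite !near_withinE => nP; near=> h => xh; apply: (near nP h) => //.
by rewrite /= gt_eqF.
Unshelve. all: by end_near. Qed.

Section General.
Context {V : normedModType R} (B : seq V).
Implicit Types (D U : set V).

Lemma accessible_reachable D e x :
  accessible B D -> e \in B -> D x -> reachable D e x.
Proof.
move=> aD eB Dx; split; last exact: times_filter.
move=> H.
have {}H : \forall h \near (0 : R)^', D (h *: e + x) -> False by exact: H.
have H1 : \forall h \near (0 : R)^'+, D (h *: e + x) -> False.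
  exact: dnbhs_at_right.
have H2 : \forall h \near (0 : R)^'+, False.
  near=> h; apply: (near H1 h) => //.
  by near: h; exact: aD.
by have [h] := @filter_ex _ _ (at_right_proper_filter (0 : R)) _ H2.
Unshelve. all: by end_near. Qed.

Lemma line_near (P : set V) e x : (\forall y \near x, P y) ->
  \forall h \near (0 : R), P (h *: e + x).
Proof.
move=> nP.
have cl : (h *: e + x) @[h --> (0 : R)] --> x.
  rewrite -[X in _ --> X]add0r -(scale0r e).
  by apply: cvgD; [apply: cvgZr_tmp; exact: cvg_id|exact: cvg_cst].
exact: (cl P nP).
Qed.

Lemma nbhs_setIl D U x : open U -> U x -> \forall y \near x, D y <-> (D `&` U) y.
Proof.
move=> oU Ux; have : \forall y \near x, U y by exact: open_nbhs_nbhs.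
by apply: filterS => y Uy; split=> [//|[]].
Qed.

Section Target.
Context {W : normedModType R}.
Implicit Types (f g : V -> W).

Lemma class_C_continuous k D f : class_C B k D f -> {within D, continuous f}.
Proof. by case: k => [|k] []. Qed.

Lemma class_C_has_deriv k D f e x : class_C B k.+1 D f -> e \in B -> D x ->
  has_deriv D f e x (deriv_along D f e x).
Proof. by move=> [_ Cf] eB Dx; apply: derivable_has_deriv; exact: (Cf e eB).1. Qed.

Lemma class_C_deriv k D f e : class_C B k.+1 D f -> e \in B ->
  class_C B k D (deriv_along D f e).
Proof. by move=> [_ Cf] eB; exact: (Cf e eB).2. Qed.

Lemma class_C_pred k D f : class_C B k.+1 D f -> class_C B k D f.
Proof.
elim: k f => [|k IH] f [cf Cf]; first by split.
split=> // e eB; split; first exact: (Cf e eB).1.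
exact/IH/(Cf e eB).2.
Qed.

Lemma class_C_le k m D f : (k <= m)%N -> class_C B m D f -> class_C B k D f.
Proof.
elim: m k => [|m IH] k; first by rewrite leqn0 => /eqP ->.
rewrite leq_eqVlt => /orP[/eqP->//|km] Cf.
by apply: IH => //; exact: class_C_pred.
Qed.

Lemma continuous_within_ext D f g : (forall y, D y -> f y = g y) ->
  {within D, continuous f} -> {within D, continuous g}.
Proof.
move=> fg; apply: subspace_eq_continuous => y; rewrite inE => Dy.
exact: fg.
Qed.

Lemma class_C_ext k D f g : (forall y, D y -> f y = g y) ->
  class_C B k D f -> class_C B k D g.
Proof.
elim: k f g => [|k IH] f g fg [cf Cf]; split=> //;
  try exact: continuous_within_ext fg cf.
move=> e eB; split.
  move=> x Dx; apply/has_deriv_derivable/(has_deriv_ext Dx fg).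
  by apply: derivable_has_deriv; exact: (Cf e eB).1.
apply: IH (Cf e eB).2 => y Dy; exact: deriv_along_ext.
Qed.

(** Closure of C^k under the operations of algebra reduces to this by induction
    on k: it only remains to exhibit derivatives built from known functions. *)
Lemma class_C_succ k D f (df : V -> V -> W) : accessible B D ->
  {within D, continuous f} ->
  (forall e, e \in B -> forall x, D x -> has_deriv D f e x (df e x)) ->
  (forall e, e \in B -> class_C B k D (df e)) -> class_C B k.+1 D f.
Proof.
move=> aD cf hdf Cdf; split=> // e eB; split.
  by move=> x Dx; apply: has_deriv_derivable; exact: hdf.
apply: class_C_ext (Cdf e eB) => x Dx; symmetry; apply: deriv_alongE.
  exact: accessible_reachable aD eB Dx.
exact: hdf.
Qed.

Lemma within_openI_nbhs D U x : open U -> U x ->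
  within (D `&` U) (nbhs x) = within D (nbhs x).
Proof.
move=> oU Ux; have nU : \forall y \near x, U y by exact: open_nbhs_nbhs.
apply/seteqP; split => A.
  move=> H; have {}H : \forall y \near x, (D `&` U) y -> A y by exact: H.
  change (\forall y \near x, D y -> A y).
  by near=> y => Dy; apply: (near H y) => //; split=> //; exact: (near nU y).
move=> H; have {}H : \forall y \near x, D y -> A y by exact: H.
change (\forall y \near x, (D `&` U) y -> A y).
by near=> y => -[Dy _]; apply: (near H y).
Unshelve. all: by end_near. Qed.

(** Derivatives along D only see D near the point. *)
Lemma class_C_local k D f :
  (forall x, D x -> exists2 U, open U /\ U x & class_C B k (D `&` U) f) ->
  class_C B k D f.
Proof.
elim: k f => [|k IH] f loc; (have cf : {within D, continuous f};
  [apply/subspace_continuousP => x Dx; have [U [oU Ux] /class_C_continuous] :=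
     loc x Dx; move=> /subspace_continuousP/(_ x (conj Dx Ux));
     by rewrite within_openI_nbhs|]); first by split.
split=> // e eB; split.
  move=> x Dx; have [U [oU Ux] Cf] := loc x Dx.
  have := class_C_has_deriv Cf eB (conj Dx Ux).
  move=> dfx; apply: has_deriv_derivable; apply: has_deriv_near dfx => //.
    by near do apply: iff_sym; exact: nbhs_setIl.
  by near=> y.
apply: IH => x Dx; have [U [oU Ux] Cf] := loc x Dx; exists U => //.
apply: class_C_ext (class_C_deriv Cf eB) => y [Dy Uy].
apply: deriv_along_near => //.
  by near do apply: iff_sym; exact: nbhs_setIl.
by near=> z.
Unshelve. all: by end_near. Qed.

Lemma class_C_cst k D (w : W) : accessible B D -> class_C B k D (fun=> w).
Proof.
move=> aD; elim: k w => [|k IH] w; first by split=> //; exact: cst_continuous.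
apply: (class_C_succ (df := fun _ _ => 0)) => //.
  exact: cst_continuous.
by move=> e eB x Dx; exact: has_deriv_cst.
Qed.

Lemma class_C_add k D f g : accessible B D ->
  class_C B k D f -> class_C B k D g -> class_C B k D (fun y => f y + g y).
Proof.
move=> aD; elim: k f g => [|k IH] f g Cf Cg; have cfg :
    {within D, continuous (fun y => f y + g y)} by
  move=> x; apply: cvgD; [exact: class_C_continuous Cf x|
                          exact: class_C_continuous Cg x].
  by split.
apply: (class_C_succ (df := fun e y => deriv_along D f e y + deriv_along D g e y)) => //.
  by move=> e eB x Dx; apply: has_derivD; apply: class_C_has_deriv; eauto.
by move=> e eB; apply: IH; exact: class_C_deriv.
Qed.

End Target.

Section Scaling.
Context {W : normedModType R}.
Implicit Types (f g : V -> W).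

Lemma class_C_scale k D (a : V -> R) f : accessible B D ->
  class_C B k D a -> class_C B k D f -> class_C B k D (fun y => a y *: f y).
Proof.
move=> aD; elim: k a f => [|k IH] a f Ca Cf; have caf :
    {within D, continuous (fun y => a y *: f y)}.
- by move=> x; apply: cvgZ; [case: Ca => + _; exact|case: Cf => + _; exact].
- by split.
- by move=> x; apply: cvgZ; [case: Ca => + _; exact|case: Cf => + _; exact].
apply: (class_C_succ (df := fun e y => deriv_along D a e y *: f y
                                       + a y *: deriv_along D f e y)) => //.
  move=> e eB x Dx; have dA := class_C_has_deriv Ca eB Dx.
  by have := has_derivZ dA (class_C_has_deriv Cf eB Dx).
move=> e eB; apply: class_C_add => //; apply: IH.
- exact: class_C_deriv.
- exact: class_C_pred.
- exact: class_C_pred.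
- exact: class_C_deriv.
Qed.

Lemma class_C_scalel k D (c : R) f : accessible B D ->
  class_C B k D f -> class_C B k D (fun y => c *: f y).
Proof.
move=> aD Cf; apply: class_C_scale => //.
elim: k {Cf} c => [|k IH] c; first by split=> //; exact: cst_continuous.
apply: (class_C_succ (df := fun _ _ => 0)) => //.
  exact: cst_continuous.
by move=> e eB x Dx; exact: has_deriv_cst.
Qed.

Lemma class_C_opp k D f : accessible B D ->
  class_C B k D f -> class_C B k D (fun y => - f y).
Proof.
move=> aD Cf; apply: (class_C_ext (f := fun y => (-1) *: f y)).
  by move=> y _; rewrite scaleN1r.
exact: class_C_scalel.
Qed.

Lemma class_C_sub k D f g : accessible B D ->
  class_C B k D f -> class_C B k D g -> class_C B k D (fun y => f y - g y).
Proof. by move=> aD Cf Cg; apply: class_C_add => //; exact: class_C_opp. Qed.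

Lemma class_C_sum k D (I : Type) (r : seq I) (f : I -> V -> W) :
  accessible B D -> (forall i, class_C B k D (f i)) ->
  class_C B k D (fun y => \sum_(i <- r) f i y).
Proof.
move=> aD Cf; elim: r => [|i r IH].
  by under eq_fun do rewrite big_nil; exact: class_C_cst.
by under eq_fun do rewrite big_cons; exact: class_C_add.
Qed.

End Scaling.

Lemma class_C_mul k D (a b : V -> R) : accessible B D ->
  class_C B k D a -> class_C B k D b -> class_C B k D (fun y => a y * b y).
Proof. exact: class_C_scale. Qed.

Lemma continuous_within_comp D (a : V -> R) (phi : R -> R) :
  {within D, continuous a} -> (forall x, D x -> {for a x, continuous phi}) ->
  {within D, continuous (fun y => phi (a y))}.
Proof.
move=> /subspace_continuousP ca cphi; apply/subspace_continuousP => x Dx.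
exact: (cvg_comp _ _ (ca x Dx) (cphi x Dx)).
Qed.

Lemma class_C_inv k D (a : V -> R) : accessible B D ->
  (forall x, D x -> a x != 0) -> class_C B k D a ->
  class_C B k D (fun y => (a y)^-1).
Proof.
move=> aD a0; elim: k => [|k IH] Ca; have ca :
    {within D, continuous (fun y => (a y)^-1)} by
  (apply: continuous_within_comp; [exact: class_C_continuous Ca|
   by move=> x Dx; apply: inv_continuous; exact: a0]).
  by split.
have IHk := IH (class_C_pred Ca).
apply: (class_C_succ
  (df := fun e y => - ((a y)^-1 * (a y)^-1) * deriv_along D a e y)) => //.
  move=> e eB x Dx; have -> : - ((a x)^-1 * (a x)^-1) = - (a x) ^- 2.
    by rewrite expr2 invfM.
  by apply: has_derivV; [exact: a0|exact: class_C_has_deriv Ca eB Dx].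
move=> e eB; apply: class_C_mul => //; last exact: class_C_deriv.
by apply: class_C_opp => //; exact: class_C_mul.
Qed.

Lemma class_C_sqrt k D (a : V -> R) : accessible B D ->
  (forall x, D x -> 0 < a x) -> class_C B k D a ->
  class_C B k D (fun y => Num.sqrt (a y)).
Proof.
move=> aD a0; elim: k => [|k IH] Ca; have ca :
    {within D, continuous (fun y => Num.sqrt (a y))} by
  (apply: continuous_within_comp; [exact: class_C_continuous Ca|
   by move=> x Dx; exact: sqrt_continuous]).
  by split.
have IHk := IH (class_C_pred Ca).
apply: (class_C_succ
  (df := fun e y => (2 * Num.sqrt (a y))^-1 * deriv_along D a e y)) => //.
  move=> e eB x Dx; apply: has_deriv_sqrt; first exact: a0.
  exact: class_C_has_deriv Ca eB Dx.
move=> e eB; apply: class_C_mul => //; last exact: class_C_deriv.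
apply: class_C_inv => //.
  by move=> x Dx; rewrite mulf_neq0// lt0r_neq0// sqrtr_gt0 a0.
by apply: class_C_mul => //; exact: class_C_cst.
Qed.

Lemma continuous_within_row D n (f : V -> 'rV[R]_n) :
  {within D, continuous f} <-> forall i, {within D, continuous (fun y => f y 0 i)}.
Proof.
split=> [/subspace_continuousP cf i|cf].
  by apply/subspace_continuousP => x Dx; move/cvg_rowP: (cf x Dx); exact.
apply/subspace_continuousP => x Dx; apply/cvg_rowP => i.
by move/subspace_continuousP: (cf i); exact.
Qed.

Lemma class_C_row k D n (f : V -> 'rV[R]_n) : accessible B D ->
  class_C B k D f <-> forall i, class_C B k D (fun y => f y 0 i).
Proof.
move=> aD; elim: k f => [|k IH] f.
  split=> [[/continuous_within_row cf _] i|cf]; split=> //.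
  by apply/continuous_within_row => i; case: (cf i).
split=> [Cf i|Cf].
  apply: (class_C_succ (df := fun e y => deriv_along D f e y 0 i)) => //.
  - by move/class_C_continuous/continuous_within_row: Cf; exact.
  - move=> e eB x Dx.
    by have /has_deriv_rowP := class_C_has_deriv Cf eB Dx; exact.
  - by move=> e eB; have /IH := class_C_deriv Cf eB; exact.
apply: (class_C_succ
  (df := fun e y => \row_i deriv_along D (fun y => f y 0 i) e y)) => //.
- by apply/continuous_within_row => i; exact: class_C_continuous (Cf i).
- move=> e eB x Dx; apply/has_deriv_rowP => i; rewrite mxE.
  exact: class_C_has_deriv (Cf i) eB Dx.
- move=> e eB; apply/IH => i; under eq_fun do rewrite mxE.
  exact: class_C_deriv.
Qed.

End General.
End ClassC.

(** * Calculus up to the boundary of a half-plane *)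

Section HalfPlaneCalculus.
Context {R : realType}.

Definition relopen (D : set (R * R)) : Prop :=
  exists2 O : set (R * R), open O & D = O `&` half_plane.

Lemma has_deriv_line {V W : normedModType R} (D : set V) (f : V -> W)
    (e x : V) (s : R) l :
  has_deriv D f e (s *: e + x) l ->
  has_deriv [set u | D (u *: e + x)] (fun u => f (u *: e + x)) 1 s l.
Proof.
rewrite /has_deriv /quotient_along /=.
under [in X in _ -> X]eq_fun do rewrite scalerDl -addrA [_ *: 1]mulr1.
have -> // : [set h : R | D ((h *: (1 : R) + s) *: e + x)] =
           [set h | D (h *: e + (s *: e + x))].
by apply/seteqP; split => h /=; rewrite scalerDl -addrA [_ *: 1]mulr1.
Qed.

Lemma has_deriv_is_derive (I : set R) (g : R -> R) s l :
  (\forall u \near s, I u) -> has_deriv I g 1 s l -> is_derive s 1 g l.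
Proof.
move=> nI dg.
have {}dg : has_deriv setT g 1 s l.
  apply: has_deriv_near dg => //; last by near=> y.
  by near=> y; split=> // _; exact: (near nI y).
have c : h^-1 *: (g (h *: 1 + s) - g s) @[h --> 0^'] --> l.
  move=> A /dg H; have {}H : \forall h \near (0 : R)^',
     setT (h *: 1 + s) -> A (h^-1 *: (g (h *: 1 + s) - g s)) by exact: H.
  change (\forall h \near (0 : R)^', A (h^-1 *: (g (h *: 1 + s) - g s))).
  by near=> h; apply: (near H h).
apply: DeriveDef; first by apply/cvg_ex; exists l.
exact: cvg_lim c.
Unshelve. all: by end_near. Qed.

Section Segments.
Context {V : normedModType R} (D : set V) (f : V -> R) (e x : V) (a b : R).
Hypothesis cf : {within D, continuous f}.
Hypothesis segD : forall s, a <= s <= b -> D (s *: e + x).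
Hypothesis dseg : forall s, a <= s <= b -> derivable_along D f e (s *: e + x).

Lemma segment_is_derive s : s \in `]a, b[ ->
  is_derive s 1 (fun u => f (u *: e + x)) (deriv_along D f e (s *: e + x)).
Proof.
move=> sI; apply: (@has_deriv_is_derive [set u | D (u *: e + x)]).
  have := near_in_itvoo sI.
  apply: filterS => u; rewrite /= in_itv /= => /andP[ua ub].
  by apply: segD; rewrite !ltW.
apply: has_deriv_line; apply: dseg; move: sI; rewrite in_itv /= => /andP[sa sb].
by rewrite !ltW.
Qed.

Lemma segment_continuous : {within `[a, b], continuous (fun u => f (u *: e + x))}.
Proof.
apply/subspace_continuousP => s; rewrite /= in_itv /= => sI.
move/subspace_continuousP: cf => /(_ _ (segD sI)) c.
apply: cvg_comp c => A /= nA.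
have {}nA : \forall y \near s *: e + x, D y -> A y by exact: nA.
change (\forall u \near s, u \in `[a, b] -> A (u *: e + x)).
have cl : (u *: e + x) @[u --> s] --> s *: e + x.
  by apply: cvgD; [exact: scalel_continuous|exact: cvg_cst].
have H : \forall u \near s, D (u *: e + x) -> A (u *: e + x) by exact: (cl _ nA).
near=> u => uI; apply: (near H u) => //; apply: segD.
by move: uI; rewrite in_itv.
Unshelve. all: by end_near. Qed.

End Segments.

Lemma mvt_along {V : normedModType R} (D : set V) (f : V -> R) (e x : V) (a : R) :
  0 < a -> {within D, continuous f} ->
  (forall s, 0 <= s <= a -> D (s *: e + x)) ->
  (forall s, 0 <= s <= a -> derivable_along D f e (s *: e + x)) ->
  exists2 s, 0 < s < a &
    f (a *: e + x) - f x = a * deriv_along D f e (s *: e + x).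
Proof.
move=> a0 cf sD df.
have [s sI] := MVT a0 (segment_is_derive sD df) (segment_continuous cf sD).
by rewrite scale0r add0r subr0 mulrC => E; exists s => //; move: sI; rewrite in_itv.
Qed.

Lemma dir1_line (s : R) (y : R * R) : s *: dir1 + y = (s + y.1, y.2).
Proof.
case: y => u v; congr pair; rewrite /=; first by rewrite [s *: 1]mulr1.
by rewrite scaler0 add0r.
Qed.

Lemma dir2_line (s : R) (y : R * R) : s *: dir2 + y = (y.1, s + y.2).
Proof.
case: y => u v; congr pair; rewrite /=; first by rewrite scaler0 add0r.
by rewrite [s *: 1]mulr1.
Qed.

Lemma box_near (x : R * R) (P : set (R * R)) : (\forall y \near x, P y) ->
  exists2 d : R, 0 < d &
    forall y, `|y.1 - x.1| < d -> `|y.2 - x.2| < d -> P y.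
Proof.
move=> /nbhs_ballP[d /= d0 bP]; exists d => // y y1 y2.
by apply: bP; split; rewrite /ball /= distrC.
Qed.

Lemma near_box (x : R * R) (d : R) : 0 < d ->
  \forall y \near x, `|y.1 - x.1| < d /\ `|y.2 - x.2| < d.
Proof.
move=> d0; apply/nbhs_ballP; exists d => // y [y1 y2].
by split; rewrite distrC.
Qed.

Lemma relopen_box D x : relopen D -> D x -> exists2 d : R, 0 < d &
  forall y, `|y.1 - x.1| < d -> `|y.2 - x.2| < d -> 0 <= y.2 -> D y.
Proof.
move=> [G oG ->] [Ox _].
have [d d0 dO] := box_near (open_nbhs_nbhs (conj oG Ox)).
by exists d => // y y1 y2 y0; split; [exact: dO|].
Qed.

Lemma relopen_half D x : relopen D -> D x -> 0 <= x.2.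
Proof. by move=> [G _ ->] []. Qed.

Lemma relopen_openI D U : relopen D -> open U -> relopen (D `&` U).
Proof.
move=> [G oG ->] oU; exists (G `&` U); first exact: openI.
by rewrite setIAC.
Qed.

Lemma relopen_accessible D : relopen D -> accessible dirs2 D.
Proof.
move=> [G oG ->] e ed x [Ox Hx].
have On : \forall h \near (0 : R), G (h *: e + x).
  by apply: line_near; exact: open_nbhs_nbhs.
near=> h; split; first by near: h; exact: nbhs_at_right.
rewrite /half_plane /=; apply: addr_ge0 => //.
apply: mulr_ge0; first by near: h; exact: nbhs_right_ge.
by move: ed; rewrite !inE => /orP[] /eqP ->.
Unshelve. all: by end_near. Qed.

(** ** Slopes and the chain rule *)

Section Slopes.
Variables (D : set (R * R)) (f : R * R -> R) (x : R * R).
Hypotheses (rD : relopen D) (Cf : class_C dirs2 1 D f) (Dx : D x).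

(** Hadamard decomposition: the path from x to y through (y.1, x.2) splits the
    increment of f into a horizontal and a vertical one, and each is an
    increment of a coordinate times a slope. The slopes tend to the partial
    derivatives even at boundary points, because the path stays in the half-
    plane. *)
Definition slope1 (y : R * R) : R :=
  if y.1 == x.1 then deriv_along D f dir1 x
  else (f (y.1, x.2) - f x) / (y.1 - x.1).

Definition slope2 (y : R * R) : R :=
  if y.2 == x.2 then deriv_along D f dir2 x
  else (f y - f (y.1, x.2)) / (y.2 - x.2).

Lemma slopesE y :
  f y - f x = (y.1 - x.1) * slope1 y + (y.2 - x.2) * slope2 y.
Proof.
rewrite /slope1 /slope2; case: eqP => [E1|/eqP N1]; case: eqP => [E2|/eqP N2].
- by rewrite E1 E2 !subrr !mul0r addr0; case: x y E1 E2 => [? ?] [? ?] /= -> ->;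
  rewrite subrr.
- rewrite E1 subrr mul0r add0r mulrC divfK ?subr_eq0//.
  by case: (x).
- rewrite E2 subrr mul0r addr0 mulrC divfK ?subr_eq0// -E2.
  by case: (y).
- by rewrite ![(_ - _) * (_ / _)]mulrC !divfK ?subr_eq0// [RHS]addrC addrA subrK.
Qed.

Lemma mvt_dir (e : R * R) (u v : R * R) (a : R) : e \in dirs2 -> 0 < a ->
  v = a *: e + u ->
  (forall s, 0 <= s <= a -> D (s *: e + u)) ->
  exists2 s, 0 < s < a & f v - f u = a * deriv_along D f e (s *: e + u).
Proof.
move=> ed a0 -> sD; apply: mvt_along => //; first exact: class_C_continuous Cf.
move=> s sI; apply: has_deriv_derivable.
by apply: class_C_has_deriv Cf ed _; exact: sD.
Qed.

Lemma slope1_cvg : slope1 y @[y --> within D (nbhs x)] --> deriv_along D f dir1 x.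
Proof.
have [d d0 dD] := relopen_box rD Dx.
have /class_C_continuous/subspace_continuousP/(_ _ Dx) c :=
  class_C_deriv Cf (mem_head dir1 [:: dir2]).
apply/cvgrPdist_lt => eps e0.
have {c} : \forall y \near x, D y ->
    `|deriv_along D f dir1 x - deriv_along D f dir1 y| < eps.
  by have /cvgrPdist_lt/(_ _ e0) := c.
move=> /box_near[d' d'0 dc].
pose m := Num.min d d'.
have m0 : 0 < m by rewrite lt_min d0.
have x2 := relopen_half rD Dx.
rewrite near_withinE; have := near_box x m0; apply: filterS => y [y1 _] _.
have inD s : `|s - x.1| < m ->
    D (s, x.2) /\ `|deriv_along D f dir1 x - deriv_along D f dir1 (s, x.2)| < eps.
  rewrite lt_min => /andP[sd sd'].
  have Ds : D (s, x.2) by apply: dD; rewrite /= ?subrr ?normr0.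
  by split=> //; apply: dc; rewrite /= ?subrr ?normr0.
rewrite /slope1; case: eqP => [_|/eqP ne]; first by rewrite subrr normr0.
have pt s u : s *: dir1 + (u, x.2) = (s + u, x.2) :> R * R.
  by rewrite dir1_line.
case: (ltgtP y.1 x.1) ne => // lt _.
- have sD s : 0 <= s <= x.1 - y.1 -> `|s + y.1 - x.1| < m.
    move=> sI; apply: le_lt_trans y1; rewrite !ler0_norm; lra.
  rewrite -[f _ - f x]opprB.
  have [|||s sI|s sI ->] := @mvt_dir dir1 (y.1, x.2) x (x.1 - y.1).
  + by rewrite !inE eqxx.
  + by rewrite subr_gt0.
  + by rewrite pt subrK; case: (x).
  + by rewrite pt; apply: (inD _ (sD _ sI)).1.
  rewrite pt.
  have -> : - ((x.1 - y.1) * deriv_along D f dir1 (s + y.1, x.2)) / (y.1 - x.1)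
     = deriv_along D f dir1 (s + y.1, x.2).
    by rewrite -mulNr opprB mulrC mulrA mulVf ?mul1r// subr_eq0 lt_eqF.
  by apply: (inD _ (sD _ _)).2; lra.
- have sD s : 0 <= s <= y.1 - x.1 -> `|s + x.1 - x.1| < m.
    move=> sI; apply: le_lt_trans y1; rewrite !ger0_norm; lra.
  have ptx s : s *: dir1 + x = (s + x.1, x.2) by rewrite dir1_line.
  have [|||s sI|s sI ->] := @mvt_dir dir1 x (y.1, x.2) (y.1 - x.1).
  + by rewrite !inE eqxx.
  + by rewrite subr_gt0.
  + by rewrite ptx subrK.
  + by rewrite ptx; apply: (inD _ (sD _ sI)).1.
  rewrite ptx.
  rewrite mulrC mulrA mulVf ?mul1r ?subr_eq0 ?gt_eqF//.
  by apply: (inD _ (sD _ _)).2; lra.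
Qed.

Lemma slope2_cvg : slope2 y @[y --> within D (nbhs x)] --> deriv_along D f dir2 x.
Proof.
have d2in : dir2 \in @dirs2 R by rewrite !inE eqxx orbT.
have [d d0 dD] := relopen_box rD Dx.
have /class_C_continuous/subspace_continuousP/(_ _ Dx) c :=
  class_C_deriv Cf d2in.
apply/cvgrPdist_lt => eps e0.
have {c} : \forall y \near x, D y ->
    `|deriv_along D f dir2 x - deriv_along D f dir2 y| < eps.
  by have /cvgrPdist_lt/(_ _ e0) := c.
move=> /box_near[d' d'0 dc].
pose m := Num.min d d'.
have m0 : 0 < m by rewrite lt_min d0.
have x2 := relopen_half rD Dx.
rewrite near_withinE; have := near_box x m0; apply: filterS => y [y1 y2] Dy.
have yp := relopen_half rD Dy.
have inD s : `|s - x.2| < m -> 0 <= s ->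
    D (y.1, s) /\ `|deriv_along D f dir2 x - deriv_along D f dir2 (y.1, s)| < eps.
  move: y1; rewrite !lt_min => /andP[yd yd'] /andP[sd sd'] s0.
  have Ds : D (y.1, s) by exact: dD.
  by split=> //; exact: dc.
rewrite /slope2; case: eqP => [_|/eqP ne]; first by rewrite subrr normr0.
have pt s u v : s *: dir2 + (u, v) = (u, s + v) :> R * R.
  by rewrite dir2_line.
case: (ltgtP y.2 x.2) ne => // lt _.
- have sD s : 0 <= s <= x.2 - y.2 -> `|s + y.2 - x.2| < m.
    move=> sI; apply: le_lt_trans y2; rewrite !ler0_norm; lra.
  have pty s : s *: dir2 + y = (y.1, s + y.2) by rewrite dir2_line.
  rewrite -[f y - _]opprB.
  have [|||s sI|s sI ->] := @mvt_dir dir2 y (y.1, x.2) (x.2 - y.2).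
  + by [].
  + by rewrite subr_gt0.
  + by rewrite pty subrK.
  + by rewrite pty; apply: (inD _ (sD _ sI) _).1; lra.
  rewrite pty.
  have -> : - ((x.2 - y.2) * deriv_along D f dir2 (y.1, s + y.2)) / (y.2 - x.2)
     = deriv_along D f dir2 (y.1, s + y.2).
    by rewrite -mulNr opprB mulrC mulrA mulVf ?mul1r// subr_eq0 lt_eqF.
  by apply: (inD _ (sD _ _) _).2; lra.
- have sD s : 0 <= s <= y.2 - x.2 -> `|s + x.2 - x.2| < m.
    move=> sI; apply: le_lt_trans y2; rewrite !ger0_norm; lra.
  have [|||s sI|s sI ->] := @mvt_dir dir2 (y.1, x.2) y (y.2 - x.2).
  + by [].
  + by rewrite subr_gt0.
  + by rewrite pt subrK; case: (y).
  + by rewrite pt; apply: (inD _ (sD _ sI) _).1; lra.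
  rewrite pt.
  rewrite mulrC mulrA mulVf ?mul1r ?subr_eq0 ?gt_eqF//.
  by apply: (inD _ (sD _ _) _).2; lra.
Qed.

End Slopes.
End HalfPlaneCalculus.

Local Opaque dir1 dir2 deriv_along.

Section ChainRule.
Context {R : realType}.

Lemma dir1_in : dir1 \in @dirs2 R.
Proof. exact: mem_head. Qed.

Lemma dir2_in : dir2 \in @dirs2 R.
Proof. by rewrite inE mem_head orbT. Qed.

(** Immediate from the Hadamard decomposition, whose slopes have limits at
    every point of D, boundary points included. *)
Lemma has_deriv_chain {V : normedModType R} (D : set (R * R)) (f : R * R -> R)
    (D' : set V) (t : V -> R * R) (e z : V) (l : R * R) :
  relopen D -> class_C dirs2 1 D f -> (forall y, D' y -> D (t y)) -> D' z ->
  has_deriv D' t e z l ->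
  has_deriv D' (fun y => f (t y)) e z
    (l.1 * deriv_along D f dir1 (t z) + l.2 * deriv_along D f dir2 (t z)).
Proof.
move=> rD Cf tD D'z dt; have Dtz := tD z D'z.
rewrite /has_deriv /quotient_along.
under eq_fun do rewrite (slopesE D f (t z)) scalerDr.
have tc : t (h *: e + z) @[h --> times D' e z] --> within D (nbhs (t z)).
  move=> A nA; have c := has_deriv_cvg dt.
  have {}nA : \forall y \near t z, D y -> A y by exact: nA.
  have H : \forall h \near (0 : R)^', D' (h *: e + z) ->
     D (t (h *: e + z)) -> A (t (h *: e + z)) by exact: (c _ nA).
  change (\forall h \near (0 : R)^', D' (h *: e + z) -> A (t (h *: e + z))).
  by near=> h => D'h; apply: (near H h) => //; exact: tD.
have c1 := cvg_comp _ _ tc (slope1_cvg rD Cf Dtz).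
have c2 := cvg_comp _ _ tc (slope2_cvg rD Cf Dtz).
apply: cvgD.
  by under eq_fun do rewrite scalerAl; exact: (cvgM (has_deriv_fst dt) c1).
by under eq_fun do rewrite scalerAl; exact: (cvgM (has_deriv_snd dt) c2).
Unshelve. all: by end_near. Qed.

Lemma class_C_fst {V : normedModType R} (B : seq V) k (D : set V) (f : V -> R * R) :
  accessible B D -> class_C B k D f -> class_C B k D (fun y => (f y).1).
Proof.
move=> aD; elim: k f => [|k IH] f Cf;
  (have cf : {within D, continuous (fun y => (f y).1)};
   [apply/subspace_continuousP => x Dx;
    move/class_C_continuous/subspace_continuousP: Cf => /(_ x Dx) c;
    exact: (cvg_comp _ _ c (@cvg_fst _ _ (nbhs (f x).1) (nbhs (f x).2) _))|]);
  first by split.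
apply: (class_C_succ (df := fun e y => (deriv_along D f e y).1)) => //.
  by move=> e eB x Dx; apply: has_deriv_fst; exact: class_C_has_deriv Cf eB Dx.
by move=> e eB; apply: IH; exact: class_C_deriv.
Qed.

Lemma class_C_snd {V : normedModType R} (B : seq V) k (D : set V) (f : V -> R * R) :
  accessible B D -> class_C B k D f -> class_C B k D (fun y => (f y).2).
Proof.
move=> aD; elim: k f => [|k IH] f Cf;
  (have cf : {within D, continuous (fun y => (f y).2)};
   [apply/subspace_continuousP => x Dx;
    move/class_C_continuous/subspace_continuousP: Cf => /(_ x Dx) c;
    exact: (cvg_comp _ _ c (@cvg_snd _ _ (nbhs (f x).1) (nbhs (f x).2) _))|]);
  first by split.
apply: (class_C_succ (df := fun e y => (deriv_along D f e y).2)) => //.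
  by move=> e eB x Dx; apply: has_deriv_snd; exact: class_C_has_deriv Cf eB Dx.
by move=> e eB; apply: IH; exact: class_C_deriv.
Qed.

Lemma continuous_within_map {T U Z : topologicalType} (A : set T) (A' : set U)
    (g : T -> U) (f : U -> Z) : (forall x, A x -> A' (g x)) ->
  {within A, continuous g} -> {within A', continuous f} ->
  {within A, continuous (fun x => f (g x))}.
Proof.
move=> gA /subspace_continuousP cg /subspace_continuousP cf.
apply/subspace_continuousP => x Ax P nP.
have {}nP : \forall y \near g x, A' y -> P (f y) by exact: (cf _ (gA _ Ax) _ nP).
have H : \forall y \near x, A y -> A' (g y) -> P (f (g y)) by exact: (cg _ Ax _ nP).
change (\forall y \near x, A y -> P (f (g y))).
by near=> y => Ay; apply: (near H y) => //; exact: gA.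
Unshelve. all: by end_near. Qed.

Lemma class_C_comp {V : normedModType R} (B : seq V) k (D : set (R * R))
    (f : R * R -> R) (D' : set V) (t : V -> R * R) :
  relopen D -> accessible B D' -> (forall y, D' y -> D (t y)) ->
  class_C dirs2 k D f -> class_C B k D' t ->
  class_C B k D' (fun y => f (t y)).
Proof.
move=> rD aD' tD; elim: k f => [|k IH] f Cf Ct;
  have cft := continuous_within_map tD (class_C_continuous Ct) (class_C_continuous Cf);
  first by split.
apply: (class_C_succ (df := fun e y =>
  (deriv_along D' t e y).1 * deriv_along D f dir1 (t y)
  + (deriv_along D' t e y).2 * deriv_along D f dir2 (t y))) => //.
  move=> e eB x D'x; apply: has_deriv_chain => //.
    exact: class_C_le Cf.
  exact: class_C_has_deriv Ct eB D'x.
have i1 : dir1 \in @dirs2 R by exact: dir1_in.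
have i2 : dir2 \in @dirs2 R by exact: dir2_in.
move=> e eB; have Cd := class_C_deriv Ct eB.
have Ctk := class_C_pred Ct.
apply: class_C_add => //; apply: class_C_mul => //.
- exact: class_C_fst.
- by apply: IH => //; exact: class_C_deriv Cf i1.
- exact: class_C_snd.
- by apply: IH => //; exact: class_C_deriv Cf i2.
Qed.

Lemma class_C_comp_row {V : normedModType R} (B : seq V) k n (D : set (R * R))
    (f : R * R -> 'rV[R]_n) (D' : set V) (t : V -> R * R) :
  relopen D -> accessible B D' -> (forall y, D' y -> D (t y)) ->
  class_C dirs2 k D f -> class_C B k D' t ->
  class_C B k D' (fun y => f (t y)).
Proof.
move=> rD aD' tD /(class_C_row _ _ (relopen_accessible rD)) Cf Ct.
by apply/class_C_row => // i; exact: (class_C_comp (f := fun z => f z 0 i) rD).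
Qed.

Lemma has_deriv_chain_row {V : normedModType R} n (D : set (R * R))
    (f : R * R -> 'rV[R]_n) (D' : set V) (t : V -> R * R) (e z : V) (l : R * R) :
  relopen D -> class_C dirs2 1 D f -> (forall y, D' y -> D (t y)) -> D' z ->
  has_deriv D' t e z l ->
  has_deriv D' (fun y => f (t y)) e z
    (l.1 *: deriv_along D f dir1 (t z) + l.2 *: deriv_along D f dir2 (t z)).
Proof.
move=> rD Cf tD D'z dt; have aD := relopen_accessible rD.
have i1 : dir1 \in @dirs2 R by exact: dir1_in.
have i2 : dir2 \in @dirs2 R by exact: dir2_in.
have Dtz := tD _ D'z.
have Cfi := (class_C_row _ _ aD).1 Cf.
have dE e' i : e' \in dirs2 ->
    deriv_along D (fun z => f z 0 i) e' (t z) = deriv_along D f e' (t z) 0 i.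
  move=> e'in; apply: deriv_alongE; first exact: accessible_reachable aD e'in Dtz.
  by have /has_deriv_rowP := class_C_has_deriv Cf e'in Dtz; exact.
apply/has_deriv_rowP => i.
have := has_deriv_chain rD (Cfi i) tD D'z dt.
have -> : (l.1 *: deriv_along D f dir1 (t z) + l.2 *: deriv_along D f dir2 (t z)) 0 i
  = l.1 * deriv_along D f dir1 (t z) 0 i + l.2 * deriv_along D f dir2 (t z) 0 i.
  by rewrite mxE [X in X + _]mxE [X in _ + X]mxE.
by rewrite (dE _ i i1) (dE _ i i2).
Qed.

End ChainRule.

Section MixedPartials.
Context {R : realType} {V : normedModType R} (B : seq V) (D : set V) (e1 e2 x : V).
Hypotheses (e1B : e1 \in B) (e2B : e2 \in B) (Dx : D x).

(** Squares based at x and spanned by e1 and e2 are enough: x may lie on the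
    boundary of D. *)
Variable d : R.
Hypotheses (d0 : 0 < d)
  (sqD : forall s u, 0 <= s <= d -> 0 <= u <= d -> D (s *: e1 + (u *: e2 + x))).

(** Two mean values: along e1 for the difference of f between two parallel
    segments, then along e2 for the derivative of f in the direction e1. *)
Lemma second_difference (f : V -> R) (h : R) : class_C B 2 D f -> 0 < h <= d ->
  exists s u, [/\ 0 <= s <= h, 0 <= u <= h &
    f (h *: e1 + (h *: e2 + x)) - f (h *: e1 + x) - f (h *: e2 + x) + f x
    = h * (h * deriv_along D (deriv_along D f e1) e2 (s *: e1 + (u *: e2 + x)))].
Proof.
move=> Cf /andP[h0 hd].
have cf := class_C_continuous Cf.
have sq s u : 0 <= s <= h -> 0 <= u <= h -> D (s *: e1 + (u *: e2 + x)).
  by move=> /andP[s0 sh] /andP[u0 uh]; apply: sqD; lra.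
have sD1 s : 0 <= s <= h -> D (s *: e1 + (h *: e2 + x)).
  by move=> sI; apply: sq; lra.
have sD0 s : 0 <= s <= h -> D (s *: e1 + x).
  by move=> sI; have := @sq s 0 sI; rewrite scale0r add0r; apply; lra.
have df e y : e \in B -> D y -> derivable_along D f e y.
  by move=> eB Dy; apply: has_deriv_derivable; exact: class_C_has_deriv Cf eB Dy.
have [s sI E] := MVT h0
  (fun s sI => is_deriveB (segment_is_derive sD1 (fun u uI => df _ _ e1B (sD1 u uI)) sI)
                          (segment_is_derive sD0 (fun u uI => df _ _ e1B (sD0 u uI)) sI))
  (within_continuousB (segment_continuous cf sD1) (segment_continuous cf sD0)).
have {}sI : 0 <= s <= h by move: sI; rewrite in_itv /= => /andP[? ?]; lra.
have Cf1 := class_C_deriv Cf e1B.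
have sDs u : 0 <= u <= h -> D (u *: e2 + (s *: e1 + x)).
  by move=> uI; rewrite addrCA; exact: sq.
have [|u uI E2] := mvt_along h0 (class_C_continuous Cf1) sDs.
  move=> u uI; apply: has_deriv_derivable.
  exact: class_C_has_deriv Cf1 e2B (sDs _ uI).
exists s, u; split=> //; first by lra.
have {}E : f (h *: e1 + (h *: e2 + x)) - f (h *: e1 + x)
    - (f (0 *: e1 + (h *: e2 + x)) - f (0 *: e1 + x))
  = (deriv_along D f e1 (s *: e1 + (h *: e2 + x))
     - deriv_along D f e1 (s *: e1 + x)) * (h - 0) by exact: E.
move: E; rewrite !scale0r !add0r subr0 [s *: e1 + (h *: e2 + x)]addrCA E2.
rewrite [s *: e1 + (u *: e2 + x)]addrCA => E.
by rewrite [RHS]mulrC -E; ring.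
Qed.

Lemma near_square (P : set V) : (\forall y \near x, P y) ->
  exists2 c : R, 0 < c &
    forall s u, 0 <= s <= c -> 0 <= u <= c -> P (s *: e1 + (u *: e2 + x)).
Proof.
move=> nP.
have cl : (z.1 *: e1 + (z.2 *: e2 + x)) @[z --> ((0, 0) : R * R)] --> x.
  rewrite -[X in _ --> X](_ : 0 *: e1 + (0 *: e2 + x) = x); last first.
    by rewrite !scale0r !add0r.
  apply: cvgD; first by apply: cvgZr_tmp; exact: (@cvg_fst _ _ (nbhs 0) (nbhs 0) _).
  apply: cvgD; last exact: cvg_cst.
  by apply: cvgZr_tmp; exact: (@cvg_snd _ _ (nbhs 0) (nbhs 0) _).
have [c c0 cP] := box_near (cl _ nP).
exists (c / 2); first by rewrite divr_gt0.
move=> s u sI uI; apply: (cP (s, u)); rewrite /= subr0 ger0_norm; lra.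
Qed.

End MixedPartials.

Section MixedPartialsEqual.
Context {R : realType} {V : normedModType R} (B : seq V) (D : set V) (e1 e2 x : V).
Hypotheses (e1B : e1 \in B) (e2B : e2 \in B) (Dx : D x).
Variable d : R.
Hypotheses (d0 : 0 < d)
  (sqD : forall s u, 0 <= s <= d -> 0 <= u <= d -> D (s *: e1 + (u *: e2 + x))).

Let le_itv (s h c : R) : 0 <= s <= h -> h <= c -> 0 <= s <= c.
Proof. by move=> /andP[-> /le_trans sh] /sh. Qed.

Let swap_middle (a b c d' : R) : a - b - c + d' = a - c - b + d'.
Proof. by ring. Qed.

Let half_close (a b m eps : R) :
  `|a - m| < eps / 2 -> `|b - m| < eps / 2 -> `|a - b| <= eps.
Proof.
move=> am bm; have -> : a - b = (a - m) - (b - m) by ring.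
by apply: le_trans (ler_normB _ _) _; lra.
Qed.

(** The second difference is symmetric in e1 and e2, and divided by the square
    of h it tends to either mixed derivative. *)
Lemma mixed_partials (f : V -> R) : class_C B 2 D f ->
  deriv_along D (deriv_along D f e1) e2 x = deriv_along D (deriv_along D f e2) e1 x.
Proof.
move=> Cf; set p := LHS; set q := RHS.
have near_val (g : V -> R) : class_C B 0 D g -> forall eps : R, 0 < eps ->
    \forall y \near x, D y -> `|g x - g y| < eps.
  move=> /class_C_continuous/subspace_continuousP/(_ _ Dx) /cvgrPdist_lt H eps e0.
  exact: (H _ e0).
apply/eqP; rewrite -subr_eq0 -normr_le0; apply/ler_addgt0Pr => eps e0.
have e20 : 0 < eps / 2 by rewrite divr_gt0.
have [c1 c10 H1] := near_square e1 e2 (near_val _ (class_C_deriv (class_C_deriv Cf e1B) e2B) _ e20).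
have [c2 c20 H2] := near_square e2 e1 (near_val _ (class_C_deriv (class_C_deriv Cf e2B) e1B) _ e20).
pose h := Num.min d (Num.min c1 c2).
have h0 : 0 < h by rewrite !lt_min d0 c10.
have hd : h <= d by rewrite ge_min lexx.
have hc1 : h <= c1 by rewrite !ge_min lexx orbT.
have hc2 : h <= c2 by rewrite !ge_min lexx !orbT.
have hI : 0 < h <= d by rewrite h0.
have [s [u [sI uI E]]] := second_difference e1B e2B sqD Cf hI.
have sqD' s' u' : 0 <= s' <= d -> 0 <= u' <= d -> D (s' *: e2 + (u' *: e1 + x)).
  by move=> s'I u'I; rewrite addrCA; exact: sqD.
have [s' [u' [s'I u'I E']]] := second_difference e2B e1B sqD' Cf hI.
have pqE : deriv_along D (deriv_along D f e1) e2 (s *: e1 + (u *: e2 + x))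
         = deriv_along D (deriv_along D f e2) e1 (u' *: e1 + (s' *: e2 + x)).
  apply: (mulfI (lt0r_neq0 h0)); apply: (mulfI (lt0r_neq0 h0)).
  have {}E' := etrans E' (congr1 (fun y => h * (h * deriv_along D
    (deriv_along D f e2) e1 y)) (addrCA (s' *: e2) (u' *: e1) x)).
  apply: etrans (etrans (esym E) _) E'.
  by rewrite (addrCA (h *: e2) (h *: e1)) swap_middle.
have P1 : `|p - deriv_along D (deriv_along D f e1) e2 (s *: e1 + (u *: e2 + x))| < eps / 2.
  by apply: H1; [exact: le_itv sI hc1|exact: le_itv uI hc1|
    apply: sqD; [exact: le_itv sI hd|exact: le_itv uI hd]].
have P2 : `|q - deriv_along D (deriv_along D f e2) e1 (u' *: e1 + (s' *: e2 + x))| < eps / 2.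
  rewrite -(addrCA (s' *: e2)).
  by apply: H2; [exact: le_itv s'I hc2|exact: le_itv u'I hc2|
    apply: sqD'; [exact: le_itv s'I hd|exact: le_itv u'I hd]].
rewrite add0r; move: P1 P2; rewrite pqE.
exact: half_close.
Qed.

End MixedPartialsEqual.

Section PlanePartials.
Context {R : realType}.

Lemma mixed_partials_plane (D : set (R * R)) (f : R * R -> R) x :
  relopen D -> D x -> class_C dirs2 2 D f ->
  deriv_along D (deriv_along D f dir1) dir2 x =
  deriv_along D (deriv_along D f dir2) dir1 x.
Proof.
move=> rD Dx Cf; have [d d0 dD] := relopen_box rD Dx.
have x2 := relopen_half rD Dx.
apply: (mixed_partials (d := d / 2) dir1_in dir2_in Dx _ _ Cf).
  by rewrite divr_gt0.
move=> s u sI uI; rewrite dir1_line dir2_line; apply: dD => /=; last by lra.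
  by rewrite addrK ger0_norm; lra.
by rewrite addrK ger0_norm; lra.
Qed.

Lemma deriv_along_row n (D : set (R * R)) (f : R * R -> 'rV[R]_n) e x i :
  relopen D -> D x -> e \in dirs2 -> class_C dirs2 1 D f ->
  deriv_along D (fun y => f y 0 i) e x = deriv_along D f e x 0 i.
Proof.
move=> rD Dx ed Cf; apply: deriv_alongE.
  exact: accessible_reachable (relopen_accessible rD) ed Dx.
by have /has_deriv_rowP := class_C_has_deriv Cf ed Dx; exact.
Qed.

Lemma mixed_partials_row n (D : set (R * R)) (f : R * R -> 'rV[R]_n) x :
  relopen D -> D x -> class_C dirs2 2 D f ->
  deriv_along D (deriv_along D f dir1) dir2 x =
  deriv_along D (deriv_along D f dir2) dir1 x.
Proof.
move=> rD Dx Cf; apply/rowP => i.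
have d2 e e' : e \in dirs2 -> e' \in dirs2 ->
    deriv_along D (deriv_along D f e) e' x 0 i
    = deriv_along D (deriv_along D (fun y => f y 0 i) e) e' x.
  move=> ed ed'; rewrite -deriv_along_row//; last exact: class_C_deriv.
  apply: deriv_along_ext => // y Dy; symmetry.
  by apply: deriv_along_row => //; exact: class_C_pred.
have Cfi := (class_C_row _ _ (relopen_accessible rD)).1 Cf i.
exact: etrans (etrans (d2 _ _ dir1_in dir2_in) (mixed_partials_plane rD Dx Cfi))
              (esym (d2 _ _ dir2_in dir1_in)).
Qed.

End PlanePartials.

(** ** Coordinate derivatives *)

Definition coord_dir {R : realType} (b : bool) : R * R := if b then dir2 else dir1.

(** Sealed: the partial derivatives are only used through the rules below. *)
HB.lock Definition pd {R : realType} {W : normedModType R} (D : set (R * R))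
  (b : bool) (f : R * R -> W) : R * R -> W := deriv_along D f (coord_dir b).

Section CoordinateDerivatives.
Context {R : realType}.
Variables (D : set (R * R)).
Hypothesis rD : relopen D.
Implicit Types (b : bool) (z : R * R).

Lemma coord_dir_in b : coord_dir b \in @dirs2 R.
Proof. by case: b; [exact: dir2_in|exact: dir1_in]. Qed.

Section Target.
Context {W : normedModType R}.
Implicit Types (f g : R * R -> W).

Lemma pdE b f : pd D b f = deriv_along D f (coord_dir b).
Proof. by rewrite unlock. Qed.

Lemma pd_has_deriv k b f z : class_C dirs2 k.+1 D f -> D z ->
  has_deriv D f (coord_dir b) z (pd D b f z).
Proof. by rewrite pdE => Cf Dz; exact: class_C_has_deriv Cf (coord_dir_in b) Dz. Qed.

Lemma class_pd k b f : class_C dirs2 k.+1 D f -> class_C dirs2 k D (pd D b f).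
Proof. by rewrite pdE => Cf; exact: class_C_deriv Cf (coord_dir_in b). Qed.

Lemma pd_reachable b z : D z -> reachable D (coord_dir b) z.
Proof. exact: accessible_reachable (relopen_accessible rD) (coord_dir_in b). Qed.

Lemma pd_eq b f z l : D z -> has_deriv D f (coord_dir b) z l -> pd D b f z = l.
Proof. by rewrite pdE => Dz; apply: deriv_alongE; exact: pd_reachable. Qed.

Lemma pd_ext b f g z : D z -> (forall y, D y -> f y = g y) ->
  pd D b f z = pd D b g z.
Proof. by rewrite !pdE; exact: deriv_along_ext. Qed.

End Target.

Lemma pd_mixed n (f : R * R -> 'rV[R]_n) z : D z -> class_C dirs2 2 D f ->
  pd D true (pd D false f) z = pd D false (pd D true f) z.
Proof. by move=> Dz Cf; rewrite !pdE; exact: mixed_partials_row. Qed.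

End CoordinateDerivatives.

Arguments pd_has_deriv {R D W k} b {f z}.
Arguments pd_reachable {R D} rD b {z}.
Local Transparent dir1 dir2 deriv_along.

(** * Vector algebra in Euclidean 3-space and Minkowski 5-space *)

Section VectorAlgebra.
Context {R : realType}.
Implicit Types (u v w X : 'rV[R]_3).

Let i0 : 'I_3 := 0.
Let i1 : 'I_3 := 1.
Let i2 : 'I_3 := 2%:R.

Lemma dotE u v : dot u v = u 0 i0 * v 0 i0 + u 0 i1 * v 0 i1 + u 0 i2 * v 0 i2.
Proof.
rewrite /dot !big_ord_recr big_ord0 /= add0r.
by congr (_ + _ + _); congr (u 0 _ * v 0 _); exact: val_inj.
Qed.

Lemma cross0E u v : cross u v 0 i0 = u 0 i1 * v 0 i2 - u 0 i2 * v 0 i1.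
Proof. by rewrite mxE !add0r. Qed.

Lemma cross1E u v : cross u v 0 i1 = u 0 i2 * v 0 i0 - u 0 i0 * v 0 i2.
Proof.
rewrite mxE; have -> : i1 + 1 = i2 by exact: val_inj.
by have -> : i1 + 2%:R = i0 by exact: val_inj.
Qed.

Lemma cross2E u v : cross u v 0 i2 = u 0 i0 * v 0 i1 - u 0 i1 * v 0 i0.
Proof.
rewrite mxE; have -> : i2 + 1 = i0 by exact: val_inj.
by have -> : i2 + 2%:R = i1 by exact: val_inj.
Qed.

Lemma row3P u v : u 0 i0 = v 0 i0 -> u 0 i1 = v 0 i1 -> u 0 i2 = v 0 i2 -> u = v.
Proof.
move=> h0 h1 h2; apply/rowP => -[[|[|[|//]]] lt].
- by rewrite (_ : Ordinal lt = i0) //; exact: val_inj.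
- by rewrite (_ : Ordinal lt = i1) //; exact: val_inj.
- by rewrite (_ : Ordinal lt = i2) //; exact: val_inj.
Qed.

Let entD u v i : (u + v) 0 i = u 0 i + v 0 i. Proof. by rewrite mxE. Qed.
Let entN u i : (- u) 0 i = - u 0 i. Proof. by rewrite mxE. Qed.
Let entZ (a : R) u i : (a *: u) 0 i = a * u 0 i. Proof. by rewrite mxE. Qed.
Let ent0 i : (0 : 'rV[R]_3) 0 i = 0. Proof. by rewrite mxE. Qed.
Let entE := (entD, entN, entZ, ent0, cross0E, cross1E, cross2E).

Lemma dotC u v : dot u v = dot v u.
Proof. by rewrite !dotE; ring. Qed.

Lemma dot0l u : dot 0 u = 0.
Proof. by rewrite !dotE !entE; ring. Qed.

Lemma dotDl u v w : dot (u + v) w = dot u w + dot v w.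
Proof. by rewrite !dotE !mxE; ring. Qed.

Lemma dotDr u v w : dot w (u + v) = dot w u + dot w v.
Proof. by rewrite !dotE !mxE; ring. Qed.

Lemma dotNl u v : dot (- u) v = - dot u v.
Proof. by rewrite !dotE !mxE; ring. Qed.

Lemma dotNr u v : dot u (- v) = - dot u v.
Proof. by rewrite !dotE !mxE; ring. Qed.

Lemma dotZl (a : R) u v : dot (a *: u) v = a * dot u v.
Proof. by rewrite !dotE !mxE; ring. Qed.

Lemma dotZr (a : R) u v : dot u (a *: v) = a * dot u v.
Proof. by rewrite !dotE !mxE; ring. Qed.

Definition dotlin := (dotDl, dotDr, dotZl, dotZr, dotNl, dotNr).

Lemma crossC u v : cross u v = - cross v u.
Proof.
by apply: row3P; rewrite !entE; ring.
Qed.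

Lemma crossDl u v w : cross (u + v) w = cross u w + cross v w.
Proof.
by apply: row3P; rewrite !entE; ring.
Qed.

Lemma crossZl (a : R) u v : cross (a *: u) v = a *: cross u v.
Proof.
by apply: row3P; rewrite !entE; ring.
Qed.

Lemma crossDr u v w : cross w (u + v) = cross w u + cross w v.
Proof. by rewrite crossC crossDl opprD -!(crossC w). Qed.

Lemma crossZr (a : R) u v : cross u (a *: v) = a *: cross u v.
Proof. by rewrite crossC crossZl -scalerN -crossC. Qed.

Lemma crossvv u : cross u u = 0.
Proof. by apply: row3P; rewrite !entE; ring. Qed.

Definition crosslin := (crossDl, crossDr, crossZl, crossZr).

Lemma dot_cross_l u v : dot u (cross u v) = 0.
Proof. by rewrite !dotE !entE; ring. Qed.

Lemma dot_cross_r u v : dot v (cross u v) = 0.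
Proof. by rewrite !dotE !entE; ring. Qed.

Lemma dot_crossC u v w : dot u (cross v w) = dot w (cross u v).
Proof. by rewrite !dotE !entE; ring. Qed.

Lemma cross_cross w u v : cross w (cross u v) = dot w v *: u - dot w u *: v.
Proof.
by apply: row3P; rewrite !entE !dotE; ring.
Qed.

Lemma dot_cross_cross u v :
  dot (cross u v) (cross u v) = dot u u * dot v v - dot u v ^+ 2.
Proof. by rewrite !dotE !entE; ring. Qed.

(** Coordinates of w in the basis u, v, u x v. *)
Lemma cross_basis u v w :
  dot (cross u v) (cross u v) *: w =
  (dot v v * dot w u - dot u v * dot w v) *: u
  + (dot u u * dot w v - dot u v * dot w u) *: v
  + dot w (cross u v) *: cross u v.
Proof.
by apply: row3P; rewrite !entE !dotE !entE; ring.
Qed.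

Lemma dot_ge0 u : 0 <= dot u u.
Proof. by rewrite dotE !addr_ge0// -expr2 sqr_ge0. Qed.

Lemma dot_eq0 u : dot u u = 0 -> u = 0.
Proof.
rewrite dotE => u0; have sq (a b c : R) : a * a + b * b + c * c = 0 -> a = 0.
  move=> abc; have [a0 b0 c0] : [/\ 0 <= a * a, 0 <= b * b & 0 <= c * c].
    by rewrite -!expr2 !sqr_ge0.
  have /eqP : a * a = 0 by lra.
  by rewrite mulf_eq0 orbb => /eqP.
apply: row3P; rewrite ent0; first exact: sq u0.
  by apply: sq (u 0 i0) (u 0 i2) _; rewrite -u0; ring.
by apply: sq (u 0 i0) (u 0 i1) _; rewrite -u0; ring.
Qed.

(** ** Minkowski space *)

Implicit Types (x y z : 'rV[R]_5).

Lemma minkC y z : mink y z = mink z y.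
Proof. by apply: eq_bigr => i _; rewrite mulrC. Qed.

Lemma minkDl x y z : mink (x + y) z = mink x z + mink y z.
Proof.
rewrite /mink -big_split; apply: eq_bigr => i _ /=; rewrite mxE mulrDl.
by case: ifP => // _; rewrite opprD.
Qed.

Lemma minkZl (a : R) y z : mink (a *: y) z = a * mink y z.
Proof.
rewrite /mink mulr_sumr; apply: eq_bigr => i _ /=; rewrite mxE -mulrA.
by case: ifP => // _; rewrite mulrN.
Qed.

Lemma minkDr x y z : mink z (x + y) = mink z x + mink z y.
Proof. by rewrite !(minkC z) minkDl. Qed.

Lemma minkZr (a : R) y z : mink y (a *: z) = a * mink y z.
Proof. by rewrite !(minkC y) minkZl. Qed.

Lemma minkNl y z : mink (- y) z = - mink y z.
Proof. by rewrite -scaleN1r minkZl mulN1r. Qed.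

Lemma minkNr y z : mink y (- z) = - mink y z.
Proof. by rewrite -scaleN1r minkZr mulN1r. Qed.

Definition minklin := (minkDl, minkDr, minkZl, minkZr, minkNl, minkNr).

Lemma ord5P (k : 'I_5) :
  (exists i : 'I_3, k = i :> nat) \/ (k = 3 :> nat) \/ (k = 4 :> nat).
Proof.
case: k => -[|[|[|[|[|//]]]]] lt /=; [left|left|left|right; left|right; right] => //.
- by exists i0.
- by exists i1.
- by exists i2.
Qed.

Lemma mk5E_lt u (a b : R) (k : 'I_5) (i : 'I_3) :
  k = i :> nat -> mk5 u a b 0 k = u 0 i.
Proof.
move=> ki; have -> : k = lshift 2 i by exact: val_inj.
exact: (@row_mxEl _ 1 3 2 u _ 0 i).
Qed.

Lemma mk5E3 u (a b : R) (k : 'I_5) : k = 3 :> nat -> mk5 u a b 0 k = a.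
Proof.
move=> k3; have -> : k = rshift 3 (lshift 1 (0 : 'I_1)) by exact: val_inj.
apply: etrans (@row_mxEr _ 1 3 2 u _ 0 _) _.
by rewrite (@row_mxEl _ 1 1 1) mxE.
Qed.

Lemma mk5E4 u (a b : R) (k : 'I_5) : k = 4 :> nat -> mk5 u a b 0 k = b.
Proof.
move=> k4; have -> : k = rshift 3 (rshift 1 (0 : 'I_1)) by exact: val_inj.
apply: etrans (@row_mxEr _ 1 3 2 u _ 0 _) _.
by rewrite (@row_mxEr _ 1 1 1) mxE.
Qed.

Lemma mk5_eta y : y = mk5 (\row_(i < 3) y 0 (inord i)) (y 0 (inord 3)) (y 0 (inord 4)).
Proof.
apply/rowP => k; have [[i ki]|[k3|k4]] := ord5P k.
- rewrite (mk5E_lt _ _ _ ki) mxE; congr (y 0 _); apply: val_inj.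
  by rewrite /= inordK// (leq_trans (ltn_ord i)).
- by rewrite mk5E3 //; congr (y 0 _); apply: val_inj; rewrite /= inordK.
- by rewrite mk5E4 //; congr (y 0 _); apply: val_inj; rewrite /= inordK.
Qed.

Lemma mink_mk5 u v (a b c d : R) :
  mink (mk5 u a b) (mk5 v c d) = dot u v + a * c - b * d.
Proof.
rewrite /mink !big_ord_recr big_ord0 /= add0r dotE.
congr (_ + _ + _ + _ + _).
- by rewrite !(@mk5E_lt _ _ _ _ i0).
- by rewrite !(@mk5E_lt _ _ _ _ i1).
- by rewrite !(@mk5E_lt _ _ _ _ i2).
- by rewrite !mk5E3.
- by rewrite !mk5E4.
Qed.

Lemma mk5D u v (a b c d : R) : mk5 u a b + mk5 v c d = mk5 (u + v) (a + c) (b + d).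
Proof.
apply/rowP => k; rewrite mxE; have [[i ki]|[k3|k4]] := ord5P k.
- by rewrite !(mk5E_lt _ _ _ ki) mxE.
- by rewrite !mk5E3.
- by rewrite !mk5E4.
Qed.

Lemma mk5Z (t : R) u (a b : R) : t *: mk5 u a b = mk5 (t *: u) (t * a) (t * b).
Proof.
apply/rowP => k; rewrite mxE; have [[i ki]|[k3|k4]] := ord5P k.
- by rewrite !(mk5E_lt _ _ _ ki) mxE.
- by rewrite !mk5E3.
- by rewrite !mk5E4.
Qed.

Lemma mk5N u (a b : R) : - mk5 u a b = mk5 (- u) (- a) (- b).
Proof.
apply/rowP => k; rewrite mxE; have [[i ki]|[k3|k4]] := ord5P k.
- by rewrite !(mk5E_lt _ _ _ ki) mxE.
- by rewrite !mk5E3.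
- by rewrite !mk5E4.
Qed.

(** The potential is linear, and its gradient is the light-like vector. *)
Lemma potentialE y : potential y = mink y lvec.
Proof.
rewrite {2}[y]mk5_eta mink_mk5 dotC dot0l /potential.
by rewrite add0r !mulr1.
Qed.

(** The differential at X, in the direction v, of the embedding [cone] of
    Euclidean space into the light cone. *)
Definition tlift X v : 'rV[R]_5 := mk5 v (dot X v) (dot X v).

Definition cone X : 'rV[R]_5 :=
  mk5 X ((dot X X - 1) / 2%:R) ((dot X X + 1) / 2%:R).

Lemma tliftD X u v : tlift X (u + v) = tlift X u + tlift X v.
Proof. by rewrite /tlift mk5D !dotDr. Qed.

Lemma tliftZ X (a : R) v : tlift X (a *: v) = a *: tlift X v.
Proof. by rewrite /tlift mk5Z !dotZr. Qed.

Lemma tliftN X v : tlift X (- v) = - tlift X v.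
Proof. by rewrite /tlift mk5N !dotNr. Qed.

Lemma mink_tlift X u v : mink (tlift X u) (tlift X v) = dot u v.
Proof. by rewrite mink_mk5 addrK. Qed.

Lemma mink_cone_tlift X v : mink (cone X) (tlift X v) = 0.
Proof. by rewrite mink_mk5; field. Qed.

Lemma mink_cone X : mink (cone X) (cone X) = 0.
Proof. by rewrite mink_mk5; field. Qed.

Lemma mink_cone_lvec X : mink (cone X) lvec = -1.
Proof. by rewrite mink_mk5 dotC dot0l; field. Qed.

Lemma mink_tlift_lvec X v : mink (tlift X v) lvec = 0.
Proof. by rewrite mink_mk5 dotC dot0l; ring. Qed.

Lemma cone_neq0 X : cone X != 0.
Proof.
apply/eqP => E; have := mink_cone_lvec X; rewrite E -(scale0r 0) minkZl mul0r.
by move/eqP; rewrite eq_sym oppr_eq0 oner_eq0.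
Qed.

End VectorAlgebra.

(** * Differentiation of the algebraic operations *)

Section VectorCalculus.
Context {R : realType} {V : normedModType R}.
Implicit Types (D : set V) (e x : V).

Lemma has_deriv_dot D (f g : V -> 'rV[R]_3) e x l m :
  has_deriv D f e x l -> has_deriv D g e x m ->
  has_deriv D (fun y => dot (f y) (g y)) e x (dot l (g x) + dot (f x) m).
Proof.
move=> /has_deriv_rowP df /has_deriv_rowP dg; rewrite /dot -big_split.
by apply: has_deriv_sum => i; exact: has_derivM.
Qed.

Lemma has_deriv_mink D (f g : V -> 'rV[R]_5) e x l m :
  has_deriv D f e x l -> has_deriv D g e x m ->
  has_deriv D (fun y => mink (f y) (g y)) e x (mink l (g x) + mink (f x) m).
Proof.
move=> /has_deriv_rowP df /has_deriv_rowP dg; rewrite /mink -big_split.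
apply: has_deriv_sum => i /=; case: ifP => _; last exact: has_derivM.
by rewrite -opprD; apply: has_derivN; exact: has_derivM.
Qed.

Lemma has_deriv_cross D (f g : V -> 'rV[R]_3) e x l m :
  has_deriv D f e x l -> has_deriv D g e x m ->
  has_deriv D (fun y => cross (f y) (g y)) e x (cross l (g x) + cross (f x) m).
Proof.
move=> /has_deriv_rowP df /has_deriv_rowP dg; apply/has_deriv_rowP => i.
rewrite !mxE; under eq_fun do rewrite mxE.
set j := i + 1; set k := i + 2%:R.
rewrite (_ : _ + _ = (l 0 j * g x 0 k + f x 0 j * m 0 k)
                   - (l 0 k * g x 0 j + f x 0 k * m 0 j)); last by ring.
by apply: has_derivB; exact: has_derivM.
Qed.

Lemma has_deriv_mk5 D (f : V -> 'rV[R]_3) (a b : V -> R) e x l (da db : R) :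
  has_deriv D f e x l -> has_deriv D a e x da -> has_deriv D b e x db ->
  has_deriv D (fun y => mk5 (f y) (a y) (b y)) e x (mk5 l da db).
Proof.
move=> /has_deriv_rowP df dA dB; apply/has_deriv_rowP => i.
have [[j ij]|[i3|i4]] := ord5P i.
- rewrite (mk5E_lt _ _ _ ij); under eq_fun do rewrite (mk5E_lt _ _ _ ij).
  exact: df.
- by rewrite mk5E3//; under eq_fun do rewrite mk5E3//.
- by rewrite mk5E4//; under eq_fun do rewrite mk5E4//.
Qed.

Lemma has_deriv_tlift D (X v : V -> 'rV[R]_3) e x dX dv :
  has_deriv D X e x dX -> has_deriv D v e x dv ->
  has_deriv D (fun y => tlift (X y) (v y)) e x
    (tlift (X x) dv + dot dX (v x) *: lvec).
Proof.
move=> hX hv; have dXv := has_deriv_dot hX hv.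
rewrite /tlift /lvec mk5Z mk5D scaler0 addr0 mulr1 !(addrC (dot (X x) dv)).
exact: has_deriv_mk5.
Qed.

Lemma has_deriv_cone D (X : V -> 'rV[R]_3) e x dX :
  has_deriv D X e x dX ->
  has_deriv D (fun y => cone (X y)) e x (tlift (X x) dX).
Proof.
move=> hX; have dXX := has_deriv_dot hX hX.
have half (c : R) : has_deriv D (fun y => (dot (X y) (X y) + c) / 2) e x (dot (X x) dX).
  have := has_derivM (has_derivD dXX (has_deriv_cst D c e x))
                     (has_deriv_cst D (2^-1 : R) e x).
  rewrite mulr0 !addr0 (dotC dX); congr has_deriv.
  by field.
by apply: has_deriv_mk5 => //; exact: half.
Qed.

Variable B : seq V.

Lemma class_C_dot k D (f g : V -> 'rV[R]_3) : accessible B D ->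
  class_C B k D f -> class_C B k D g -> class_C B k D (fun y => dot (f y) (g y)).
Proof.
move=> aD /(class_C_row _ _ aD) Cf /(class_C_row _ _ aD) Cg.
by apply: class_C_sum => // i; exact: class_C_mul.
Qed.

Lemma class_C_mink k D (f g : V -> 'rV[R]_5) : accessible B D ->
  class_C B k D f -> class_C B k D g -> class_C B k D (fun y => mink (f y) (g y)).
Proof.
move=> aD /(class_C_row _ _ aD) Cf /(class_C_row _ _ aD) Cg.
apply: class_C_sum => // i; case: (i == ord_max); last exact: class_C_mul.
by apply: class_C_opp => //; exact: class_C_mul.
Qed.

Lemma class_C_cross k D (f g : V -> 'rV[R]_3) : accessible B D ->
  class_C B k D f -> class_C B k D g -> class_C B k D (fun y => cross (f y) (g y)).
Proof.
move=> aD /(class_C_row _ _ aD) Cf /(class_C_row _ _ aD) Cg.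
apply/class_C_row => // i; under eq_fun do rewrite mxE.
by apply: class_C_sub => //; exact: class_C_mul.
Qed.

Lemma class_C_mk5 k D (f : V -> 'rV[R]_3) (a b : V -> R) : accessible B D ->
  class_C B k D f -> class_C B k D a -> class_C B k D b ->
  class_C B k D (fun y => mk5 (f y) (a y) (b y)).
Proof.
move=> aD /(class_C_row _ _ aD) Cf Ca Cb; apply/class_C_row => // i.
have [[j ij]|[i3|i4]] := ord5P i.
- by under eq_fun do rewrite (mk5E_lt _ _ _ ij).
- by under eq_fun do rewrite mk5E3//.
- by under eq_fun do rewrite mk5E4//.
Qed.

End VectorCalculus.

(** * The pointwise algebra of a surface in 3-space *)

Section ShapeOperator.
Context {R : realType}.
Variables (a b p q nu : 'rV[R]_3) (w : R).
(* a, b stand for the coordinate tangent vectors, nu for the unit normal, p, q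
   for its derivatives and w for the area density. *)
Hypotheses (w_gt0 : 0 < w) (w2 : w ^+ 2 = dot a a * dot b b - dot a b ^+ 2)
  (nuE : nu = w^-1 *: cross a b) (pn : dot p nu = 0) (qn : dot q nu = 0)
  (sym : dot p b = dot q a).

(** Trace, with respect to the first fundamental form (g11, g12, g22), of the
    bilinear form with matrix (m11, m12, m21, m22); w is the area density. *)
Definition metric_trace (g11 g12 g22 w m11 m12 m21 m22 : R) : R :=
  (g22 * m11 - g12 * (m12 + m21) + g11 * m22) / w ^+ 2.

Let tr := metric_trace (dot a a) (dot a b) (dot b b) w.
Let H : R := - tr (dot p a) (dot p b) (dot q a) (dot q b) / 2%:R.
Let K : R := (dot p a * dot q b - dot p b * dot q a) / w ^+ 2.

Let w0 : w != 0. Proof. exact: lt0r_neq0. Qed.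

Let tangent v : dot v nu = 0 -> exists s t, v = s *: a + t *: b.
Proof.
rewrite nuE dotZr => /eqP; rewrite mulf_eq0 invr_eq0 (negbTE w0) /= => /eqP vn.
have := cross_basis a b v; rewrite vn scale0r addr0 dot_cross_cross -w2 => E.
exists (w ^- 2 * (dot b b * dot v a - dot a b * dot v b)),
       (w ^- 2 * (dot a a * dot v b - dot a b * dot v a)).
by rewrite -!scalerA -scalerDr -E scalerA mulVf ?scale1r// expf_neq0.
Qed.

Lemma flux1_position :
  (dot b b / w) *: a - (dot a b / w) *: b = cross b nu.
Proof.
rewrite nuE crossZr cross_cross scalerBr !scalerA !(mulrC w^-1).
by rewrite (dotC a b).
Qed.

Lemma flux2_position :
  (dot a a / w) *: b - (dot a b / w) *: a = cross nu a.
Proof.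
rewrite nuE crossZl crossC cross_cross opprB scalerBr !scalerA !(mulrC w^-1).
by [].
Qed.

(** Every identity below is a polynomial identity in the entries of the matrix
    of the shape operator in the basis a, b. *)
Let coords : exists s t s' t', [/\ p = s *: a + t *: b, q = s' *: a + t' *: b,
  s * dot a b + t * dot b b = s' * dot a a + t' * dot a b,
  2 * H = - (s + t') & K = s * t' - t * s'].
Proof.
have [s [t pE]] := tangent pn; have [s' [t' qE]] := tangent qn.
have E : s * dot a b + t * dot b b = s' * dot a a + t' * dot a b.
  by move: sym; rewrite pE qE !dotlin (dotC b a).
exists s, t, s', t'; split=> //.
  rewrite /H /tr /metric_trace pE qE !dotlin (dotC b a) w2.
  field; rewrite -w2 expf_neq0// andbT; exact: pnatr_eq0.
rewrite /K pE qE !dotlin (dotC b a) w2.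
field; by rewrite -w2 expf_neq0.
Qed.

Lemma flux1_normal :
  (dot b b / w) *: p - (dot a b / w) *: q
  = - (2 * H) *: cross b nu - cross q nu.
Proof.
have [s [t [s' [t' [-> -> E -> _]]]]] := coords.
rewrite nuE opprK !crosslin !cross_cross (dotC b a).
have {}E : t * dot b b = s' * dot a a + t' * dot a b - s * dot a b by rewrite -E; ring.
apply/rowP => i; rewrite !mxE.
have -> : dot b b / w * (s * a 0 i + t * b 0 i)
  = (dot b b * s * a 0 i + (t * dot b b) * b 0 i) / w by ring.
by rewrite E; field.
Qed.

Lemma flux2_normal :
  (dot a a / w) *: q - (dot a b / w) *: p
  = - (2 * H) *: cross nu a - cross nu p.
Proof.
have [s [t [s' [t' [-> -> E -> _]]]]] := coords.
rewrite nuE opprK !crosslin !(crossC (cross a b)) !cross_cross (dotC b a).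
have {}E : s' * dot a a = s * dot a b + t * dot b b - t' * dot a b by rewrite E; ring.
apply/rowP => i; rewrite !mxE.
have -> : dot a a / w * (s' * a 0 i + t' * b 0 i)
  = ((s' * dot a a) * a 0 i + dot a a * t' * b 0 i) / w by ring.
by rewrite E; field.
Qed.

(** Up to sign p and q are the images of a and b under the shape operator: the
    wedge product of an image with a tangent vector, symmetrized, sees its trace,
    and in the next lemma the wedge product of both images its determinant. *)
Lemma cross_trace : cross b p + cross q a = (2 * H * w) *: nu.
Proof.
have [s [t [s' [t' [-> -> _ -> _]]]]] := coords.
rewrite nuE !crosslin !crossvv (crossC b a) !scaler0 addr0 add0r scalerA.
rewrite mulfK// !scalerN -opprD -scalerDl scaleNr.
by [].
Qed.

Lemma cross_det : cross p q = (K * w) *: nu.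
Proof.
have [s [t [s' [t' [-> -> _ _ ->]]]]] := coords.
rewrite nuE !crosslin !crossvv (crossC b a) !scaler0 addr0 add0r !scalerA.
by rewrite mulfK// scalerN -scalerBl; congr (_ *: _); ring.
Qed.

Let normal_unit : dot nu nu = 1.
Proof.
rewrite nuE !dotlin dot_cross_cross -w2 expr2 mulrA; field; exact: w0.
Qed.

Lemma volume1 : dot a (cross b nu) = w.
Proof.
rewrite dot_crossC nuE !dotlin dot_cross_cross -w2 expr2 mulrA mulVf//.
by rewrite mul1r.
Qed.

Lemma volume2 : dot b (cross nu a) = w.
Proof. by rewrite dot_crossC volume1. Qed.

Lemma volume_trace : dot a (cross q nu) + dot b (cross nu p) = - (2 * H * w).
Proof.
rewrite (dot_crossC a) -(dot_crossC nu) -dotDr (crossC a q) (crossC p b) -opprD.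
by rewrite addrC cross_trace dotNr dotZr normal_unit mulr1.
Qed.

(** The norm of (H + co) id - A, for A the shape operator, of trace 2 H and
    determinant K. *)
Lemma gauss_map_norm (co : R) :
  tr (dot ((H + co) *: a + p) ((H + co) *: a + p))
     (dot ((H + co) *: a + p) ((H + co) *: b + q))
     (dot ((H + co) *: b + q) ((H + co) *: a + p))
     (dot ((H + co) *: b + q) ((H + co) *: b + q))
  = 2 * H ^+ 2 + 2 * co ^+ 2 - 2 * K.
Proof.
have [s [t [s' [t' [pE qE E HE ->]]]]] := coords.
have -> : H = - (s + t') / 2 by rewrite -HE; field.
have b0 : dot b b != 0.
  apply/eqP => b0; move: (exprn_gt0 2 w_gt0); rewrite w2 b0 mulr0 add0r.
  by rewrite oppr_gt0 ltNge sqr_ge0.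
have -> : t = (s' * dot a a + t' * dot a b - s * dot a b) / dot b b.
  by rewrite -E addrC addKr mulfK.
have := w2 => W2; have : w ^+ 2 != 0 by rewrite expf_neq0.
rewrite pE qE /tr /metric_trace !dotlin (dotC b a).
have -> : t = (s' * dot a a + t' * dot a b - s * dot a b) / dot b b.
  by rewrite -E addrC addKr mulfK.
rewrite W2; move: (dot a a) (dot b b) (dot a b) b0 => aa bb ab b0 d0.
by field; rewrite b0 d0.
Qed.

End ShapeOperator.

(** * Parametrized surfaces: curvature, Laplacian and the conformal Gauss map *)

Section LocalGeometry.
Context {R : realType}.
Variables (D : set (R * R)) (x : R * R -> 'rV[R]_3).

Local Notation pd1 f := (pd D false f).
Local Notation pd2 f := (pd D true f).

Definition met11 z := dot (pd1 x z) (pd1 x z).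
Definition met12 z := dot (pd1 x z) (pd2 x z).
Definition met22 z := dot (pd2 x z) (pd2 x z).
Definition density z : R := Num.sqrt (met11 z * met22 z - met12 z ^+ 2).

Definition nu z : 'rV[R]_3 :=
  let n := cross (pd1 x z) (pd2 x z) in (Num.sqrt (dot n n))^-1 *: n.

(** The components of the gradient of f times the area density; the Laplacian
    is the divergence of this flux divided by the density. *)
Definition flux1 (W : normedModType R) (f : R * R -> W) z : W :=
  (met22 z / density z) *: pd1 f z - (met12 z / density z) *: pd2 f z.
Definition flux2 (W : normedModType R) (f : R * R -> W) z : W :=
  (met11 z / density z) *: pd2 f z - (met12 z / density z) *: pd1 f z.
Definition lap (W : normedModType R) (f : R * R -> W) z : W :=
  (density z)^-1 *: (pd1 (flux1 f) z + pd2 (flux2 f) z).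

Definition trace_at z := metric_trace (met11 z) (met12 z) (met22 z) (density z).

Definition mean_curv z : R :=
  - trace_at z (dot (pd1 nu z) (pd1 x z)) (dot (pd1 nu z) (pd2 x z))
               (dot (pd2 nu z) (pd1 x z)) (dot (pd2 nu z) (pd2 x z)) / 2%:R.
Definition gauss_curv z : R :=
  (dot (pd1 nu z) (pd1 x z) * dot (pd2 nu z) (pd2 x z)
   - dot (pd1 nu z) (pd2 x z) * dot (pd2 nu z) (pd1 x z)) / density z ^+ 2.

Definition gauss_map (co : R) z : 'rV[R]_5 :=
  (mean_curv z + co) *: cone (x z) + tlift (x z) (nu z).

Definition norm2 (f : R * R -> 'rV[R]_5) z : R :=
  trace_at z (mink (pd1 f z) (pd1 f z)) (mink (pd1 f z) (pd2 f z))
             (mink (pd2 f z) (pd1 f z)) (mink (pd2 f z) (pd2 f z)).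

Definition euler_lagrange (co : R) z : R :=
  lap mean_curv z + 2%:R * (mean_curv z + co)
    * (mean_curv z * (mean_curv z - co) - gauss_curv z).

Lemma lap_ext (W : normedModType R) (f g : R * R -> W) z : D z ->
  (forall y, D y -> f y = g y) -> lap f z = lap g z.
Proof.
move=> Dz fg; rewrite /lap; congr (_ *: (_ + _)); apply: (pd_ext _ Dz) => y Dy.
  by rewrite /flux1 (pd_ext false Dy fg) (pd_ext true Dy fg).
by rewrite /flux2 (pd_ext false Dy fg) (pd_ext true Dy fg).
Qed.

Lemma norm2_ext (f g : R * R -> 'rV[R]_5) z : D z ->
  (forall y, D y -> f y = g y) -> norm2 f z = norm2 g z.
Proof.
by move=> Dz fg; rewrite /norm2 (pd_ext false Dz fg) (pd_ext true Dz fg).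
Qed.

Hypotheses (rD : relopen D) (Cx : class_C dirs2 4 D x)
  (det_gt0 : forall z, D z -> 0 < met11 z * met22 z - met12 z ^+ 2).

Let aD := relopen_accessible rD.

Let C1 (W : normedModType R) k (f : R * R -> W) :
  class_C dirs2 k.+1 D f -> class_C dirs2 k D (pd1 f).
Proof. exact: class_pd. Qed.

Let C2 (W : normedModType R) k (f : R * R -> W) :
  class_C dirs2 k.+1 D f -> class_C dirs2 k D (pd2 f).
Proof. exact: class_pd. Qed.

Lemma class_met11 : class_C dirs2 3 D met11.
Proof. by apply: (class_C_dot aD); exact: C1. Qed.
Lemma class_met12 : class_C dirs2 3 D met12.
Proof. by apply: (class_C_dot aD); [exact: C1|exact: C2]. Qed.
Lemma class_met22 : class_C dirs2 3 D met22.
Proof. by apply: (class_C_dot aD); exact: C2. Qed.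

Lemma density_gt0 z : D z -> 0 < density z.
Proof. by move=> Dz; rewrite sqrtr_gt0 det_gt0. Qed.

Lemma density2 z : D z -> density z ^+ 2 = met11 z * met22 z - met12 z ^+ 2.
Proof. by move=> Dz; rewrite sqr_sqrtr// ltW// det_gt0. Qed.

Lemma class_density : class_C dirs2 3 D density.
Proof.
apply: (class_C_sqrt aD det_gt0); apply: (class_C_sub aD).
  by apply: (class_C_mul aD); [exact: class_met11|exact: class_met22].
by apply: (class_C_mul aD); exact: class_met12.
Qed.

Let class_inv_density : class_C dirs2 3 D (fun z => (density z)^-1).
Proof.
apply: (class_C_inv aD); last exact: class_density.
by move=> z Dz; rewrite lt0r_neq0// density_gt0.
Qed.

Lemma nuE z : nu z = (density z)^-1 *: cross (pd1 x z) (pd2 x z).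
Proof. by rewrite /nu /density dot_cross_cross. Qed.

Lemma class_nu : class_C dirs2 3 D nu.
Proof.
apply: (class_C_ext (f := fun z => (density z)^-1 *: cross (pd1 x z) (pd2 x z))).
  by move=> z _; rewrite nuE.
apply: (class_C_scale aD class_inv_density).
apply: (class_C_cross aD); first exact: C1.
exact: C2.
Qed.

Lemma nu_unit z : D z -> dot (nu z) (nu z) = 1.
Proof.
move=> Dz; rewrite nuE !dotlin dot_cross_cross -(density2 Dz).
by rewrite expr2 mulrA; field; rewrite lt0r_neq0// density_gt0.
Qed.

Lemma nu_tangent1 z : dot (pd1 x z) (nu z) = 0.
Proof. by rewrite nuE dotZr dot_cross_l mulr0. Qed.

Lemma nu_tangent2 z : dot (pd2 x z) (nu z) = 0.
Proof. by rewrite nuE dotZr dot_cross_r mulr0. Qed.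

Lemma dnu_normal b z : D z -> dot (pd D b nu z) (nu z) = 0.
Proof.
move=> Dz; have dn := pd_has_deriv b class_nu Dz.
have dn1 := has_deriv_ext Dz (fun y Dy => nu_unit Dy) (has_deriv_dot dn dn).
have := has_deriv_unique (pd_reachable rD b Dz) dn1
          (has_deriv_cst_scalar D 1 (coord_dir b) z).
by rewrite (dotC (nu z)) => E; lra.
Qed.

Let cancel_common (a a' b c : R) : a + b = 0 -> a' + c = 0 -> a' = a -> b = c.
Proof. by move=> ab ac E; lra. Qed.

(** The second fundamental form is symmetric because partial derivatives
    commute. *)
Lemma dnu_sym z : D z ->
  dot (pd1 nu z) (pd2 x z) = dot (pd2 nu z) (pd1 x z).
Proof.
move=> Dz.
have e1 := has_deriv_ext Dz (fun y _ => nu_tangent2 y)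
  (has_deriv_dot (pd_has_deriv false (C2 Cx) Dz) (pd_has_deriv false class_nu Dz)).
have e2 := has_deriv_ext Dz (fun y _ => nu_tangent1 y)
  (has_deriv_dot (pd_has_deriv true (C1 Cx) Dz) (pd_has_deriv true class_nu Dz)).
have E1 := has_deriv_unique (pd_reachable rD false Dz) e1
          (has_deriv_cst_scalar D 0 (coord_dir false) z).
have E2 := has_deriv_unique (pd_reachable rD true Dz) e2
          (has_deriv_cst_scalar D 0 (coord_dir true) z).
have S := pd_mixed rD Dz (class_C_le (isT : (2 <= 4)%N) Cx).
have := cancel_common E1 E2 (congr1 (fun v => dot v (nu z)) S).
by rewrite (dotC (pd2 x z)) (dotC (pd1 x z)).
Qed.

Lemma class_trace k (m11 m12 m21 m22 : R * R -> R) : (k <= 3)%N ->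
  class_C dirs2 k D m11 -> class_C dirs2 k D m12 ->
  class_C dirs2 k D m21 -> class_C dirs2 k D m22 ->
  class_C dirs2 k D (fun z => trace_at z (m11 z) (m12 z) (m21 z) (m22 z)).
Proof.
move=> k3 c11 c12 c21 c22; apply: (class_C_mul aD); last first.
  apply: (class_C_le k3); apply: (class_C_inv aD).
    by move=> z Dz; rewrite expf_neq0// lt0r_neq0// density_gt0.
  exact: class_C_mul aD class_density class_density.
apply: (class_C_add aD).
  apply: (class_C_sub aD).
    exact: class_C_mul aD (class_C_le k3 class_met22) c11.
  exact: class_C_mul aD (class_C_le k3 class_met12) (class_C_add aD c12 c21).
exact: class_C_mul aD (class_C_le k3 class_met11) c22.
Qed.

Let class_dd b b' :
  class_C dirs2 2 D (fun z => dot (pd D b nu z) (pd D b' x z)).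
Proof.
apply: (class_C_dot aD); first exact: class_pd class_nu.
by apply: class_C_pred; exact: class_pd Cx.
Qed.

Lemma class_mean_curv : class_C dirs2 2 D mean_curv.
Proof.
apply: (class_C_mul aD); last exact: class_C_cst.
apply: (class_C_opp aD); by apply: (class_trace (isT : (2 <= 3)%N)); exact: class_dd.
Qed.

Lemma class_gauss_curv : class_C dirs2 2 D gauss_curv.
Proof.
apply: (class_C_mul aD); last first.
  apply: (class_C_inv aD).
    by move=> z Dz; rewrite expf_neq0// lt0r_neq0// density_gt0.
  exact: class_C_pred (class_C_mul aD class_density class_density).
by apply: (class_C_sub aD); apply: (class_C_mul aD); exact: class_dd.
Qed.

Let class_flux_coef (f : R * R -> R) k : (k <= 3)%N ->
  class_C dirs2 3 D f -> class_C dirs2 k D (fun z => f z / density z).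
Proof.
by move=> k3 Cf; apply: (class_C_le k3); exact: class_C_mul aD Cf class_inv_density.
Qed.

Lemma class_flux1 (W : normedModType R) k (f : R * R -> W) : (k <= 3)%N ->
  class_C dirs2 k.+1 D f -> class_C dirs2 k D (flux1 f).
Proof.
move=> k3 Cf; apply: (class_C_sub aD).
  exact: class_C_scale aD (class_flux_coef k3 class_met22) (C1 Cf).
exact: class_C_scale aD (class_flux_coef k3 class_met12) (C2 Cf).
Qed.

Lemma class_flux2 (W : normedModType R) k (f : R * R -> W) : (k <= 3)%N ->
  class_C dirs2 k.+1 D f -> class_C dirs2 k D (flux2 f).
Proof.
move=> k3 Cf; apply: (class_C_sub aD).
  exact: class_C_scale aD (class_flux_coef k3 class_met11) (C2 Cf).
exact: class_C_scale aD (class_flux_coef k3 class_met12) (C1 Cf).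
Qed.

Lemma class_lap (W : normedModType R) k (f : R * R -> W) : (k <= 2)%N ->
  class_C dirs2 k.+2 D f -> class_C dirs2 k D (lap f).
Proof.
move=> k2 Cf.
apply: (class_C_scale aD (class_C_le (leqW k2) class_inv_density)).
have k3 : (k.+1 <= 3)%N by [].
exact: class_C_add aD (C1 (class_flux1 k3 Cf)) (C2 (class_flux2 k3 Cf)).
Qed.

Lemma class_euler_lagrange co : class_C dirs2 0 D (euler_lagrange co).
Proof.
have CH : class_C dirs2 0 D mean_curv := class_C_le (leq0n 2) class_mean_curv.
have CK : class_C dirs2 0 D gauss_curv := class_C_le (leq0n 2) class_gauss_curv.
have Cc (c : R) : class_C dirs2 0 D (fun=> c) := class_C_cst 0 c aD.
apply: (class_C_add aD (class_lap (leq0n 2) class_mean_curv)).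
apply: (class_C_mul aD (class_C_mul aD (Cc 2%:R) (class_C_add aD CH (Cc co)))).
exact: class_C_sub aD (class_C_mul aD CH (class_C_sub aD CH (Cc co))) CK.
Qed.

Lemma class_cone k : (k <= 4)%N -> class_C dirs2 k D (fun z => cone (x z)).
Proof.
move=> k4; have Cxk := class_C_le k4 Cx.
have Cq (c : R) : class_C dirs2 k D (fun z => (dot (x z) (x z) + c) / 2%:R).
  apply: (class_C_mul aD _ (class_C_cst k _ aD)).
  exact: class_C_add aD (class_C_dot aD Cxk Cxk) (class_C_cst k c aD).
exact: class_C_mk5 aD Cxk (Cq _) (Cq _).
Qed.

Lemma class_gauss_map co : class_C dirs2 2 D (gauss_map co).
Proof.
have Cn : class_C dirs2 2 D nu := class_C_pred class_nu.
have Cx2 : class_C dirs2 2 D x := class_C_le (isT : (2 <= 4)%N) Cx.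
have CX := class_cone (isT : (2 <= 4)%N).
have Cq := class_C_dot aD Cx2 Cn.
apply: (class_C_add aD _ (class_C_mk5 aD Cn Cq Cq)).
exact: class_C_scale aD (class_C_add aD class_mean_curv (class_C_cst 2 co aD)) CX.
Qed.

Lemma gauss_map_deSitter co z : D z -> deSitter (gauss_map co z).
Proof.
move=> Dz; rewrite /deSitter /= !minklin mink_cone mink_cone_tlift.
rewrite (minkC (tlift _ _) (cone _)) mink_cone_tlift mink_tlift nu_unit//.
by rewrite !(mulr0, add0r).
Qed.

(** ** The differential of the conformal Gauss map *)

(** The derivative of the lifted normal also has a component along the light-
    like vector; it is the tangential part of the normal, zero. *)
Lemma deriv_gauss_map co b z : D z ->
  pd D b (gauss_map co) z
  = pd D b mean_curv z *: cone (x z)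
    + tlift (x z) ((mean_curv z + co) *: pd D b x z + pd D b nu z).
Proof.
move=> Dz; apply: pd_eq => //.
have dx := pd_has_deriv b Cx Dz.
have dn := pd_has_deriv b class_nu Dz.
have dH := pd_has_deriv b class_mean_curv Dz.
have dHc := has_derivD dH (has_deriv_cst_scalar D co (coord_dir b) z).
have tan : dot (pd D b x z) (nu z) = 0.
  by case: b {dx dn dH dHc}; [exact: nu_tangent2|exact: nu_tangent1].
have := has_derivD (has_derivZ dHc (has_deriv_cone dx)) (has_deriv_tlift dx dn).
by rewrite tan scale0r !addr0 tliftD tliftZ -addrA.
Qed.

Lemma norm2_gauss_map co z : D z ->
  norm2 (gauss_map co) z
  = 2 * mean_curv z ^+ 2 + 2 * co ^+ 2 - 2 * gauss_curv z.
Proof.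
move=> Dz; rewrite /norm2 !(deriv_gauss_map co _ Dz).
have mm s t u v : mink (s *: cone (x z) + tlift (x z) u)
                       (t *: cone (x z) + tlift (x z) v) = dot u v.
  rewrite !minklin mink_cone mink_tlift mink_cone_tlift.
  by rewrite (minkC _ (cone _)) mink_cone_tlift !(mulr0, add0r).
rewrite !mm; exact: (gauss_map_norm (density_gt0 Dz) (density2 Dz) (nuE z)
  (dnu_normal false Dz) (dnu_normal true Dz) (dnu_sym Dz)).
Qed.

Let regroup X (c : 'rV[R]_5) (a b p q : 'rV[R]_3) (s t H1 H2 k : R) :
  s *: (H1 *: c + tlift X (k *: a + p)) - t *: (H2 *: c + tlift X (k *: b + q))
  = (s * H1 - t * H2) *: c
    + (k *: tlift X (s *: a - t *: b) + tlift X (s *: p - t *: q)).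
Proof.
rewrite !(tliftD, tliftN, tliftZ); move: (tlift X a) (tlift X b) (tlift X p) (tlift X q).
by move=> A B' P Q; apply/rowP => i; rewrite !mxE; ring.
Qed.

Let flux1_x z : flux1 x z = cross (pd2 x z) (nu z).
Proof. exact: flux1_position (nuE z). Qed.

Let flux2_x z : flux2 x z = cross (nu z) (pd1 x z).
Proof. exact: flux2_position (nuE z). Qed.

Let flux1_nu z : D z -> flux1 nu z
  = - (2 * mean_curv z) *: cross (pd2 x z) (nu z) - cross (pd2 nu z) (nu z).
Proof.
move=> Dz; exact: (flux1_normal (density_gt0 Dz) (density2 Dz) (nuE z)
  (dnu_normal false Dz) (dnu_normal true Dz) (dnu_sym Dz)).
Qed.

Let flux2_nu z : D z -> flux2 nu z
  = - (2 * mean_curv z) *: cross (nu z) (pd1 x z) - cross (nu z) (pd1 nu z).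
Proof.
move=> Dz; exact: (flux2_normal (density_gt0 Dz) (density2 Dz) (nuE z)
  (dnu_normal false Dz) (dnu_normal true Dz) (dnu_sym Dz)).
Qed.

Let collect X (P c H : R) (u : 'rV[R]_5) (v w : 'rV[R]_3) :
  P *: u + ((H + c) *: tlift X v + tlift X (- (2 * H) *: v - w))
  = P *: u + ((c - H) *: tlift X v - tlift X w).
Proof.
rewrite tliftD tliftN tliftZ; move: (tlift X v) (tlift X w) => V' W'.
by apply/rowP => i; rewrite !mxE; ring.
Qed.

(** By the shape operator algebra the flux is made of cross products of first
    derivatives of x and nu, whose divergence is easy because mixed partial
    derivatives agree. *)
Lemma flux1_gauss_map co z : D z ->
  flux1 (gauss_map co) z
  = flux1 mean_curv z *: cone (x z)
    + ((co - mean_curv z) *: tlift (x z) (cross (pd2 x z) (nu z))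
       - tlift (x z) (cross (pd2 nu z) (nu z))).
Proof.
move=> Dz; rewrite /flux1 !(deriv_gauss_map co _ Dz).
rewrite regroup -/(flux1 x z) -/(flux1 nu z) (flux1_x z) (flux1_nu Dz).
exact: collect.
Qed.

Lemma flux2_gauss_map co z : D z ->
  flux2 (gauss_map co) z
  = flux2 mean_curv z *: cone (x z)
    + ((co - mean_curv z) *: tlift (x z) (cross (nu z) (pd1 x z))
       - tlift (x z) (cross (nu z) (pd1 nu z))).
Proof.
move=> Dz; rewrite /flux2 !(deriv_gauss_map co _ Dz).
rewrite regroup -/(flux2 x z) -/(flux2 nu z) (flux2_x z) (flux2_nu Dz).
exact: collect.
Qed.

(** The fluxes of H, contracted with the coordinate fields, do not depend on
    which factor is differentiated: the metric is symmetric. *)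
Lemma flux_swap z :
  flux1 mean_curv z *: pd1 x z + flux2 mean_curv z *: pd2 x z
  = pd1 mean_curv z *: flux1 x z + pd2 mean_curv z *: flux2 x z.
Proof.
rewrite /flux1 /flux2; move: (pd1 x z) (pd2 x z) (pd1 mean_curv z) (pd2 mean_curv z).
by move=> a b h k; apply/rowP => i; rewrite !mxE /GRing.scale /=; ring.
Qed.

Let assemble (c Ta Tb Tbn Tna Tbp Tqa Tmn Tnm Tqp Tkn Tnk Tn l : 'rV[R]_5)
    (dP dQ F1 F2 H1 H2 H K co w s1 s2 : R) :
  Tbp + Tqa = (2 * H * w) *: Tn -> Tqp = - ((K * w) *: Tn) ->
  Tnm = - Tmn -> Tnk = - Tkn ->
  F1 *: Ta + F2 *: Tb = H1 *: Tbn + H2 *: Tna -> s1 + s2 = - (2 * H * w) ->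
  w != 0 ->
  w^-1 *: (dP *: c + F1 *: Ta + ((0 - H1) *: Tbn
             + (co - H) *: (Tmn + Tbp + w *: l) - (Tkn + Tqp + s1 *: l))
           + (dQ *: c + F2 *: Tb + ((0 - H2) *: Tna
             + (co - H) *: (Tqa + Tnm + w *: l) - (Tqp + Tnk + s2 *: l))))
  = (w^-1 * (dP + dQ)) *: c
    + ((2 * H * (co - H) + 2 * K) *: Tn + (2 * co) *: l).
Proof.
move=> h1 -> -> -> h2 h3 w0.
have -> : Tqa = (2 * H * w) *: Tn - Tbp by rewrite -h1 addrC addKr.
have h2' : F1 *: Ta = H1 *: Tbn + H2 *: Tna - F2 *: Tb by rewrite -h2 addrK.
have -> : s2 = - (2 * H * w) - s1 by rewrite -h3 addrC addKr.
by rewrite h2'; apply/rowP => i; rewrite !mxE; field.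
Qed.

(** In the divergence of the fluxes the second derivatives cancel in pairs,
    and the terms in the gradient of H cancel by [flux_swap]; what is left is
    the trace and the determinant of the shape operator, and a multiple of the
    light-like vector produced by the moving base point of the lift. *)
Lemma lap_gauss_map co z : D z ->
  lap (gauss_map co) z
  = lap mean_curv z *: cone (x z)
    + ((2 * mean_curv z * (co - mean_curv z) + 2 * gauss_curv z)
         *: tlift (x z) (nu z) + (2 * co) *: lvec).
Proof.
move=> Dz.
have Cx2 : class_C dirs2 2 D x := class_C_le (isT : (2 <= 4)%N) Cx.
have dx b := pd_has_deriv b Cx Dz.
have dxx b b' := pd_has_deriv b (class_pd b' Cx) Dz.
have dn b := pd_has_deriv b class_nu Dz.
have dnn b b' := pd_has_deriv b (class_pd b' class_nu) Dz.
have dH b := pd_has_deriv b class_mean_curv Dz.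
have dP := pd_has_deriv false (class_flux1 (isT : (1 <= 3)%N) class_mean_curv) Dz.
have dQ := pd_has_deriv true (class_flux2 (isT : (1 <= 3)%N) class_mean_curv) Dz.
have dco b := has_derivB (has_deriv_cst_scalar D co (coord_dir b) z) (dH b).
have e1 := pd_eq rD Dz (has_deriv_ext Dz (fun y Dy => esym (flux1_gauss_map co Dy))
  (has_derivD (has_derivZ dP (has_deriv_cone (dx false)))
    (has_derivB
      (has_derivZ (dco false)
         (has_deriv_tlift (dx false) (has_deriv_cross (dxx false true) (dn false))))
      (has_deriv_tlift (dx false) (has_deriv_cross (dnn false true) (dn false)))))).
have e2 := pd_eq rD Dz (has_deriv_ext Dz (fun y Dy => esym (flux2_gauss_map co Dy))
  (has_derivD (has_derivZ dQ (has_deriv_cone (dx true)))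
    (has_derivB
      (has_derivZ (dco true)
         (has_deriv_tlift (dx true) (has_deriv_cross (dn true) (dxx true false))))
      (has_deriv_tlift (dx true) (has_deriv_cross (dn true) (dnn true false)))))).
rewrite /lap e1 e2 !tliftD.
have := flux_swap z.
rewrite flux1_x flux2_x => sw.
have w0 := density_gt0 Dz.
have T u v (uv : u = v) : tlift (x z) u = tlift (x z) v by rewrite uv.
have ct := cross_trace w0 (density2 Dz) (nuE z) (dnu_normal false Dz) (dnu_normal true Dz) (dnu_sym Dz).
have cd := cross_det w0 (density2 Dz) (nuE z) (dnu_normal false Dz) (dnu_normal true Dz) (dnu_sym Dz).
have vt := volume_trace w0 (density2 Dz) (nuE z) (dnu_normal false Dz) (dnu_normal true Dz) (dnu_sym Dz).
rewrite (volume1 w0 (density2 Dz) (nuE z)) (volume2 w0 (density2 Dz) (nuE z)).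
apply: assemble.
- by rewrite -tliftD -tliftZ; exact: T ct.
- by rewrite crossC tliftN -tliftZ; congr (- _); exact: T cd.
- by rewrite -tliftN; apply: T; rewrite (pd_mixed rD Dz Cx2); exact: crossC.
- by rewrite -tliftN; apply: T; rewrite (pd_mixed rD Dz (class_C_pred class_nu)); exact: crossC.
- by rewrite -!tliftZ -!tliftD; exact: T sw.
- exact: vt.
- exact: lt0r_neq0.
Qed.

(** ** The conformal Gauss map sees exactly the Euler-Lagrange expression *)

(** The norm of the differential is such that the multiples of the lifted
    normal and of the light-like vector cancel, leaving a multiple of the
    cone. *)
Theorem gauss_map_tension co z : D z ->
  lap (gauss_map co) z + norm2 (gauss_map co) z *: gauss_map co z
    - (2%:R * co) *: deSitter_proj (gauss_map co z) lvec
  = euler_lagrange co z *: cone (x z).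
Proof.
move=> Dz; rewrite lap_gauss_map// norm2_gauss_map// /deSitter_proj.
have -> : mink (gauss_map co z) lvec = - (mean_curv z + co).
  by rewrite !minklin mink_cone_lvec mink_tlift_lvec addr0 mulrN1.
rewrite /gauss_map /euler_lagrange.
move: (lap mean_curv z) (mean_curv z) (gauss_curv z) (cone _) (tlift _ _) => L H K c t.
by apply/rowP => i; rewrite !mxE; ring.
Qed.

End LocalGeometry.

(** * Independence of the chart *)

Section ChartChange.
Context {R : realType}.
Variables (D D' T U : set (R * R)) (t : R * R -> R * R).
Hypotheses (rD : relopen D) (rD' : relopen D') (oU : open U) (TE : T = D `&` U)
  (tD' : forall z, T z -> D' (t z)) (Ct : forall k, class_C dirs2 k T t).

Let rT : relopen T. Proof. by rewrite TE; exact: relopen_openI. Qed.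
Let aT := relopen_accessible rT.
Let aD' := relopen_accessible rD'.

Let jac b z : R * R := pd T b t z.
Local Notation ja z := (jac false z).1.
Local Notation jb z := (jac false z).2.
Local Notation jc z := (jac true z).1.
Local Notation jd z := (jac true z).2.

Definition jacobian z : R := ja z * jd z - jc z * jb z.

Let Cjac b k : class_C dirs2 k T (jac b).
Proof. exact: class_pd (Ct k.+1). Qed.

Let Cjac1 b k : class_C dirs2 k T (fun z => (jac b z).1).
Proof. exact: class_C_fst aT (Cjac b k). Qed.

Let Cjac2 b k : class_C dirs2 k T (fun z => (jac b z).2).
Proof. exact: class_C_snd aT (Cjac b k). Qed.

Let dt b z : T z -> has_deriv T t (coord_dir b) z (jac b z).
Proof. exact: pd_has_deriv (Ct 1). Qed.

Lemma pd_local (W : normedModType R) b (f g : R * R -> W) z : T z ->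
  (forall y, T y -> f y = g y) -> pd D b f z = pd T b g z.
Proof.
move=> Tz fg; rewrite !pdE; have := Tz; rewrite {1}TE => -[Dz Uz].
rewrite -(deriv_along_ext _ Tz fg) TE.
apply: deriv_along_near => //; first exact: nbhs_setIl.
by near=> y.
Unshelve. all: by end_near. Qed.

(** The chain rule holds for scalar and for vector targets; the invariance of
    the Laplacian is proved for both at once by taking it as a hypothesis. *)
Definition chain_rule (W : normedModType R) := forall (f : R * R -> W) b z,
  class_C dirs2 1 D' f -> T z ->
  has_deriv T (fun y => f (t y)) (coord_dir b) z
    ((jac b z).1 *: pd D' false f (t z) + (jac b z).2 *: pd D' true f (t z)).

Lemma chain_rule_scalar : chain_rule R.
Proof.
move=> f b z Cf Tz; rewrite !pdE.
have := has_deriv_chain rD' Cf tD' Tz (@dt b z Tz).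
exact.
Qed.

Lemma chain_rule_row n : chain_rule 'rV[R]_n.
Proof.
move=> f b z Cf Tz; rewrite !pdE.
exact: has_deriv_chain_row rD' Cf tD' Tz (@dt b z Tz).
Qed.

Section Transformation.
Variables (W : normedModType R) (f f' : R * R -> W).
Hypotheses (chW : chain_rule W) (fE : forall z, T z -> f z = f' (t z)).

Lemma pd_chart b z : class_C dirs2 1 D' f' -> T z ->
  pd D b f z = (jac b z).1 *: pd D' false f' (t z)
             + (jac b z).2 *: pd D' true f' (t z).
Proof.
move=> Cf' Tz; rewrite (pd_local b Tz fE); apply: (pd_eq rT Tz).
exact: chW.
Qed.

End Transformation.

(* Commutation of the partial derivatives of the change of charts. *)
Let jac_mixed1 z : T z ->
  pd T true (fun y => (jac false y).1) z = pd T false (fun y => (jac true y).1) z.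
Proof.
move=> Tz; have Ct1 := class_C_fst aT (Ct 2).
have E b y : T y -> (jac b y).1 = pd T b (fun y => (t y).1) y.
  by move=> Ty; symmetry; apply: (pd_eq rT Ty); apply: has_deriv_fst; exact: dt.
rewrite (pd_ext true Tz (E false)) (pd_ext false Tz (E true)).
by rewrite !pdE; exact: mixed_partials_plane.
Qed.

Let jac_mixed2 z : T z ->
  pd T true (fun y => (jac false y).2) z = pd T false (fun y => (jac true y).2) z.
Proof.
move=> Tz; have Ct1 := class_C_snd aT (Ct 2).
have E b y : T y -> (jac b y).2 = pd T b (fun y => (t y).2) y.
  by move=> Ty; symmetry; apply: (pd_eq rT Ty); apply: has_deriv_snd; exact: dt.
rewrite (pd_ext true Tz (E false)) (pd_ext false Tz (E true)).
by rewrite !pdE; exact: mixed_partials_plane.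
Qed.

Variables (x x' : R * R -> 'rV[R]_3).
Hypotheses (Jpos : forall z, T z -> 0 < jacobian z)
  (xE : forall z, T z -> x z = x' (t z)).

Section FirstOrder.
Hypothesis (Cx' : class_C dirs2 1 D' x').

Let xb b z : T z -> pd D b x z = (jac b z).1 *: pd D' false x' (t z)
             + (jac b z).2 *: pd D' true x' (t z).
Proof. exact: pd_chart (chain_rule_row (n := 3)) xE b z Cx'. Qed.

Lemma met11_chart z : T z -> met11 D x z = ja z ^+ 2 * met11 D' x' (t z)
  + 2 * (ja z * jb z) * met12 D' x' (t z) + jb z ^+ 2 * met22 D' x' (t z).
Proof.
move=> Tz; rewrite /met11 /met12 /met22 xb// !dotlin.
by rewrite (dotC (pd D' true x' _) (pd D' false x' _)); ring.
Qed.

Lemma met12_chart z : T z -> met12 D x z = ja z * jc z * met11 D' x' (t z)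
  + (ja z * jd z + jb z * jc z) * met12 D' x' (t z)
  + jb z * jd z * met22 D' x' (t z).
Proof.
move=> Tz; rewrite /met11 /met12 /met22 !xb// !dotlin.
by rewrite (dotC (pd D' true x' _) (pd D' false x' _)); ring.
Qed.

Lemma met22_chart z : T z -> met22 D x z = jc z ^+ 2 * met11 D' x' (t z)
  + 2 * (jc z * jd z) * met12 D' x' (t z) + jd z ^+ 2 * met22 D' x' (t z).
Proof.
move=> Tz; rewrite /met11 /met12 /met22 xb// !dotlin.
by rewrite (dotC (pd D' true x' _) (pd D' false x' _)); ring.
Qed.

Lemma det_chart z : T z -> met11 D x z * met22 D x z - met12 D x z ^+ 2
  = jacobian z ^+ 2
    * (met11 D' x' (t z) * met22 D' x' (t z) - met12 D' x' (t z) ^+ 2).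
Proof.
by move=> Tz; rewrite met11_chart// met12_chart// met22_chart// /jacobian; ring.
Qed.

Lemma density_chart z : T z -> density D x z = jacobian z * density D' x' (t z).
Proof.
move=> Tz; rewrite /density det_chart// sqrtrM ?sqr_ge0// sqrtr_sqr.
by rewrite gtr0_norm// Jpos.
Qed.

Lemma cross_chart z : T z -> cross (pd D false x z) (pd D true x z)
  = jacobian z *: cross (pd D' false x' (t z)) (pd D' true x' (t z)).
Proof.
move=> Tz; rewrite !xb// !crosslin !crossvv !scaler0 add0r addr0.
rewrite (crossC (pd D' true x' _)) !scalerN !scalerA -scalerBl /jacobian.
by congr (_ *: _); ring.
Qed.

(** The change of charts preserves the orientation: its Jacobian is positive. *)
Lemma nu_chart z : T z -> nu D x z = nu D' x' (t z).
Proof.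
move=> Tz; rewrite !nuE density_chart// cross_chart// scalerA; congr (_ *: _).
by rewrite invfM mulrAC mulVf ?mul1r// lt0r_neq0// Jpos.
Qed.

Hypothesis (det'_gt0 : forall z, D' z ->
  0 < met11 D' x' z * met22 D' x' z - met12 D' x' z ^+ 2).

(** The entries on the left are those of the pulled back bilinear form. *)
Lemma trace_chart z (m11 m12 m21 m22 : R) : T z ->
  trace_at D x z
    (ja z ^+ 2 * m11 + ja z * jb z * (m12 + m21) + jb z ^+ 2 * m22)
    (ja z * jc z * m11 + ja z * jd z * m12 + jb z * jc z * m21 + jb z * jd z * m22)
    (ja z * jc z * m11 + jb z * jc z * m12 + ja z * jd z * m21 + jb z * jd z * m22)
    (jc z ^+ 2 * m11 + jc z * jd z * (m12 + m21) + jd z ^+ 2 * m22)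
  = trace_at D' x' (t z) m11 m12 m21 m22.
Proof.
move=> Tz; rewrite /trace_at /metric_trace density_chart//.
rewrite met11_chart// met12_chart// met22_chart//.
have w0 : density D' x' (t z) != 0 by rewrite lt0r_neq0// sqrtr_gt0; apply: det'_gt0; exact: tD'.
have j0 : jacobian z != 0 by rewrite lt0r_neq0// Jpos.
move: w0 j0; rewrite /jacobian.
move: (density _ _ _) (met11 _ _ _) (met12 _ _ _) (met22 _ _ _) => w e g h.
move: (ja z) (jb z) (jc z) (jd z) => a b c d w0 j0.
by field; rewrite w0 j0.
Qed.

Let comb_sub (W : lmodType R) (s r a b c d : R) (u v : W) :
  s *: (a *: u + b *: v) - r *: (c *: u + d *: v)
  = (s * a - r * c) *: u + (s * b - r * d) *: v.
Proof. by rewrite !scalerDr !scalerA opprD addrACA -!scalerBl. Qed.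

Let comb_swap (W : lmodType R) (s r p q m : R) (u v : W) :
  s *: (p *: u - q *: v) - r *: (m *: v - q *: u)
  = (s * p + r * q) *: u + (- (s * q) - r * m) *: v.
Proof.
rewrite !scalerBr !scalerA opprB scalerDl scalerBl scaleNr.
by rewrite -!addrA; congr (_ + _); rewrite addrCA.
Qed.

Let comb_swap' (W : lmodType R) (s r p q m : R) (u v : W) :
  s *: (p *: v - q *: u) - r *: (m *: u - q *: v)
  = (- (s * q) - r * m) *: u + (s * p + r * q) *: v.
Proof. by rewrite comb_swap addrC. Qed.

Let diff2 (W : zmodType) (M p q Q : W) : (M + (p + q)) - (M + (Q + q)) = p - Q.
Proof. by rewrite opprD addrACA subrr add0r opprD addrACA subrr addr0. Qed.

Let piola (W : lmodType R) (a b c d m k : R) (F G F1 F2 G1 G2 : W) :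
  (m *: F + d *: (a *: F1 + b *: F2) - (k *: G + c *: (a *: G1 + b *: G2)))
  + (k *: G + a *: (c *: G1 + d *: G2) - (m *: F + b *: (c *: F1 + d *: F2)))
  = (a * d - c * b) *: (F1 + G2).
Proof.
rewrite [X in _ + X]addrC addrACA [X in _ + X]addrC !scalerDr !scalerA.
rewrite (mulrC d b) diff2 (mulrC a c).
rewrite (mulrC d a) (mulrC b c) !scalerBl; congr (_ + _).
by rewrite ![(c * a) *: G1 + _]addrC diff2.
Qed.

Lemma flux1_chart (W : normedModType R) (f f' : R * R -> W) z :
  chain_rule W -> (forall z, T z -> f z = f' (t z)) -> class_C dirs2 1 D' f' ->
  T z -> flux1 D x f z
  = jd z *: flux1 D' x' f' (t z) - jc z *: flux2 D' x' f' (t z).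
Proof.
move=> chW fE Cf' Tz; rewrite /flux1 /flux2 !(pd_chart chW fE _ Cf' Tz).
have w0 : density D' x' (t z) != 0.
  by rewrite lt0r_neq0// sqrtr_gt0; apply: det'_gt0; exact: tD'.
have j0 : jacobian z != 0 by rewrite lt0r_neq0// Jpos.
rewrite density_chart// met12_chart// met22_chart//.
rewrite comb_sub [in RHS]comb_swap; move: w0 j0; rewrite /jacobian.
move: (density _ _ _) (met11 _ _ _) (met12 _ _ _) (met22 _ _ _) => w e g h.
move: (ja z) (jb z) (jc z) (jd z) => a b c d w0 j0.
by congr (_ *: _ + _ *: _); field; rewrite w0 j0.
Qed.

Lemma flux2_chart (W : normedModType R) (f f' : R * R -> W) z :
  chain_rule W -> (forall z, T z -> f z = f' (t z)) -> class_C dirs2 1 D' f' ->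
  T z -> flux2 D x f z
  = ja z *: flux2 D' x' f' (t z) - jb z *: flux1 D' x' f' (t z).
Proof.
move=> chW fE Cf' Tz; rewrite /flux1 /flux2 !(pd_chart chW fE _ Cf' Tz).
have w0 : density D' x' (t z) != 0.
  by rewrite lt0r_neq0// sqrtr_gt0; apply: det'_gt0; exact: tD'.
have j0 : jacobian z != 0 by rewrite lt0r_neq0// Jpos.
rewrite density_chart// met12_chart// met11_chart//.
rewrite comb_sub [in RHS]comb_swap' ; move: w0 j0; rewrite /jacobian.
move: (density _ _ _) (met11 _ _ _) (met12 _ _ _) (met22 _ _ _) => w e g h.
move: (ja z) (jb z) (jc z) (jd z) => a b c d w0 j0.
by congr (_ *: _ + _ *: _); field; rewrite w0 j0.
Qed.

(** The coefficients of the pulled back flux are cofactors of the Jacobian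
    matrix, whose divergence vanishes since mixed partial derivatives agree; so
    divergences of fluxes transform like densities. *)
Lemma lap_chart (W : normedModType R) (f f' : R * R -> W) z :
  chain_rule W -> (forall z, T z -> f z = f' (t z)) -> class_C dirs2 2 D' f' ->
  class_C dirs2 1 D' (flux1 D' x' f') -> class_C dirs2 1 D' (flux2 D' x' f') ->
  T z -> lap D x f z = lap D' x' f' (t z).
Proof.
move=> chW fE Cf' C1 C2 Tz; rewrite /lap density_chart//.
have Cf1 := class_C_pred Cf'.
have e1 y : T y -> flux1 D x f y
    = jd y *: flux1 D' x' f' (t y) - jc y *: flux2 D' x' f' (t y).
  exact: flux1_chart chW fE Cf1.
have e2 y : T y -> flux2 D x f y
    = ja y *: flux2 D' x' f' (t y) - jb y *: flux1 D' x' f' (t y).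
  exact: flux2_chart chW fE Cf1.
have j1 b b' := pd_has_deriv b' (Cjac1 b 1) Tz.
have j2 b b' := pd_has_deriv b' (Cjac2 b 1) Tz.
have d1 := pd_eq rT Tz (has_derivB
  (has_derivZ (j2 true false) (chW _ false z C1 Tz))
  (has_derivZ (j1 true false) (chW _ false z C2 Tz))).
have d2 := pd_eq rT Tz (has_derivB
  (has_derivZ (j1 false true) (chW _ true z C2 Tz))
  (has_derivZ (j2 false true) (chW _ true z C1 Tz))).
rewrite (pd_local false Tz e1) (pd_local true Tz e2) d1 d2.
rewrite (jac_mixed1 Tz) (jac_mixed2 Tz) piola -/(jacobian z) scalerA.
by congr (_ *: _); rewrite invfM mulrAC mulVf ?mul1r// lt0r_neq0// Jpos.
Qed.

Let dot_pull (a b c d : R) (u v p q : 'rV[R]_3) :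
  dot (a *: u + b *: v) (c *: p + d *: q)
  = a * c * dot u p + a * d * dot u q + b * c * dot v p + b * d * dot v q.
Proof. by rewrite !dotlin; ring. Qed.

Let mink_pull (a b c d : R) (u v p q : 'rV[R]_5) :
  mink (a *: u + b *: v) (c *: p + d *: q)
  = a * c * mink u p + a * d * mink u q + b * c * mink v p + b * d * mink v q.
Proof. by rewrite !minklin; ring. Qed.

Lemma mean_curv_chart z : class_C dirs2 1 D' (nu D' x') -> T z ->
  mean_curv D x z = mean_curv D' x' (t z).
Proof.
move=> Cn Tz; rewrite /mean_curv -(trace_chart _ _ _ _ Tz).
rewrite !(pd_chart (chain_rule_row (n := 3)) nu_chart _ Cn Tz) !xb// !dot_pull.
congr (- trace_at _ _ _ _ _ _ _ / _); ring.
Qed.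

Lemma gauss_curv_chart z : class_C dirs2 1 D' (nu D' x') -> T z ->
  gauss_curv D x z = gauss_curv D' x' (t z).
Proof.
move=> Cn Tz; rewrite /gauss_curv density_chart//.
rewrite !(pd_chart (chain_rule_row (n := 3)) nu_chart _ Cn Tz) !xb// !dot_pull.
have w0 : density D' x' (t z) != 0.
  by rewrite lt0r_neq0// sqrtr_gt0; apply: det'_gt0; exact: tD'.
have j0 : jacobian z != 0 by rewrite lt0r_neq0// Jpos.
move: w0 j0; rewrite /jacobian.
move: (density _ _ _) (dot _ _) (dot _ _) (dot _ _) (dot _ _) => w m1 m2 m3 m4.
move: (ja z) (jb z) (jc z) (jd z) => a b c d w0 j0.
by field; rewrite w0 j0.
Qed.

Lemma norm2_chart (f f' : R * R -> 'rV[R]_5) z :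
  (forall z, T z -> f z = f' (t z)) -> class_C dirs2 1 D' f' -> T z ->
  norm2 D x f z = norm2 D' x' f' (t z).
Proof.
move=> fE Cf' Tz; rewrite /norm2 -(trace_chart _ _ _ _ Tz).
rewrite !(pd_chart (chain_rule_row (n := 5)) fE _ Cf' Tz) !mink_pull.
congr (trace_at _ _ _ _ _ _ _); ring.
Qed.

End FirstOrder.
End ChartChange.

(** * Surfaces *)

Section Frames.
Context {R : realType}.

(** The left-hand side is the trace in the orthonormal frame that Gram-Schmidt
    makes out of the coordinate frame; the next lemma is its analogue for
    determinants. *)
Lemma frame_trace (e f g w m11 m12 m21 m22 : R) :
  0 < e -> 0 < w -> w ^+ 2 = e * g - f ^+ 2 ->
  let s := Num.sqrt e in
  s^-1 * (s^-1 * m11)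
  + (- f / (s * w) * (- f / (s * w) * m11 + s / w * m12)
     + s / w * (- f / (s * w) * m21 + s / w * m22))
  = metric_trace e f g w m11 m12 m21 m22.
Proof.
move=> e0 w0 w2 s; have s0 : s != 0 by rewrite lt0r_neq0// sqrtr_gt0.
have wn0 := lt0r_neq0 w0.
have se : e = s ^+ 2 by rewrite sqr_sqrtr// ltW.
have gE : g = (w ^+ 2 + f ^+ 2) / s ^+ 2.
  by rewrite w2 se subrK mulrAC mulfV ?mul1r// expf_neq0.
by rewrite /metric_trace gE se; field; rewrite s0 wn0.
Qed.

Lemma frame_det (e f w m11 m12 m21 m22 : R) : 0 < e -> 0 < w ->
  let s := Num.sqrt e in
  let t := - f / (s * w) in let r := s / w in
  (s^-1 * (s^-1 * m11)) * (t * (t * m11 + r * m12) + r * (t * m21 + r * m22))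
  - (s^-1 * (t * m11 + r * m12)) * (t * (s^-1 * m11) + r * (s^-1 * m21))
  = (m11 * m22 - m12 * m21) / w ^+ 2.
Proof.
move=> e0 w0 s t r; have s0 : s != 0 by rewrite lt0r_neq0// sqrtr_gt0.
by rewrite /t /r; field; rewrite s0 lt0r_neq0.
Qed.

(** The Gram determinant is the squared length of the cross product, which
    vanishes only for dependent vectors. *)
Lemma row_free_gram (u v : 'rV[R]_3) : row_free (col_mx u v) ->
  0 < dot u u * dot v v - dot u v ^+ 2.
Proof.
move=> uv; rewrite -dot_cross_cross lt_def dot_ge0 andbT; apply/eqP => n0.
have cr0 := dot_eq0 n0.
have comb (a b : R) : a *: u + b *: v = 0 -> a = 0 /\ b = 0.
  move=> ab; have : row_mx a%:M b%:M *m col_mx u v = 0 :> 'rV_3.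
    by rewrite mul_row_col !mul_scalar_mx.
  move/eqP; rewrite mulmx_free_eq0// -row_mx0 => /eqP /eq_row_mx[/matrixP/(_ 0 0) + /matrixP/(_ 0 0)].
  by rewrite !mxE !mulr1n => -> ->.
have := cross_cross v u v; rewrite cr0.
rewrite -[X in cross v X](scale0r v) crossZr scale0r -scaleNr => /esym /comb[vv _].
have v0 : 0 *: u + 1 *: v = 0.
  by rewrite scale0r add0r scale1r; exact: dot_eq0.
by have [_ /eqP] := comb _ _ v0; rewrite oner_eq0.
Qed.

End Frames.

Section Charts.
Context {R : realType} (S : surface R).
Implicit Types (p q : S) (z : R * R).

Local Notation dom p := (cdom (chart_at p)).
Local Notation img p := (cimg (chart_at p)).
Local Notation phi p := (cmap (chart_at p)).
Local Notation psi p := (cinv (chart_at p)).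
Local Notation ovl p q := (overlap (chart_at p) (chart_at q)).
Local Notation tr p q := (transition (chart_at p) (chart_at q)).

Lemma img_relopen p : relopen (img p).
Proof. by have [_ ? _ _ _] := chart_at_chart p. Qed.

Lemma dom_open p : open (dom p).
Proof. by have [] := chart_at_chart p. Qed.

Lemma phiK p q : dom p q -> psi p (phi p q) = q.
Proof. by have [_ _ _ _] := chart_at_chart p; apply. Qed.

Lemma phi_img p q : dom p q -> img p (phi p q).
Proof. by exists q. Qed.

Lemma psi_dom p z : img p z -> dom p (psi p z).
Proof. by case=> q pq <-; rewrite phiK. Qed.

Lemma psiK p z : img p z -> phi p (psi p z) = z.
Proof. by case=> q pq <-; rewrite phiK. Qed.

Lemma local_center (A : Type) (f : S -> A) p : local (chart_at p) f (phi p p) = f p.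
Proof. by rewrite /local /= (phiK (chart_at_dom p)). Qed.

Lemma ovl_open p q : exists2 U, open U & ovl p q = img p `&` U.
Proof.
have [_ _ _ /continuousP cpsi _] := chart_at_chart p.
have /open_subspaceP[U oU UE] := cpsi _ (dom_open q).
exists U => //; rewrite setIC UE; apply/seteqP; split=> z [] //.
Qed.

Lemma tr_img p q z : ovl p q z -> img q (tr p q z).
Proof. by move=> [_ qz]; exact: phi_img. Qed.

Lemma tr_class p q k : class_C dirs2 k (ovl p q) (tr p q).
Proof. exact: (chart_at_compatible p q).1. Qed.

Lemma tr_jacobian p q z : ovl p q z -> 0 < jacobian (ovl p q) (tr p q) z.
Proof.
by move=> pqz; rewrite /jacobian !pdE; exact: (chart_at_compatible p q).2.
Qed.

Lemma local_tr (A : Type) (f : S -> A) p q z : ovl p q z ->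
  local (chart_at p) f z = local (chart_at q) f (tr p q z).
Proof. by move=> [_ qz]; rewrite /local /transition /= phiK. Qed.

(** A chart sends a point to the open half-plane as soon as one chart does:
    otherwise the second coordinate of the transition has an interior minimum,
    and the Jacobian vanishes. *)
Lemma tr_interior p q z : ovl p q z -> 0 < z.2 -> 0 < (tr p q z).2.
Proof.
move=> pqz z0; have [U oU TE] := ovl_open p q.
have rT : relopen (ovl p q) by rewrite TE; apply: relopen_openI => //; exact: img_relopen.
have t0 y : ovl p q y -> 0 <= (tr p q y).2.
  by move=> /tr_img; exact: relopen_half (img_relopen q).
rewrite lt_def (t0 _ pqz) andbT; apply/eqP => tz0.
have nT : \forall y \near z, ovl p q y.
  have [d d0 dT] := relopen_box rT pqz.
  have m0 : 0 < Num.min d z.2 by rewrite lt_min d0.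
  apply: filterS (near_box z m0) => y [y1]; rewrite lt_min => /andP[y2 y3].
  move: y1; rewrite lt_min => /andP[y1 _].
  by apply: dT => //; move: y3; rewrite ltr_norml; lra.
have crit b : (pd (ovl p q) b (tr p q) z).2 = 0.
  have dt := has_deriv_snd (pd_has_deriv b (tr_class p q 1) pqz).
  set l := _.2 in dt *.
  pose g (h : R) := (tr p q (h *: coord_dir b + z)).2.
  have dg : is_derive (0 : R) 1 g l.
    apply: (@has_deriv_is_derive _ [set h | ovl p q (h *: coord_dir b + z)]).
      exact: line_near.
    apply: (has_deriv_line (f := fun y => (tr p q y).2)).
    by rewrite scale0r add0r.
  have [a a0 ba] : exists2 a : R, 0 < a & forall h, `|h| < a -> ovl p q (h *: coord_dir b + z).
    have /nbhs_ballP[a a0 ba] := line_near (coord_dir b) nT.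
    by exists a => // h ha; apply: ba; rewrite /ball /= sub0r normrN.
  have dg0 := @derive1_at_min R g (- a) a 0.
  have : is_derive (0 : R) 1 g 0.
    apply: dg0.
    - lra.
    - move=> h; rewrite in_itv /= => /andP[h1 h2].
      have hT : ovl p q (h *: coord_dir b + z) by apply: ba; rewrite ltr_norml h1.
      have nh : \forall u \near h, ovl p q (u *: coord_dir b + z).
        have : \forall u \near h, u \in `]- a, a[.
          by apply: near_in_itvoo; rewrite in_itv /= h1.
        apply: filterS => u; rewrite in_itv /= => ua.
        by apply: ba; rewrite ltr_norml.
      have := has_deriv_snd (pd_has_deriv b (tr_class p q 1) hT).
      move=> /(has_deriv_line (f := fun y => (tr p q y).2)).
      by move=> /(has_deriv_is_derive nh) [].
    - by rewrite in_itv /=; lra.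
    - move=> h; rewrite in_itv /= => /andP[h1 h2].
      rewrite /g scale0r add0r tz0; apply: t0; apply: ba.
      by rewrite ltr_norml h1.
  by move=> [_ d0]; case: dg => _ <-; rewrite d0.
have := tr_jacobian pqz; rewrite /jacobian !crit !mulr0 subr0 ltxx.
by [].
Qed.

Lemma surface_interior_psi p z : img p z -> 0 < z.2 -> surface_interior (psi p z).
Proof.
move=> pz z0; have := chart_at_dom (psi p z) => qz.
have pqz : ovl p (psi p z) z by [].
exact: tr_interior pqz z0.
Qed.

End Charts.

(** * The geometry of an immersed surface in its charts *)

Section SurfaceGeometry.
Context {R : realType} (S : surface R) (X : S -> 'rV[R]_3).
Hypothesis immX : immersion 4 X.
Implicit Types (p q : S) (z : R * R).

Local Notation dom p := (cdom (chart_at p)).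
Local Notation img p := (cimg (chart_at p)).
Local Notation phi p := (cmap (chart_at p)).
Local Notation psi p := (cinv (chart_at p)).
Local Notation ovl p q := (overlap (chart_at p) (chart_at q)).
Local Notation tr p q := (transition (chart_at p) (chart_at q)).
Local Notation loc p f := (local (chart_at p) f).
Local Notation xl p := (local (chart_at p) X).

Let rI p : relopen (img p) := img_relopen p.

Lemma xl_class p : class_C dirs2 4 (img p) (xl p).
Proof. exact: immX.1. Qed.

Let xl1 p : class_C dirs2 1 (img p) (xl p).
Proof. exact: class_C_le (isT : (1 <= 4)%N) (xl_class p). Qed.

Lemma partial1E (W : normedModType R) (c : chart R S) (f : S -> W) :
  partial1 c f = pd (cimg c) false (local c f).
Proof. by rewrite pdE. Qed.

Lemma partial2E (W : normedModType R) (c : chart R S) (f : S -> W) :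
  partial2 c f = pd (cimg c) true (local c f).
Proof. by rewrite pdE. Qed.

(** The immersion condition is imposed at the centre of each chart; at another
    point of the chart the Gram determinant is the one at the centre of
    another chart times the square of a Jacobian. *)
Lemma metric_det_gt0 p z : img p z ->
  0 < met11 (img p) (xl p) z * met22 (img p) (xl p) z - met12 (img p) (xl p) z ^+ 2.
Proof.
move=> pz; set q := psi p z; have qq : dom q q := chart_at_dom q.
have pqz : ovl p q z by [].
have [U oU TE] := ovl_open p q.
rewrite (det_chart (rI p) (rI q) oU TE (@tr_img _ _ p q) (@tr_class _ _ p q)
  (@local_tr _ _ _ X p q) (xl1 q) pqz).
apply: mulr_gt0; first by rewrite exprn_gt0// tr_jacobian.
have := row_free_gram (immX.2 q); rewrite partial1E partial2E.
by [].
Qed.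

Let dens_gt0 p z (pz : img p z) := density_gt0 (@metric_det_gt0 p) pz.

Lemma normal_center q : normal X q = nu (img q) (xl q) (phi q q).
Proof. by rewrite /normal partial1E partial2E. Qed.

(** The geometric quantities at a point are defined in the chart centred at
    that point. Independence of the chart turns them into functions of the
    coordinates of one chart, which can be differentiated. *)
Lemma local_normal p z : img p z -> loc p (normal X) z = nu (img p) (xl p) z.
Proof.
move=> pz; rewrite {1}/local /= normal_center.
set q := psi p z; have pqz : ovl p q z by split=> //; exact: chart_at_dom.
have [U oU TE] := ovl_open p q.
symmetry; exact: (nu_chart (rI p) (rI q) oU TE (@tr_img _ _ p q) (@tr_class _ _ p q)
  (@tr_jacobian _ _ p q) (@local_tr _ _ _ X p q) (xl1 q) pqz).
Qed.

Lemma nu_class p : class_C dirs2 3 (img p) (nu (img p) (xl p)).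
Proof. exact: class_nu (rI p) (xl_class p) (@metric_det_gt0 p). Qed.

(** ** Orthonormal frames *)

Lemma met11_gt0 p z : img p z -> 0 < met11 (img p) (xl p) z.
Proof.
move=> /metric_det_gt0 d0; have := dot_ge0 (pd (img p) false (xl p) z).
rewrite -/(met11 (img p) (xl p) z) le_eqVlt => /predU1P[e0|//].
by move: d0; rewrite -e0 mul0r sub0r oppr_gt0 ltNge sqr_ge0.
Qed.

Lemma d1E (W : normedModType R) (f : S -> W) p : d1 X f p =
  (Num.sqrt (met11 (img p) (xl p) (phi p p)))^-1 *: pd (img p) false (loc p f) (phi p p).
Proof. by rewrite /d1 /dmap /= scale0r addr0 /g11 !partial1E. Qed.

Lemma d2E (W : normedModType R) (f : S -> W) p :
  let e := met11 (img p) (xl p) (phi p p) in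
  let w := density (img p) (xl p) (phi p p) in d2 X f p =
  (- met12 (img p) (xl p) (phi p p) / (Num.sqrt e * w))
    *: pd (img p) false (loc p f) (phi p p)
  + (Num.sqrt e / w) *: pd (img p) true (loc p f) (phi p p).
Proof. by rewrite /d2 /dmap /= /area_density /g11 /g12 /g22 !partial1E !partial2E. Qed.

Let frame_hyps p : [/\ 0 < met11 (img p) (xl p) (phi p p),
  0 < density (img p) (xl p) (phi p p) &
  density (img p) (xl p) (phi p p) ^+ 2
  = met11 (img p) (xl p) (phi p p) * met22 (img p) (xl p) (phi p p)
    - met12 (img p) (xl p) (phi p p) ^+ 2].
Proof.
have pp := phi_img (chart_at_dom p).
by split; [exact: met11_gt0|exact: dens_gt0|exact: (density2 (@metric_det_gt0 p) pp)].
Qed.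

Lemma dnorm2_center (Z : S -> 'rV[R]_5) p :
  dnorm2 X Z p = norm2 (img p) (xl p) (loc p Z) (phi p p).
Proof.
have [e0 w0 w2] := frame_hyps p; rewrite /dnorm2 d1E d2E /norm2 /trace_at.
by rewrite -(frame_trace _ _ _ _ e0 w0 w2) !minklin; ring.
Qed.

Lemma mean_curvature_center p :
  mean_curvature X p = mean_curv (img p) (xl p) (phi p p).
Proof.
have [e0 w0 w2] := frame_hyps p; rewrite /mean_curvature !d1E !d2E /mean_curv /trace_at.
have pp := phi_img (chart_at_dom p).
rewrite !(pd_ext _ pp (@local_normal p)).
by rewrite -(frame_trace _ _ _ _ e0 w0 w2) !dotlin; ring.
Qed.

Lemma gauss_curvature_center p :
  gauss_curvature X p = gauss_curv (img p) (xl p) (phi p p).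
Proof.
have [e0 w0 w2] := frame_hyps p; rewrite /gauss_curvature !d1E !d2E /gauss_curv.
have pp := phi_img (chart_at_dom p).
rewrite !(pd_ext _ pp (@local_normal p)).
by rewrite -(frame_det (met12 (img p) (xl p) (phi p p)) _ _ _ _ e0 w0) !dotlin; ring.
Qed.

Lemma laplace_center (W : normedModType R) (f : S -> W) p :
  laplace X f p = lap (img p) (xl p) (loc p f) (phi p p).
Proof.
rewrite /laplace /lap /area_density /g11 /g12 /g22 !partial1E !partial2E.
by rewrite ![pd _ _ (flux1 _ _ _)]pdE ![pd _ _ (flux2 _ _ _)]pdE.
Qed.

(** ** Geometric quantities in an arbitrary chart *)

Lemma local_mean_curvature p z : img p z ->
  loc p (mean_curvature X) z = mean_curv (img p) (xl p) z.
Proof.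
move=> pz; rewrite {1}/local /= mean_curvature_center.
set q := psi p z; have pqz : ovl p q z by split=> //; exact: chart_at_dom.
have [U oU TE] := ovl_open p q.
have Cn := class_C_le (isT : (1 <= 3)%N) (nu_class q).
symmetry; exact: (mean_curv_chart (rI p) (rI q) oU TE (@tr_img _ _ p q)
  (@tr_class _ _ p q) (@tr_jacobian _ _ p q) (@local_tr _ _ _ X p q) (xl1 q)
  (@metric_det_gt0 q) Cn pqz).
Qed.

Lemma local_gauss_curvature p z : img p z ->
  loc p (gauss_curvature X) z = gauss_curv (img p) (xl p) z.
Proof.
move=> pz; rewrite {1}/local /= gauss_curvature_center.
set q := psi p z; have pqz : ovl p q z by split=> //; exact: chart_at_dom.
have [U oU TE] := ovl_open p q.
have Cn := class_C_le (isT : (1 <= 3)%N) (nu_class q).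
symmetry; exact: (gauss_curv_chart (rI p) (rI q) oU TE (@tr_img _ _ p q)
  (@tr_class _ _ p q) (@tr_jacobian _ _ p q) (@local_tr _ _ _ X p q) (xl1 q)
  (@metric_det_gt0 q) Cn pqz).
Qed.

Lemma local_dnorm2 (Z : S -> 'rV[R]_5) p z : surface_C 1 Z -> img p z ->
  loc p (dnorm2 X Z) z = norm2 (img p) (xl p) (loc p Z) z.
Proof.
move=> CZ pz; rewrite {1}/local /= dnorm2_center.
set q := psi p z; have pqz : ovl p q z by split=> //; exact: chart_at_dom.
have [U oU TE] := ovl_open p q.
symmetry; exact: (norm2_chart (rI p) (rI q) oU TE (@tr_img _ _ p q)
  (@tr_class _ _ p q) (@tr_jacobian _ _ p q) (@local_tr _ _ _ X p q) (xl1 q)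
  (@metric_det_gt0 q) (@local_tr _ _ _ Z p q) (CZ q) pqz).
Qed.

Let local_laplace (W : normedModType R) (f : S -> W) p z :
  (forall q, chain_rule (img q) (ovl p q) (tr p q) W) ->
  surface_C 2 f -> img p z ->
  loc p (laplace X f) z = lap (img p) (xl p) (loc p f) z.
Proof.
move=> chW Cf pz; rewrite {1}/local /= laplace_center.
set q := psi p z; have pqz : ovl p q z by split=> //; exact: chart_at_dom.
have [U oU TE] := ovl_open p q.
symmetry; exact: (lap_chart (rI p) (rI q) oU TE (@tr_img _ _ p q)
  (@tr_class _ _ p q) (@tr_jacobian _ _ p q) (@local_tr _ _ _ X p q) (xl1 q)
  (@metric_det_gt0 q) (chW q) (@local_tr _ _ _ f p q) (Cf q)
  (class_flux1 (rI q) (xl_class q) (@metric_det_gt0 q) (isT : (1 <= 3)%N) (Cf q))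
  (class_flux2 (rI q) (xl_class q) (@metric_det_gt0 q) (isT : (1 <= 3)%N) (Cf q))
  pqz).
Qed.

Lemma local_laplace_scalar (f : S -> R) p z : surface_C 2 f -> img p z ->
  loc p (laplace X f) z = lap (img p) (xl p) (loc p f) z.
Proof.
apply: local_laplace => q.
exact: chain_rule_scalar (rI q) (@tr_img _ _ p q) (@tr_class _ _ p q).
Qed.

Lemma local_laplace_row n (f : S -> 'rV[R]_n) p z : surface_C 2 f -> img p z ->
  loc p (laplace X f) z = lap (img p) (xl p) (loc p f) z.
Proof.
apply: local_laplace => q.
exact: chain_rule_row (rI q) (@tr_img _ _ p q) (@tr_class _ _ p q) n.
Qed.

Lemma mean_curvature_class : surface_C 2 (mean_curvature X).
Proof.
move=> p; apply: class_C_ext (class_mean_curv (rI p) (xl_class p) (@metric_det_gt0 p)).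
by move=> z pz; rewrite (local_mean_curvature pz).
Qed.

Section GaussMap.
Variable co : R.
Local Notation Y := (conformal_gauss_map co X).

Lemma local_gauss_map p z : img p z ->
  loc p Y z = gauss_map (img p) (xl p) co z.
Proof.
move=> pz; have nE := local_normal pz; have HE := local_mean_curvature pz.
rewrite /gauss_map -nE -HE.
by rewrite /local /= /conformal_gauss_map /lightcone_lift /support_function.
Qed.

Lemma gauss_map_surface_C : surface_C 2 Y.
Proof.
move=> p; apply: class_C_ext (class_gauss_map (rI p) (xl_class p) (@metric_det_gt0 p) co).
by move=> z pz; rewrite (local_gauss_map pz).
Qed.

Lemma conformal_gauss_map_deSitter p : deSitter (Y p).
Proof.
have pp := phi_img (chart_at_dom p).
have := gauss_map_deSitter (@metric_det_gt0 p) co pp.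
by rewrite -(local_gauss_map pp) local_center.
Qed.

Definition helfrich_el p : R :=
  laplace X (mean_curvature X : S -> R^o) p
  + 2%:R * (mean_curvature X p + co)
    * (mean_curvature X p * (mean_curvature X p - co) - gauss_curvature X p).

Lemma local_helfrich_el p z : img p z ->
  loc p helfrich_el z = euler_lagrange (img p) (xl p) co z.
Proof.
move=> pz; have HE := local_mean_curvature pz; have KE := local_gauss_curvature pz.
rewrite /euler_lagrange.
have -> : lap (img p) (xl p) (mean_curv (img p) (xl p)) z
  = lap (img p) (xl p) (loc p (mean_curvature X)) z.
  apply: (lap_ext _ pz) => y py; symmetry; exact: local_mean_curvature py.
rewrite -(local_laplace_scalar mean_curvature_class pz) -HE -KE.
by [].
Qed.

(** The identity of parametrized surfaces, read in the chart centred at p. *)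
Lemma tension_identity p :
  laplace X Y p + dnorm2 X Y p *: Y p - (2%:R * co) *: deSitter_proj (Y p) lvec
  = helfrich_el p *: cone (X p).
Proof.
have pp := phi_img (chart_at_dom p).
have := gauss_map_tension (rI p) (xl_class p) (@metric_det_gt0 p) co pp.
rewrite -(local_helfrich_el pp) -(local_gauss_map pp).
have -> : lap (img p) (xl p) (gauss_map (img p) (xl p) co) (phi p p)
  = loc p (laplace X Y) (phi p p).
  rewrite (local_laplace_row gauss_map_surface_C pp).
  apply: (lap_ext _ pp) => y py; symmetry; exact: local_gauss_map py.
have -> : norm2 (img p) (xl p) (gauss_map (img p) (xl p) co) (phi p p)
  = loc p (dnorm2 X Y) (phi p p).
  rewrite (local_dnorm2 _ pp); last by move=> q; exact: class_C_pred (gauss_map_surface_C q).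
  apply: (norm2_ext _ pp) => y py; symmetry; exact: local_gauss_map py.
by rewrite !local_center.
Qed.

(** The equation is known at interior points; it extends to a boundary point
    by continuity, moving up into the half-plane. *)
Lemma helfrich_el_vanishes : helfrich_critical co X -> forall p, helfrich_el p = 0.
Proof.
move=> crit p; have pp := phi_img (chart_at_dom p).
have := class_euler_lagrange (rI p) (xl_class p) (@metric_det_gt0 p) co.
move=> /class_C_continuous cE.
have {}cE : {within img p, continuous (loc p helfrich_el)}.
  by apply: continuous_within_ext cE => y py; rewrite (local_helfrich_el py).
have [d d0 dI] := relopen_box (rI p) pp.
have z0 := relopen_half (rI p) pp.
rewrite -(local_center helfrich_el p); apply/eqP; rewrite -normr_le0.
apply/ler_addgt0Pr => eps e0; rewrite add0r.
move/subspace_continuousP: cE => /(_ _ pp) /cvgrPdist_lt/(_ _ e0).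
rewrite near_withinE => /box_near[d' d'0 dE].
pose m := Num.min d d' / 2.
have m0 : 0 < m by rewrite divr_gt0// lt_min d0.
have md : m < d /\ m < d'.
  have : Num.min d d' <= d by rewrite ge_min lexx.
  have : Num.min d d' <= d' by rewrite ge_min lexx orbT.
  rewrite /m in m0 *; lra.
pose z : R * R := ((phi p p).1, (phi p p).2 + m).
have iz : img p z.
  apply: dI; rewrite /z /= ?subrr ?normr0//; last by lra.
  by rewrite addrAC subrr add0r gtr0_norm//; lra.
have Ez : loc p helfrich_el z = 0.
  by apply: (crit (psi p z)); apply: surface_interior_psi => //; rewrite /z /=; lra.
have : `|z.1 - (phi p p).1| < d' -> `|z.2 - (phi p p).2| < d' -> img p z ->
  `|loc p helfrich_el (phi p p) - loc p helfrich_el z| < eps := dE z.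
rewrite Ez subr0 => H; apply: ltW; apply: H => //.
  by rewrite subrr normr0.
by rewrite addrAC subrr add0r gtr0_norm//; lra.
Qed.

(** The null vector field in the tension identity vanishes nowhere. *)
Theorem helfrich_critical_iff_tension :
  helfrich_critical co X <->
  forall p, laplace X Y p + dnorm2 X Y p *: Y p
    = (2%:R * co) *: deSitter_proj (Y p) lvec.
Proof.
split=> [crit p|eqn p _].
  apply/eqP; rewrite -subr_eq0 tension_identity helfrich_el_vanishes//.
  by rewrite scale0r.
have := tension_identity p; rewrite eqn subrr => /esym/eqP.
by rewrite scaler_eq0 (negbTE (cone_neq0 _)) orbF => /eqP.
Qed.

End GaussMap.
End SurfaceGeometry.

(** * Integration in charts *)

Section PlaneMeasure.
Context {R : realType}.

Lemma open_measurable_plane (G : set (R * R)) : open G -> measurable G.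
Proof.
move=> oG.
pose box (i : (rat * rat) * (rat * rat)) : set (R * R) :=
  `]ratr i.1.1, ratr i.1.2[%classic `*` `]ratr i.2.1, ratr i.2.2[%classic.
have -> : G = \bigcup_(i in [set i | box i `<=` G]) box i.
  apply/seteqP; split=> [z Gz|z [i /= + iz]]; last exact.
  have [e e0 eG] := box_near (open_nbhs_nbhs (conj oG Gz)).
  have near_rat (x y : R) : x < y -> exists q : rat, x < ratr q < y.
    by move=> xy; have [q] := rat_in_itvoo xy; rewrite in_itv /=; exists q.
  have [a /andP[a1 a2]] := near_rat (z.1 - e) z.1 (ltac:(lra)).
  have [b /andP[b1 b2]] := near_rat z.1 (z.1 + e) (ltac:(lra)).
  have [c /andP[c1 c2]] := near_rat (z.2 - e) z.2 (ltac:(lra)).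
  have [d /andP[d1 d2]] := near_rat z.2 (z.2 + e) (ltac:(lra)).
  exists ((a, b), (c, d)).
    move=> y [] /=; rewrite !in_itv /= => /andP[y1 y2] /andP[y3 y4].
    by apply: eG; rewrite ltr_norml; lra.
  by split; rewrite /= in_itv /=; apply/andP.
rewrite bigcup_mkcond; apply: countable_bigcupT_measurable => // i.
by case: ifPn => // _; apply: measurableX; exact: measurable_itv.
Qed.

Lemma relopen_measurable (Q : set (R * R)) : relopen Q -> measurable Q.
Proof.
move=> [G oG ->]; apply: measurableI; first exact: open_measurable_plane.
rewrite (_ : half_plane = setT `*` `[0, +oo[%classic).
  by apply: measurableX => //; exact: measurable_itv.
by apply/seteqP; split=> [z /= z0|z [_] /=]; rewrite in_itv /= andbT.
Qed.

Lemma continuous_relopen_measurable (Q : set (R * R)) (f : R * R -> R) :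
  relopen Q -> {within Q, continuous f} -> measurable_fun Q f.
Proof.
move=> rQ /continuousP cf; have mQ := relopen_measurable rQ.
apply: (measurability _ (RGenOpens.measurableE R)).
move=> _ [_ [a [b ->] <-]].
have /open_subspaceP[V oV VE] := cf _ (@interval_open _ (BRight a) (BLeft b) isT isT).
rewrite setIC -VE; apply: measurableI => //; exact: open_measurable_plane.
Qed.

End PlaneMeasure.

Section Density.
Import HBNNSimple.
Local Open Scope ereal_scope.
Context {R : realType} d1 d2 (T1 : measurableType d1) (T2 : measurableType d2).
Variables (m1 : {measure set T1 -> \bar R}) (m2 : {measure set T2 -> \bar R}).
Variables (A : set T1) (Q : set T2) (g : T2 -> T1) (w : T2 -> R).
Hypotheses (mA : measurable A) (mQ : measurable Q) (mg : measurable_fun Q g)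
  (gA : forall z, Q z -> A (g z)) (mw : measurable_fun Q w)
  (w0 : forall z, Q z -> (0 <= w z)%R)
  (m1E : forall B, measurable B -> B `<=` A ->
     m1 B = \int[m2]_(z in Q `&` g @^-1` B) (w z)%:E).

(** True for indicator functions by the formula on sets, hence for simple
    functions, hence for their monotone limits. *)
Lemma ge0_integral_density (f : T1 -> \bar R) :
  measurable_fun A f -> (forall x, A x -> 0 <= f x) ->
  \int[m1]_(x in A) f x = \int[m2]_(z in Q) (f (g z) * (w z)%:E).
Proof.
move=> mf f0; pose h := nnsfun_approx mA mf.
have mew : measurable_fun Q (EFin \o w) by exact/measurable_EFinP.
have mhg n : measurable_fun Q (fun z => (h n (g z))%:E).
  by apply/measurable_EFinP; apply: (measurableT_comp (f := h n)).
have -> : \int[m1]_(x in A) f x =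
    lim (\int[m1]_(x in A) (EFin \o h n) x @[n --> \oo]).
  have fE x : A x -> f x = lim ((EFin \o h n) x @[n --> \oo]).
    by move=> Ax; apply/esym/cvg_lim => //; exact: cvg_nnsfun_approx.
  under eq_integral => x /[!inE] /fE -> //.
  apply: monotone_convergence => //.
  - move=> n; apply/measurable_EFinP.
    by apply: (measurable_funS measurableT) => //; exact/measurable_funP.
  - by move=> n x Ex //=; rewrite lee_fin.
  - by move=> x Ex a b ab; rewrite lee_fin; exact/lefP/nd_nnsfun_approx.
have -> : \int[m2]_(z in Q) (f (g z) * (w z)%:E) =
    lim (\int[m2]_(z in Q) ((h n (g z))%:E * (w z)%:E) @[n --> \oo]).
  have fg z : Q z -> f (g z) * (w z)%:E
      = lim ((h n (g z))%:E * (w z)%:E @[n --> \oo]).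
    move=> Qz; apply/esym/cvg_lim => //; apply: cvgeZr => //.
    by apply: cvg_nnsfun_approx => //; exact: gA.
  under eq_integral => x /[!inE] /fg -> //.
  apply: monotone_convergence => [//| | |].
  - by move=> n; exact: emeasurable_funM.
  - by move=> n x Ex /=; rewrite mule_ge0 ?lee_fin ?w0.
  - move=> x Ex a b ab/=; rewrite lee_wpmul2r ?lee_fin ?w0//.
    exact/lefP/nd_nnsfun_approx.
suff suf n : \int[m2]_(z in Q) ((h n (g z))%:E * (w z)%:E) =
    \int[m1]_(x in A) (EFin \o h n) x.
  by under [in RHS]eq_fun do rewrite suf.
transitivity (\int[m1]_(x in A)
   (\sum_(y \in range (h n)) (y * \1_(h n @^-1` [set y]) x)%:E)); last first.
  by apply: eq_integral => t tE; rewrite /= fimfunE -fsumEFin.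
have indich m r : measurable_fun A (fun x => (r * \1_(h m @^-1` [set r]) x)%:E).
  by apply: (measurable_comp measurableT) => //; exact: measurable_funM.
have mind m r : measurable_fun setT (\1_(h m @^-1` [set r]) : T1 -> R).
  exact: measurable_indic.
have indichg m r : measurable_fun Q
    (fun z => (r * \1_(h m @^-1` [set r]) (g z))%:E).
  apply/measurable_EFinP; apply: measurable_funM => //.
  exact: (measurableT_comp (mind m r) mg).
rewrite ge0_integral_fsum//; last by move=> m y Ey; exact: nnfun_muleindic_ge0.
transitivity (\int[m2]_(z in Q) (\sum_(y \in range (h n))
    (y * \1_(h n @^-1` [set y]) (g z))%:E * (w z)%:E)).
  under [RHS]eq_integral => x xE.
    rewrite -ge0_mule_fsuml => [|y]; last exact: nnfun_muleindic_ge0.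
    rewrite fsumEFin // -(fimfunE _ (g x)); over.
  by [].
rewrite ge0_integral_fsum//; last 2 first.
  - by move=> y; apply: emeasurable_funM.
  - move=> m y Ey; apply: mule_ge0; last by rewrite lee_fin w0.
    exact: nnfun_muleindic_ge0.
apply: eq_fsbigr => r rhn.
under [RHS]eq_integral do rewrite EFinM.
rewrite integralZl_indic_nnsfun => //.
under eq_integral do rewrite EFinM -muleA.
have mhr : measurable (h n @^-1` [set r]) by [].
rewrite ge0_integralZl//.
- rewrite integral_indic// m1E; last by move=> ? [].
    congr (_ * _); rewrite (_ : Q `&` _ = Q `&` (g @^-1` (h n @^-1` [set r]))); last first.
      by apply/seteqP; split=> z [] // Qz; [case|move=> hz; split=> //; split=> //; exact: gA].
    by rewrite integral_mkcondr epatch_indic; apply: eq_integral => z _; rewrite muleC.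
  exact: measurableI.
- apply: emeasurable_funM => //; apply/measurable_EFinP.
  exact: (measurableT_comp (mind n r) mg).
- by move=> t Et; rewrite mule_ge0 ?lee_fin ?w0.
- by move: rhn; rewrite inE => -[t _ <-]; rewrite lee_fin.
Qed.

Lemma integral_density (f : T1 -> R) : measurable_fun A f ->
  \int[m1]_(x in A) (f x)%:E = \int[m2]_(z in Q) (f (g z) * w z)%:E.
Proof.
move=> mf; have mef : measurable_fun A (EFin \o f) by exact/measurable_EFinP.
rewrite [LHS]integralE [RHS]integralE; congr (_ - _).
  rewrite ge0_integral_density//; last exact: measurable_funepos.
  apply: eq_integral => z; rewrite inE => Qz.
  by rewrite !funeposE /= -!EFin_max -EFinM maxr_pMl ?w0// mul0r.
rewrite ge0_integral_density//; last exact: measurable_funeneg.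
apply: eq_integral => z; rewrite inE => Qz.
by rewrite !funenegE /= -!EFin_max -EFinM maxr_pMl ?w0// mul0r mulNr.
Qed.

End Density.

(** * The area measure *)

Section AreaMeasure.
Context {R : realType} (S : surface R) (X : S -> 'rV[R]_3).
Hypothesis immX : immersion 4 X.
Implicit Types (p q : S) (z : R * R).

Local Notation dom p := (cdom (chart_at p)).
Local Notation img p := (cimg (chart_at p)).
Local Notation phi p := (cmap (chart_at p)).
Local Notation psi p := (cinv (chart_at p)).
Local Notation loc p f := (local (chart_at p) f).
Local Notation xl p := (local (chart_at p) X).
Local Notation borel := (g_sigma_algebraType (@open S)).
Local Notation leb2 := (@lebesgue_measure R \x @lebesgue_measure R)%E.

Lemma open_borel (A : set S) : open A -> measurable (A : set borel).
Proof. exact: sub_sigma_algebra. Qed.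

Lemma continuous_borel (f : S -> R) : continuous f ->
  measurable_fun (setT : set borel) (f : borel -> R).
Proof.
move=> /continuousP cf; apply: (measurability _ (RGenOpens.measurableE R)).
move=> _ [_ [a [b ->] <-]]; rewrite setTI; apply: open_borel; apply: cf.
exact: interval_open.
Qed.

Lemma psi_measurable p (Q : set (R * R)) : relopen Q -> Q `<=` img p ->
  measurable_fun Q (psi p : R * R -> borel).
Proof.
move=> rQ Qp; have mQ := relopen_measurable rQ.
apply: (@measurability _ _ _ borel Q (psi p) (@open S) erefl) => _ [U oU <-].
have [_ _ _ cpsi _] := chart_at_chart p.
have /continuousP/(_ _ oU)/open_subspaceP[V oV VE] := continuous_subspaceW Qp cpsi.
by rewrite setIC -VE; apply: measurableI => //; exact: open_measurable_plane.
Qed.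

Lemma chart_image_open p (Q : set (R * R)) : relopen Q -> Q `<=` img p ->
  open (psi p @` Q).
Proof.
move=> [G oG QE] Qp; have [odom [G' oG' IE] cphi _ _] := chart_at_chart p.
have -> : psi p @` Q = dom p `&` phi p @^-1` G.
  apply/seteqP; split=> [_ [z Qz <-]|q [pq Gq]].
    have pz := Qp _ Qz; split; first exact: psi_dom.
    by rewrite /= psiK//; move: Qz; rewrite QE => -[].
  exists (phi p q); last exact: phiK.
  rewrite QE; split=> //; have := phi_img pq; rewrite IE => -[] //.
have /continuousP/(_ _ oG)/open_subspaceP[V oV VE] := cphi.
by rewrite setIC -VE; exact: openI.
Qed.

Variable mu : {measure set borel -> \bar R}.
Hypothesis amu : area_measure X mu.

Lemma chart_integral p (Q : set (R * R)) (f : S -> R) :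
  relopen Q -> Q `<=` img p -> measurable_fun (psi p @` Q : set borel) (f : borel -> R) ->
  (\int[mu]_(q in psi p @` Q) (f q)%:E
   = \int[leb2]_(z in Q) (loc p f z * density (img p) (xl p) z)%:E)%E.
Proof.
move=> rQ Qp mf; have mQ := relopen_measurable rQ.
have mA := open_borel (chart_image_open rQ Qp).
have Cd := class_density (img_relopen p) (xl_class immX p) (metric_det_gt0 immX (p := p)).
apply: (@integral_density _ _ _ borel _ mu leb2 _ Q (psi p)
  (density (img p) (xl p)) mA mQ (psi_measurable rQ Qp)) => //.
- apply: continuous_relopen_measurable => //.
  exact: continuous_subspaceW Qp (class_C_continuous Cd).
- by move=> z Qz; exact: sqrtr_ge0.
- move=> B mB BA; rewrite (@amu p B mB); last first.
    by move=> _ /BA [z Qz <-]; apply: psi_dom; exact: Qp.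
  have -> : phi p @` B = Q `&` psi p @^-1` B.
    apply/seteqP; split=> [_ [q Bq <-]|z [Qz Bz]].
      have [z Qz zq] := BA _ Bq; have pz := Qp _ Qz.
      by rewrite -zq psiK//; split=> //; rewrite /= zq.
    by exists (psi p z) => //; exact: psiK (Qp _ Qz).
  apply: eq_integral => z _; rewrite /area_density /g11 /g12 /g22.
  by rewrite partial1E partial2E.
Qed.

(** The neighbourhood is the image of a half-box on which the area density is
    bounded. *)
Lemma locally_finite p : exists A : set S,
  [/\ open A, A p & (mu A < +oo)%E].
Proof.
have pp := phi_img (chart_at_dom p).
have Cd := class_density (img_relopen p) (xl_class immX p) (metric_det_gt0 immX (p := p)).
have /subspace_continuousP/(_ _ pp) := class_C_continuous Cd.
move=> /cvgrPdist_lt/(_ _ ltr01); rewrite near_withinE => /box_near[d d0 dD].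
have [d' d'0 dI] := relopen_box (img_relopen p) pp.
pose m := Num.min d d'; have m0 : 0 < m by rewrite lt_min d0.
pose a := (phi p p).1; pose b := (phi p p).2.
pose B1 : set R := `]a - m, a + m[%classic.
pose B2 : set R := `]b - m, b + m[%classic.
have oB : open (B1 `*` B2).
  apply: openI; apply: open_comp; try exact: interval_open.
    by move=> z _; exact: (@cvg_fst _ _ (nbhs z.1) (nbhs z.2) _).
  by move=> z _; exact: (@cvg_snd _ _ (nbhs z.1) (nbhs z.2) _).
pose Q := (B1 `*` B2) `&` half_plane.
have rQ : relopen Q by exists (B1 `*` B2).
have inB z : (B1 `*` B2) z -> `|z.1 - a| < m /\ `|z.2 - b| < m.
  move=> [] /=; rewrite /B1 /B2 /= !in_itv /= => /andP[? ?] /andP[? ?].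
  by split; rewrite ltr_norml; lra.
have Qp : Q `<=` img p.
  move=> z [/inB[]]; rewrite !lt_min => /andP[_ z1] /andP[_ z2] z0.
  exact: dI.
have Qpp : Q (phi p p).
  split; last exact: relopen_half (img_relopen p) pp.
  by split; rewrite /B1 /B2 /= in_itv /=; apply/andP; split; rewrite /a /b; lra.
exists (psi p @` Q); split; first exact: chart_image_open.
  by exists (phi p p) => //; exact: phiK (chart_at_dom p).
have mA := open_borel (chart_image_open rQ Qp).
have mQ := relopen_measurable rQ.
have cQ := continuous_subspaceW Qp (class_C_continuous Cd).
have mdQ : measurable_fun Q (density (img p) (xl p)).
  exact: continuous_relopen_measurable cQ.
pose M := density (img p) (xl p) (phi p p) + 1.
have dM z : Q z -> `|density (img p) (xl p) z| <= M.
  move=> Qz; have [Bz _] := Qz; have [] := inB _ Bz.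
  rewrite !lt_min => /andP[z1 _] /andP[z2 _].
  have : `|density (img p) (xl p) (phi p p) - density (img p) (xl p) z| < 1.
    exact: dD z z1 z2 (Qp _ Qz).
  rewrite [`|density _ _ z|]ger0_norm ?sqrtr_ge0// ltr_norml => /andP[h _].
  by rewrite /M; lra.
have -> : mu (psi p @` Q)
    = (\int[leb2]_(z in Q) (1 * density (img p) (xl p) z)%:E)%E.
  rewrite -(chart_integral (f := cst 1) rQ Qp (@measurable_cst _ _ borel _ _ _)).
  by rewrite -[LHS]mul1e -integral_cst.
apply: le_lt_trans (_ : (M%:E * leb2 Q < +oo)%E); last first.
  have lQ : (leb2 Q < +oo)%E.
    apply: le_lt_trans (_ : (leb2 (B1 `*` B2) < +oo)%E).
      apply: le_measure; rewrite ?inE//; last exact: subIsetl.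
      exact: open_measurable_plane.
    have mB1 : measurable B1 by exact: measurable_itv.
    have mB2 : measurable B2 by exact: measurable_itv.
    have l (c : R) : lebesgue_measure `]c - m, c + m[%classic = (m + m)%:E.
      rewrite lebesgue_measure_itv /= lte_fin ifT; last by lra.
      by rewrite -EFinD; congr EFin; ring.
    have -> : leb2 (B1 `*` B2) = ((m + m)%:E * (m + m)%:E)%E.
      by rewrite -{1}(l a) -(l b); exact: product_measure1E.
    by rewrite -EFinM ltry.
  by apply: lte_mul_pinfty => //; rewrite lee_fin addr_ge0// sqrtr_ge0.
apply: le_trans (_ : (\int[leb2]_(z in Q) `|(density (img p) (xl p) z)%:E| <= _)%E).
  apply: ge0_le_integral => //.
  - by move=> z _; rewrite lee_fin mul1r sqrtr_ge0.
  - by apply/measurable_EFinP; under eq_fun do rewrite mul1r.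
  - by apply: measurableT_comp => //; exact/measurable_EFinP.
  - by move=> z _; rewrite lee_fin mul1r ler_norm.
apply: integral_le_bound => //.
- exact/measurable_EFinP.
- by rewrite lee_fin addr_ge0// sqrtr_ge0.
- by apply: aeW => z Qz; rewrite lee_fin; exact: dM.
Qed.

(** Compactness and local finiteness. *)
Lemma area_finite : (mu setT < +oo)%E.
Proof.
have [A HA] := choice locally_finite.
have : compact [set: S] by exact: surface_compact.
rewrite compact_cover => /(_ S setT A).
case=> [p _|p _|D' _ cov]; first by have [] := HA p.
  by exists p => //; have [] := HA p.
have mAi i : measurable (A i : set borel) by have [oA _ _] := HA i; exact: open_borel.
have fD := finite_fset D'.
apply: le_lt_trans (content_sub_fsum mu fD (fun i _ => mAi i) measurableT cov) _.
rewrite fsbig_finite//=; apply: lte_sum_pinfty => i _.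
by have [] := HA i.
Qed.

Lemma continuous_bounded (f : S -> R) : continuous f ->
  exists2 M : R, 0 <= M & forall p, `|f p| <= M.
Proof.
move=> cf; have cS : compact (f @` setT).
  apply: continuous_compact; last exact: surface_compact.
  exact: continuous_subspaceT.
have [M [Mr HM]] := compact_bounded cS.
exists (`|M| + 1); first by rewrite addr_ge0.
move=> p; apply: (HM (`|M| + 1)); last by exists p.
by rewrite (le_lt_trans (ler_norm M))// ltrDl.
Qed.

Lemma continuous_integrable (f : S -> R) : continuous f ->
  mu.-integrable (setT : set borel) (EFin \o f).
Proof.
move=> cf; have [M M0 fM] := continuous_bounded cf.
have mf := continuous_borel cf.
have mef : measurable_fun (setT : set borel) (EFin \o (f : borel -> R)).
  exact/measurable_EFinP.
apply/integrableP; split=> //.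
apply: le_lt_trans (_ : (M%:E * mu setT < +oo)%E); last first.
  by apply: lte_mul_pinfty => //; exact: area_finite.
apply: integral_le_bound => //.
by apply: aeW => p _; rewrite lee_fin; exact: fM.
Qed.

End AreaMeasure.

(** * The divergence theorem in a box *)

Section BoxDivergence.
Context {R : realType}.
Local Notation leb := (@lebesgue_measure R).
Local Notation leb2 := (@lebesgue_measure R \x @lebesgue_measure R)%E.

Lemma ftc_along {V : normedModType R} (D : set V) (f : V -> R) (e x : V) (a b : R) :
  a < b -> {within D, continuous f} -> {within D, continuous (deriv_along D f e)} ->
  (forall s, a <= s <= b -> D (s *: e + x)) ->
  (forall s, a <= s <= b -> derivable_along D f e (s *: e + x)) ->
  (\int[leb]_(s in `[a, b]) (deriv_along D f e (s *: e + x))%:E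
   = (f (b *: e + x))%:E - (f (a *: e + x))%:E)%E.
Proof.
move=> ab cf cdf sD df.
have dI s (sI : s \in `]a, b[) := segment_is_derive sD df sI.
apply: (@continuous_FTC2 _ _ (fun s => f (s *: e + x))) => //.
- exact: (@segment_continuous _ _ D (deriv_along D f e)).
- have /(continuous_within_itvP _ ab)[_ ca cb] := segment_continuous cf sD.
  by split=> // s sI; have [] := dI s sI.
- by move=> s sI; rewrite derive1E; have [_ ->] := dI s sI.
Qed.

Lemma ftc_open_along {V : normedModType R} (D : set V) (f : V -> R) (e x : V) (a b : R) :
  a < b -> {within D, continuous f} -> {within D, continuous (deriv_along D f e)} ->
  (forall s, a <= s <= b -> D (s *: e + x)) ->
  (forall s, a <= s <= b -> derivable_along D f e (s *: e + x)) ->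
  f (a *: e + x) = 0 -> f (b *: e + x) = 0 ->
  (\int[leb]_(s in `]a, b[) (deriv_along D f e (s *: e + x))%:E = 0)%E.
Proof.
move=> ab cf cdf sD df fa fb.
rewrite -(@integral_itv_bndoo _ _ _ _ true false).
  by rewrite ftc_along// fa fb subee.
apply/measurable_EFinP.
apply: (@measurable_funS _ _ _ _ `[a, b]%classic) => //.
  by apply: subset_itvW => //; rewrite ltW.
apply: subspace_continuous_measurable_fun => //.
exact: (@segment_continuous _ _ D (deriv_along D f e)).
Qed.

Variables (D : set (R * R)) (a b c d : R).
Hypotheses (rD : relopen D) (ab : a < b) (cd : c < d)
  (boxD : forall z : R * R, a <= z.1 <= b -> c <= z.2 <= d -> D z).

Definition open_box : set (R * R) := `]a, b[%classic `*` `]c, d[%classic.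

Lemma open_box_sub : open_box `<=` D.
Proof.
move=> z [] /=; rewrite !in_itv /= => /andP[? ?] /andP[? ?].
by apply: boxD; rewrite !ltW.
Qed.

Lemma open_box_measurable : measurable open_box.
Proof. by apply: measurableX; exact: measurable_itv. Qed.

Lemma open_box_open : open open_box.
Proof.
apply: openI; apply: open_comp; try exact: interval_open.
  by move=> z _; exact: (@cvg_fst _ _ (nbhs z.1) (nbhs z.2) _).
by move=> z _; exact: (@cvg_snd _ _ (nbhs z.1) (nbhs z.2) _).
Qed.

Lemma open_box_measure : leb2 open_box = ((b - a) * (d - c))%:E.
Proof.
have l (u v : R) : u < v -> leb `]u, v[%classic = (v - u)%:E.
  by move=> uv; rewrite lebesgue_measure_itv /= lte_fin uv -EFinD.
rewrite EFinM -(l _ _ ab) -(l _ _ cd); apply: product_measure1E;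
  exact: measurable_itv.
Qed.

Lemma box_bounded (f : R * R -> R) : {within D, continuous f} ->
  exists2 M : R, 0 <= M & forall z, open_box z -> `|f z| <= M.
Proof.
move=> cf; pose K : set (R * R) := `[a, b]%classic `*` `[c, d]%classic.
have cK : compact K by apply: compact_setX; exact: segment_compact.
have KD : K `<=` D by move=> z [] /=; rewrite !in_itv /=; exact: boxD.
have cfK : compact (f @` K).
  by apply: continuous_compact => //; exact: continuous_subspaceW KD cf.
have [M [Mr HM]] := compact_bounded cfK.
exists (`|M| + 1); first by rewrite addr_ge0.
move=> z [] /=; rewrite !in_itv /= => /andP[? ?] /andP[? ?].
apply: (HM (`|M| + 1)); first by rewrite (le_lt_trans (ler_norm M))// ltrDl.
by exists z => //; split; rewrite /= in_itv /= !ltW.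
Qed.

Lemma box_integrable (f : R * R -> R) : {within D, continuous f} ->
  leb2.-integrable open_box (EFin \o f).
Proof.
move=> cf; have [M M0 fM] := box_bounded cf.
have mf : measurable_fun open_box (EFin \o f).
  apply/measurable_EFinP; apply: measurable_funS (relopen_measurable rD) _ _.
    exact: open_box_sub.
  exact: continuous_relopen_measurable.
apply/integrableP; split=> //.
apply: le_lt_trans (_ : (M%:E * leb2 open_box < +oo)%E); last first.
  by rewrite open_box_measure -EFinM ltry.
apply: integral_le_bound => //; first exact: open_box_measurable.
by apply: aeW => z Qz; rewrite lee_fin; exact: fM.
Qed.

(** Fubini and the fundamental theorem of calculus on each line. *)
Lemma integral_pd1 (f : R * R -> R) : class_C dirs2 1 D f ->
  (forall y, c < y < d -> f (a, y) = 0 /\ f (b, y) = 0) ->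
  (\int[leb2]_(z in open_box) (pd D false f z)%:E = 0)%E.
Proof.
move=> Cf f0; have Cdf := class_C_continuous (class_pd false Cf).
have If := box_integrable Cdf.
rewrite integral_mkcond.
have Ih : leb2.-integrable setT ((fun z => (pd D false f z)%:E) \_ open_box).
  have HH := @integrable_mkcond _ _ R leb2 open_box (fun z => (pd D false f z)%:E) open_box_measurable.
  exact: (HH.1 If).
rewrite -(integral21_prod_meas1 Ih) /fubini_G integral0_eq// => y _.
have [yI|yN] := boolP (y \in `]c, d[%classic); last first.
  rewrite integral0_eq// => s _; rewrite patchE ifF//.
  by apply/negbTE; apply: contra yN; rewrite !inE => -[].
have yI' : c < y < d by move: yI; rewrite inE /= in_itv.
transitivity (\int[leb]_(s in `]a, b[) (deriv_along D f dir1 (s *: dir1 + (0, y)))%:E)%E.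
  rewrite [RHS]integral_mkcond; apply: eq_integral => s _.
  rewrite !patchE dir1_line /= addr0.
  have -> : ((s, y) \in open_box) = (s \in `]a, b[%classic).
    apply/idP/idP; rewrite !inE; first by case.
    by move=> sI; split=> //; move: yI; rewrite inE.
  by case: ifP => // _; rewrite /= pdE.
have [fa fb] := f0 y yI'.
have lineD s : a <= s <= b -> D (s *: dir1 + (0, y)).
  by move=> sI; rewrite dir1_line; apply: boxD => /=; rewrite ?addr0//; lra.
apply: ftc_open_along => //.
- exact: class_C_continuous Cf.
- by move: Cdf; rewrite pdE.
- move=> s sI; apply: has_deriv_derivable.
  by apply: class_C_has_deriv Cf dir1_in _; exact: lineD.
- by rewrite dir1_line /= addr0.
- by rewrite dir1_line /= addr0.
Qed.

Lemma integral_pd2 (f : R * R -> R) : class_C dirs2 1 D f ->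
  (forall x, a < x < b -> f (x, c) = 0 /\ f (x, d) = 0) ->
  (\int[leb2]_(z in open_box) (pd D true f z)%:E = 0)%E.
Proof.
move=> Cf f0; have Cdf := class_C_continuous (class_pd true Cf).
have If := box_integrable Cdf.
rewrite integral_mkcond.
have Ih : leb2.-integrable setT ((fun z => (pd D true f z)%:E) \_ open_box).
  have HH := @integrable_mkcond _ _ R leb2 open_box (fun z => (pd D true f z)%:E) open_box_measurable.
  exact: (HH.1 If).
rewrite -(integral12_prod_meas1 Ih) /fubini_F integral0_eq// => x _.
have [xI|xN] := boolP (x \in `]a, b[%classic); last first.
  rewrite integral0_eq// => s _; rewrite patchE ifF//.
  by apply/negbTE; apply: contra xN; rewrite !inE => -[].
have xI' : a < x < b by move: xI; rewrite inE /= in_itv.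
transitivity (\int[leb]_(s in `]c, d[) (deriv_along D f dir2 (s *: dir2 + (x, 0)))%:E)%E.
  rewrite [RHS]integral_mkcond; apply: eq_integral => s _.
  rewrite !patchE dir2_line /= addr0.
  have -> : ((x, s) \in open_box) = (s \in `]c, d[%classic).
    apply/idP/idP; rewrite !inE; first by case.
    by move=> sI; split=> //; move: xI; rewrite inE.
  by case: ifP => // _; rewrite /= pdE.
have [fc fd] := f0 x xI'.
have lineD s : c <= s <= d -> D (s *: dir2 + (x, 0)).
  by move=> sI; rewrite dir2_line; apply: boxD => /=; rewrite ?addr0//; lra.
apply: ftc_open_along => //.
- exact: class_C_continuous Cf.
- by move: Cdf; rewrite pdE.
- move=> s sI; apply: has_deriv_derivable.
  by apply: class_C_has_deriv Cf dir2_in _; exact: lineD.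
- by rewrite dir2_line /= addr0.
- by rewrite dir2_line /= addr0.
Qed.

Lemma box_divergence (f g : R * R -> R) : class_C dirs2 1 D f -> class_C dirs2 1 D g ->
  (forall y, c < y < d -> f (a, y) = 0 /\ f (b, y) = 0) ->
  (forall x, a < x < b -> g (x, c) = 0 /\ g (x, d) = 0) ->
  (\int[leb2]_(z in open_box) (pd D false f z + pd D true g z)%:E = 0)%E.
Proof.
move=> Cf Cg f0 g0.
have If := box_integrable (class_C_continuous (class_pd false Cf)).
have Ig := box_integrable (class_C_continuous (class_pd true Cg)).
have HH := @integralD _ _ R leb2 open_box open_box_measurable _ _ If Ig.
under eq_integral do rewrite EFinD.
apply: etrans HH _; rewrite -[RHS](adde0 0%E); congr (_ + _)%E.
  exact: integral_pd1.
exact: integral_pd2.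
Qed.

End BoxDivergence.

(** * Green's formula for maps into Minkowski space *)

Section Dirichlet.
Context {R : realType}.
Variables (D : set (R * R)) (x : R * R -> 'rV[R]_3).
Hypotheses (rD : relopen D) (Cx : class_C dirs2 4 D x)
  (det_gt0 : forall z, D z -> 0 < met11 D x z * met22 D x z - met12 D x z ^+ 2).

Let aD := relopen_accessible rD.

Definition dirichlet (f g : R * R -> 'rV[R]_5) z : R :=
  trace_at D x z
    (mink (pd D false f z) (pd D false g z)) (mink (pd D false f z) (pd D true g z))
    (mink (pd D true f z) (pd D false g z)) (mink (pd D true f z) (pd D true g z)).

Lemma norm2_polarization (f g : R * R -> 'rV[R]_5) z : D z ->
  class_C dirs2 1 D f -> class_C dirs2 1 D g ->
  norm2 D x (fun y => f y + g y) z
  = norm2 D x f z + 2 * dirichlet f g z + norm2 D x g z.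
Proof.
move=> Dz Cf Cg; rewrite /norm2.
have E b : pd D b (fun y => f y + g y) z = pd D b f z + pd D b g z.
  apply: (pd_eq rD Dz); exact: has_derivD (pd_has_deriv b Cf Dz) (pd_has_deriv b Cg Dz).
rewrite !E /dirichlet /trace_at /metric_trace !minklin.
by rewrite !(minkC (pd D _ g z) (pd D _ f z)) (minkC (pd D true f z) (pd D false f z)); ring.
Qed.

Lemma class_dirichlet (f g : R * R -> 'rV[R]_5) :
  class_C dirs2 1 D f -> class_C dirs2 1 D g -> class_C dirs2 0 D (dirichlet f g).
Proof.
move=> Cf Cg; apply: (class_trace rD Cx det_gt0 (leq0n 3));
  by apply: (class_C_mink aD); exact: class_pd.
Qed.

Let flux_algebra (e f g w a1 a2 b1 b2 l11 l21 : R) : 0 < w ->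
  l11 = g / w * a1 - f / w * b1 -> l21 = e / w * b2 - f / w * a2 ->
  w * metric_trace e f g w a1 a2 b1 b2 = l11 + l21.
Proof.
move=> w0 -> ->; rewrite /metric_trace; field; exact: lt0r_neq0.
Qed.

(** Leibniz rule: the flux of f contracted with the derivatives of g is the
    pairing times the density, and the divergence of the flux is the Laplacian
    times the density. *)
Lemma dirichlet_divergence (f g : R * R -> 'rV[R]_5) z : D z ->
  class_C dirs2 2 D f -> class_C dirs2 1 D g ->
  pd D false (fun y => mink (flux1 D x f y) (g y)) z
  + pd D true (fun y => mink (flux2 D x f y) (g y)) z
  = (dirichlet f g z + mink (lap D x f z) (g z)) * density D x z.
Proof.
move=> Dz Cf Cg; have w0 := density_gt0 det_gt0 Dz.
have dg b := pd_has_deriv b Cg Dz.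
have d1 := pd_has_deriv false (class_flux1 rD Cx det_gt0 (isT : (1 <= 3)%N) Cf) Dz.
have d2 := pd_has_deriv true (class_flux2 rD Cx det_gt0 (isT : (1 <= 3)%N) Cf) Dz.
rewrite (pd_eq rD Dz (has_deriv_mink d1 (dg false))).
rewrite (pd_eq rD Dz (has_deriv_mink d2 (dg true))).
have L : mink (lap D x f z) (g z) * density D x z
    = mink (pd D false (flux1 D x f) z) (g z) + mink (pd D true (flux2 D x f) z) (g z).
  by rewrite /lap minkZl minkDl mulrC mulrA mulfV ?mul1r// lt0r_neq0.
have E : density D x z * dirichlet f g z
    = mink (flux1 D x f z) (pd D false g z) + mink (flux2 D x f z) (pd D true g z).
  by apply: (flux_algebra w0); rewrite /flux1 /flux2 !minklin.
by rewrite [RHS]mulrDl (mulrC (dirichlet _ _ _)) E L; ring.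
Qed.

End Dirichlet.

Section Green.
Context {R : realType} (S : surface R) (X : S -> 'rV[R]_3).
Hypothesis immX : immersion 4 X.
Implicit Types (p q : S) (z : R * R).

Local Notation dom p := (cdom (chart_at p)).
Local Notation img p := (cimg (chart_at p)).
Local Notation phi p := (cmap (chart_at p)).
Local Notation psi p := (cinv (chart_at p)).
Local Notation loc p f := (local (chart_at p) f).
Local Notation xl p := (local (chart_at p) X).
Local Notation borel := (g_sigma_algebraType (@open S)).

Let rI p : relopen (img p) := img_relopen p.

Lemma chart_continuous (f : S -> R) :
  (forall p, {within img p, continuous (loc p f)}) -> continuous f.
Proof.
move=> cf p; have [odom _ cphi _ _] := chart_at_chart p.
have pp := chart_at_dom p.
have c : {within dom p, continuous (fun q => loc p f (phi p q))}.
  apply: (continuous_within_map _ cphi (cf p)) => q; exact: phi_img.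
have {}c : {within dom p, continuous f}.
  apply: subspace_eq_continuous c => q; rewrite inE => pq.
  by change (f (psi p (phi p q)) = f q); rewrite phiK.
by move: c; rewrite continuous_open_subspace// => /(_ p (mem_set pp)).
Qed.

(** The Dirichlet pairing of two maps; polarization transfers the independence
    of the chart from the norm of the differential. *)
Definition pairing (Z V : S -> 'rV[R]_5) p : R :=
  (dnorm2 X (fun q => Z q + V q) p - dnorm2 X Z p - dnorm2 X V p) / 2.

Let solve_polarization (u v w u' v' w' d : R) : u = u' -> v = v' -> w = w' ->
  u' = v' + 2 * d + w' -> (u - v - w) / 2 = d.
Proof. by move=> -> -> -> ->; field. Qed.

Lemma local_pairing (Z V : S -> 'rV[R]_5) p z : surface_C 1 Z -> surface_C 1 V ->
  img p z -> loc p (pairing Z V) z = dirichlet (img p) (xl p) (loc p Z) (loc p V) z.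
Proof.
move=> CZ CV pz.
have CZV : surface_C 1 (fun q => Z q + V q).
  by move=> q; exact: class_C_add (relopen_accessible (rI q)) (CZ q) (CV q).
have E1 := local_dnorm2 immX CZV pz.
have E2 := local_dnorm2 immX CZ pz.
have E3 := local_dnorm2 immX CV pz.
have P := norm2_polarization (xl p) (rI p) pz (CZ p) (CV p).
exact: (solve_polarization E1 E2 E3 P).
Qed.

Lemma pairing_continuous (Z V : S -> 'rV[R]_5) : surface_C 1 Z -> surface_C 1 V ->
  continuous (pairing Z V).
Proof.
move=> CZ CV; apply: chart_continuous => p.
have C := class_dirichlet (rI p) (xl_class immX p) (@metric_det_gt0 _ _ _ immX p) (CZ p) (CV p).
apply: continuous_within_ext (class_C_continuous C) => z pz.
by rewrite (local_pairing CZ CV pz).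
Qed.

Lemma dnorm2_continuous (Z : S -> 'rV[R]_5) : surface_C 1 Z -> continuous (dnorm2 X Z).
Proof.
move=> CZ; apply: chart_continuous => p.
have C := class_dirichlet (rI p) (xl_class immX p) (@metric_det_gt0 _ _ _ immX p) (CZ p) (CZ p).
apply: continuous_within_ext (class_C_continuous C) => z pz.
by rewrite (local_dnorm2 immX CZ pz).
Qed.

Lemma mink_laplace_continuous (Z V : S -> 'rV[R]_5) : surface_C 2 Z -> surface_C 0 V ->
  continuous (fun p => mink (laplace X Z p) (V p)).
Proof.
move=> CZ CV; apply: chart_continuous => p.
have C := class_lap (rI p) (xl_class immX p) (@metric_det_gt0 _ _ _ immX p) (leq0n 2) (CZ p).
have C' := class_C_mink (relopen_accessible (rI p)) C (CV p).
apply: continuous_within_ext (class_C_continuous C') => z pz.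
by rewrite -(local_laplace_row immX CZ pz).
Qed.

(** Off the closed set C the map V vanishes on a neighbourhood, so its
    derivatives vanish too. *)
Lemma pairing_vanish (Z V : S -> 'rV[R]_5) (C : set S) q : surface_C 1 Z ->
  surface_C 1 V -> closed C -> (forall r, ~ C r -> V r = 0) -> ~ C q ->
  pairing Z V q = 0.
Proof.
move=> CZ CV cC V0 Cq; have qq := phi_img (chart_at_dom q).
rewrite -(local_center (pairing Z V) q) (local_pairing CZ CV qq).
have nC : \forall y \near phi q q, img q y -> loc q V y = 0.
  have [_ _ _ /subspace_continuousP/(_ _ qq) cpsi _] := chart_at_chart q.
  have nq : nbhs (psi q (phi q q)) (~` C).
    rewrite (phiK (chart_at_dom q)); apply: open_nbhs_nbhs; split=> //.
    exact: closed_openC.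
  have := cpsi _ nq.
  move=> H; have {}H : \forall y \near phi q q, img q y -> ~ C (psi q y) by exact: H.
  near=> y => iy; apply: V0; exact: (near H y).
have pd0 b : pd (img q) b (loc q V) (phi q q) = 0.
  apply: pd_eq => //.
  apply: (has_deriv_near (D := img q) (f := fun=> 0)); last exact: has_deriv_cst.
  - by near=> y.
  - by near=> y => iy; symmetry; exact: (near nC y).
  - by rewrite (nbhs_singleton nC).
rewrite /dirichlet /trace_at !pd0.
have m0 (v : 'rV[R]_5) : mink v 0 = 0 by rewrite -[X in mink v X](scale0r v) !minklin mul0r.
by rewrite !m0 /metric_trace; ring.
Unshelve. all: by end_near. Qed.

Variable mu : {measure set borel -> \bar R}.
Hypothesis amu : area_measure X mu.

(** The flux of Y contracted with V vanishes on the sides of the box, so its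
    divergence integrates to zero. *)
Lemma green_box (Y V : S -> 'rV[R]_5) (C : set S) p (a b c d : R) :
  surface_C 2 Y -> surface_C 1 V -> a < b -> 0 < c -> c < d ->
  (forall z, a <= z.1 <= b -> c <= z.2 <= d -> img p z) ->
  closed C -> C `<=` psi p @` open_box a b c d -> (forall q, ~ C q -> V q = 0) ->
  (\int[mu]_(q in setT) (pairing Y V q + mink (laplace X Y q) (V q))%:E = 0)%E.
Proof.
move=> CY CV ab c0 cd boxI cC CQ V0.
pose Q := open_box a b c d.
pose G q := pairing Y V q + mink (laplace X Y q) (V q).
have CY1 : surface_C 1 Y by move=> q; exact: class_C_pred (CY q).
have CV0 : surface_C 0 V by move=> q; exact: class_C_pred (CV q).
have cG : continuous G.
  move=> q; apply: cvgD; first exact: pairing_continuous CY1 CV q.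
  exact: mink_laplace_continuous CY CV0 q.
have G0 q : ~ C q -> G q = 0.
  move=> Cq; rewrite /G (pairing_vanish CY1 CV cC V0 Cq) V0//.
  by rewrite -[X in mink _ X](scale0r (V q)) !minklin mul0r addr0.
have QI : Q `<=` img p by exact: open_box_sub.
have rQ : relopen Q.
  exists Q; first exact: open_box_open.
  apply/seteqP; split=> [z Qz|z []//]; split=> //.
  case: Qz => _ /=; rewrite in_itv /= => /andP[cz _]; rewrite /half_plane /=; lra.
have mG := continuous_borel cG.
have mGU : measurable_fun (psi p @` Q : set borel) (G : borel -> R).
  exact: measurable_funS mG.
transitivity (\int[mu]_(q in psi p @` Q) (G q)%:E)%E.
  rewrite [RHS]integral_mkcond; apply: eq_integral => q _.
  rewrite patchE; case: ifPn => // qQ; rewrite -/(G q) G0// => Cq.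
  by move: qQ; rewrite notin_setE; apply; exact: CQ.
rewrite (chart_integral immX amu rQ QI mGU).
have CvI := class_flux1 (rI p) (xl_class immX p) (@metric_det_gt0 _ _ _ immX p)
  (isT : (1 <= 3)%N) (CY p).
have CvI2 := class_flux2 (rI p) (xl_class immX p) (@metric_det_gt0 _ _ _ immX p)
  (isT : (1 <= 3)%N) (CY p).
have aI := relopen_accessible (rI p).
have C1 := class_C_mink aI CvI (CV p).
have C2 := class_C_mink aI CvI2 (CV p).
have Vb z : img p z -> ~ Q z -> loc p V z = 0.
  move=> pz Qz; apply: V0 => /CQ [y Qy yz]; apply: Qz.
  by rewrite -(psiK pz) -yz psiK//; exact: QI.
have mink0 (u : 'rV[R]_5) z : img p z -> ~ Q z -> mink u (loc p V z) = 0.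
  by move=> pz Qz; rewrite Vb// -[X in mink _ X](scale0r u) !minklin mul0r.
apply: etrans (box_divergence (rI p) ab cd boxI C1 C2 _ _); last first.
- move=> s /andP[s1 s2]; split; apply: mink0.
  + by apply: boxI => /=; lra.
  + by move=> [_] /=; rewrite in_itv /= ltxx.
  + by apply: boxI => /=; lra.
  + by move=> [_] /=; rewrite in_itv /= ltxx andbF.
- move=> s /andP[s1 s2]; split; apply: mink0.
  + by apply: boxI => /=; lra.
  + by move=> [] /=; rewrite in_itv /= ltxx.
  + by apply: boxI => /=; lra.
  + by move=> [] /=; rewrite in_itv /= ltxx andbF.
apply: eq_integral => z; rewrite inE => Qz; congr EFin; have pz := QI _ Qz.
rewrite (dirichlet_divergence (rI p) (xl_class immX p) (@metric_det_gt0 _ _ _ immX p) pz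
  (CY p) (CV p)).
rewrite -(local_pairing CY1 CV pz) -(local_laplace_row immX CY pz).
by [].
Qed.

End Green.

(** * Powers of the positive part *)

Section PositivePart.
Context {R : realType}.

Definition pospow (n : nat) (u : R) : R := Num.max 0 u ^+ n.

Lemma pospow_le0 n u : u <= 0 -> pospow n.+1 u = 0.
Proof. by move=> u0; rewrite /pospow max_l// expr0n. Qed.

Lemma pospow_ge0E n u : 0 <= u -> pospow n u = u ^+ n.
Proof. by move=> u0; rewrite /pospow max_r. Qed.

Lemma pospow_ge0 n u : 0 <= pospow n u.
Proof. by rewrite exprn_ge0// le_max lexx. Qed.

Lemma pospow_continuous n : continuous (pospow n).
Proof.
move=> u; apply: (@continuous_comp _ _ _ (fun u : R => Num.max 0 u) (fun v => v ^+ n)).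
  by apply: (@continuous_max _ _ (cst 0) id); [exact: cst_continuous|exact: cvg_id].
exact: exprn_continuous.
Qed.

Lemma pospow_is_derive n (u : R) :
  is_derive u 1 (pospow n.+2) (n.+2%:R * pospow n.+1 u).
Proof.
have [u0|u0|->] := ltgtP u 0.
- rewrite pospow_le0 ?ltW// mulr0.
  apply: (@near_eq_is_derive R _ R (cst 0)).
  by near=> v; rewrite pospow_le0// ltW//; near: v; exact: lt_nbhsl.
- rewrite pospow_ge0E ?ltW//.
  apply: (@near_eq_is_derive R _ R (fun v : R => v ^+ n.+2)).
    by near=> v; rewrite pospow_ge0E// ltW//; near: v; exact: lt_nbhsr.
  have := DeriveDef (@exprn_derivable R n.+2 u 1) (exp_derive n.+2 u (1 : R)).
  by rewrite /GRing.scale /= mulr1.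
(* at 0 the difference quotient is the positive part to one power less *)
- rewrite [X in is_derive _ _ _ X](_ : _ = 0); last by rewrite pospow_le0 ?mulr0.
  apply: (@has_deriv_is_derive _ setT); first by near=> v.
  have c : pospow n.+1 h @[h --> times setT (1 : R) (0 : R)] --> (0 : R).
    have p0 : pospow n.+1 (0 : R) = 0 by exact: pospow_le0.
    have c0 := @pospow_continuous n.+1 0; rewrite /continuous_at p0 in c0.
    have t0 : h @[h --> times setT (1 : R) (0 : R)] --> (0 : R) by exact: times_cvg0.
    exact: (cvg_comp id (pospow n.+1) t0 c0).
  apply: cvg_trans c; apply: near_eq_cvg.
  have n0 : \forall h \near times setT (1 : R) (0 : R), h != 0.
    by rewrite /times near_withinE near_withinE; near=> h => h0 _.
  near=> h; have h0 : h != 0 by near: h.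
  rewrite addr0 [h *: 1]mulr1 (pospow_le0 _ (lexx 0)) subr0.
  have [hn|hp] := leP h 0; first by rewrite !pospow_le0// scaler0.
  by rewrite !pospow_ge0E ?ltW// [h ^+ n.+2]exprS [_ *: _]mulrA mulVf// mul1r.
Unshelve. all: by end_near. Qed.

(** The derivative of such a power is a multiple of the next lower one, which
    loses one degree of smoothness at each step. *)
Lemma class_C_pospow {V : normedModType R} (B : seq V) k (D : set V) (a : V -> R) :
  accessible B D -> class_C B k D a -> class_C B k D (fun y => pospow k.+1 (a y)).
Proof.
move=> aD; elim: k => [|k IH] Ca; have ca := continuous_within_comp
    (class_C_continuous Ca) (fun x _ => @pospow_continuous _ (a x)).
  by split.
apply: (class_C_succ
  (df := fun e y => k.+2%:R * pospow k.+1 (a y) * deriv_along D a e y) aD (ca _)).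
  move=> e eB x Dx; apply: has_deriv_comp (class_C_has_deriv Ca eB Dx) _.
  exact: pospow_is_derive.
move=> e eB; apply: (class_C_mul aD _ (class_C_deriv Ca eB)).
exact: class_C_mul aD (class_C_cst _ _ aD) (IH (class_C_pred Ca)).
Qed.

End PositivePart.

(** * Bump functions and Green's formula on the surface *)

Section Plateau.
Context {R : realType}.

(** The inner power is a bump supported in the unit interval; the outer one
    flattens it to 1 where it exceeds one half. *)
Definition plateau (s : R) : R := 1 - pospow 3 (1 - 2 * pospow 3 (1 - s * s)).

Lemma plateau_ge0 s : 0 <= plateau s.
Proof.
rewrite subr_ge0 {1}/pospow exprn_ile1//; first by rewrite le_max lexx.
rewrite ge_max ler01 /= gerBl mulr_ge0//; exact: pospow_ge0.
Qed.

Lemma plateau1 s : `|s| <= 2 / 5 -> plateau s = 1.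
Proof.
rewrite ler_norml => /andP[s1 s2].
(* 2/5 is small enough for (1 - (2/5)^2)^3 to exceed 1/2 *)
have ss : s * s <= 4 / 25 by nra.
rewrite /plateau [pospow 3 (1 - s * s)]pospow_ge0E; last by lra.
rewrite pospow_le0 ?subr0//.
have : (21 / 25) ^+ 3 <= (1 - s * s) ^+ 3.
  by rewrite lerXn2r ?nnegrE//; lra.
lra.
Qed.

Lemma plateau0 s : 1 <= `|s| -> plateau s = 0.
Proof.
move=> s1; have ss : 1 <= s * s.
  by rewrite -expr2 -real_normK ?num_real// exprn_ege1.
rewrite /plateau [pospow 3 (1 - s * s)]pospow_le0 ?subr_le0//.
by rewrite mulr0 subr0 pospow_ge0E// expr1n subrr.
Qed.

Lemma class_C_plateau {V : normedModType R} (B : seq V) (D : set V) (a : V -> R) :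
  accessible B D -> class_C B 2 D a -> class_C B 2 D (fun y => plateau (a y)).
Proof.
move=> aD Ca; have C1 := class_C_cst 2 (1 : R) aD; have C2 := class_C_cst 2 (2 : R) aD.
apply: (class_C_sub aD C1).
apply: (class_C_pospow aD); apply: (class_C_sub aD C1).
apply: (class_C_mul aD C2); apply: (class_C_pospow aD).
exact: class_C_sub aD C1 (class_C_mul aD Ca Ca).
Qed.

Lemma has_deriv_linear {V W : normedModType R} (D : set V) (f : V -> W) e x :
  (forall (h : R) e x, f (h *: e + x) = h *: f e + f x) -> has_deriv D f e x (f e).
Proof.
move=> lf; apply: (@cvg_trans _ ((fun=> f e) h @[h --> times D e x])); last exact: cvg_cst.
apply: near_eq_cvg; rewrite /times near_withinE near_withinE.
near=> h => h0 _; rewrite lf addrK scalerA mulVf ?scale1r//.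
Unshelve. all: by end_near. Qed.

Lemma class_C_linear {V W : normedModType R} (B : seq V) k (D : set V) (f : V -> W) :
  accessible B D -> continuous f ->
  (forall (h : R) e x, f (h *: e + x) = h *: f e + f x) -> class_C B k D f.
Proof.
move=> aD cf lf; have cfD : {within D, continuous f} by exact: continuous_subspaceT.
case: k => [|k]; first by split.
apply: (class_C_succ (df := fun e _ => f e) aD cfD) => [e _ x Dx|e _].
  exact: has_deriv_linear.
exact: class_C_cst.
Qed.

Definition plane_bump (z0 : R * R) (r : R) (z : R * R) : R :=
  plateau ((z.1 - z0.1) / r) * plateau ((z.2 - z0.2) / r).

Lemma plane_bump_ge0 z0 r z : 0 <= plane_bump z0 r z.
Proof. by rewrite mulr_ge0// plateau_ge0. Qed.

Lemma plane_bump1 z0 r z : 0 < r -> `|z.1 - z0.1| <= 2 / 5 * r ->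
  `|z.2 - z0.2| <= 2 / 5 * r -> plane_bump z0 r z = 1.
Proof.
move=> r0 z1 z2; rewrite /plane_bump !plateau1 ?mulr1// normrM normfV;
  by rewrite (gtr0_norm r0) ler_pdivrMr.
Qed.

Lemma plane_bump0 z0 r z : 0 < r -> r <= `|z.1 - z0.1| \/ r <= `|z.2 - z0.2| ->
  plane_bump z0 r z = 0.
Proof.
move=> r0; have far s : r <= `|s| -> plateau (s / r) = 0.
  by move=> rs; rewrite plateau0// normrM normfV (gtr0_norm r0) ler_pdivlMr ?mul1r.
by rewrite /plane_bump => -[] /far ->; rewrite ?mul0r ?mulr0.
Qed.

Lemma class_plane_bump z0 r (D : set (R * R)) : relopen D ->
  class_C dirs2 2 D (plane_bump z0 r).
Proof.
move=> /relopen_accessible aD; apply: (class_C_mul aD); apply: (class_C_plateau aD).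
  apply: (class_C_mul aD _ (class_C_cst 2 _ aD)).
  apply: (class_C_sub aD _ (class_C_cst 2 _ aD)); apply: (class_C_linear 2 aD).
    by move=> z; exact: cvg_fst.
  by [].
apply: (class_C_mul aD _ (class_C_cst 2 _ aD)).
apply: (class_C_sub aD _ (class_C_cst 2 _ aD)); apply: (class_C_linear 2 aD).
  by move=> z; exact: cvg_snd.
by [].
Qed.

End Plateau.

Section SurfaceBump.
Context {R : realType} (S : surface R).
Implicit Types (p q : S) (z : R * R).

Local Notation dom p := (cdom (chart_at p)).
Local Notation img p := (cimg (chart_at p)).
Local Notation phi p := (cmap (chart_at p)).
Local Notation psi p := (cinv (chart_at p)).
Local Notation ovl p q := (overlap (chart_at p) (chart_at q)).

(** Bumps about p live in the square of radius r; the margin up to 2r leaves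
    room for a box in the chart on whose sides they vanish. *)
Definition admissible p (r : R) : Prop :=
  [/\ 0 < r, 2 * r < (phi p p).2 & forall z, `|z.1 - (phi p p).1| <= 2 * r ->
    `|z.2 - (phi p p).2| <= 2 * r -> img p z].

Lemma admissible_ex p (e : R) : surface_interior p -> 0 < e ->
  exists2 r, r < e & admissible p r.
Proof.
move=> p0 e0; have pp := phi_img (chart_at_dom p).
have [d d0 dI] := relopen_box (img_relopen p) pp.
pose m := Num.min (Num.min d (phi p p).2) e.
have m0 : 0 < m by rewrite !lt_min d0 e0 andbT.
have [md mb me] : [/\ m <= d, m <= (phi p p).2 & m <= e].
  by split; rewrite /m !ge_min lexx ?orbT.
exists (m / 3); first by lra.
split; [by lra|by lra|] => z z1 z2; apply: dI; [by lra|by lra|].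
by move: z2; rewrite ler_norml => /andP[z2 _]; lra.
Qed.

Definition square p (r : R) : set (R * R) :=
  [set z | `|z.1 - (phi p p).1| <= r /\ `|z.2 - (phi p p).2| <= r].

Lemma square_compact p r : compact (square p r).
Proof.
have -> : square p r = `[(phi p p).1 - r, (phi p p).1 + r]%classic
    `*` `[(phi p p).2 - r, (phi p p).2 + r]%classic.
  by apply/seteqP; split=> z; rewrite /square /= !in_itv /= !ler_distl => -[].
by apply: compact_setX; exact: segment_compact.
Qed.

Section Bump.
Variables (p : S) (r : R).
Hypothesis pr : admissible p r.

Lemma square_img : square p r `<=` img p.
Proof. by move: pr => [r0 _ I] z [z1 z2]; apply: I; lra. Qed.

(** Compact in a Hausdorff space: this makes the extension of the bump by zero
    outside the chart smooth. *)
Lemma square_closed : closed (psi p @` square p r).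
Proof.
apply: compact_closed; first exact: surface_hausdorff.
apply: continuous_compact (@square_compact p r).
have [_ _ _ cpsi _] := chart_at_chart p.
exact: continuous_subspaceW square_img cpsi.
Qed.

Definition bump q : R :=
  if `[< dom p q >] then plane_bump (phi p p) r (phi p q) else 0.

Lemma bump_chart q : dom p q -> bump q = plane_bump (phi p p) r (phi p q).
Proof. by move=> pq; rewrite /bump ifT//; exact/asboolP. Qed.

Lemma bump_ge0 q : 0 <= bump q.
Proof. by rewrite /bump; case: ifP => // _; exact: plane_bump_ge0. Qed.

Lemma bump0 q : ~ (psi p @` square p r) q -> bump q = 0.
Proof.
move=> Cq; rewrite /bump; case: asboolP => // pq; apply: plane_bump0.
  by have [] := pr.
have [z1|z1] := leP r `|(phi p q).1 - (phi p p).1|; first by left.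
have [z2|z2] := leP r `|(phi p q).2 - (phi p p).2|; first by right.
by exfalso; apply: Cq; exists (phi p q); [split; exact: ltW|exact: phiK].
Qed.

Lemma bump_psi1 z : `|z.1 - (phi p p).1| <= 2 / 5 * r ->
  `|z.2 - (phi p p).2| <= 2 / 5 * r -> bump (psi p z) = 1.
Proof.
have [r0 _ I] := pr; move=> z1 z2; have pz : img p z by apply: I; lra.
rewrite bump_chart; last exact: psi_dom.
by rewrite psiK//; exact: plane_bump1.
Qed.

Lemma bump_center : bump p = 1.
Proof.
rewrite -{1}(phiK (chart_at_dom p)); have [r0 _ _] := pr.
by apply: bump_psi1; rewrite subrr normr0; lra.
Qed.

(** Near a point of the chart at p the bump is a C^2 function of the
    coordinates there, composed with the change of charts; a point outside
    that chart has a neighbourhood that misses the closed image of the square. *)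
Lemma bump_surface_C : surface_C 2 bump.
Proof.
move=> q; have rI := img_relopen q; apply: class_C_local => z qz.
have [pz|pz] := pselect (dom p (psi q z)).
  have [U oU TE] := ovl_open q p; have qpz : ovl q p z by [].
  have rT : relopen (ovl q p) by rewrite TE; exact: relopen_openI rI oU.
  exists U; first by split=> //; move: qpz; rewrite TE => -[].
  rewrite -TE.
  have C := class_C_comp (img_relopen p) (relopen_accessible rT) (@tr_img _ _ q p)
    (class_plane_bump (phi p p) r (img_relopen p)) (@tr_class _ _ q p 2).
  apply: class_C_ext C => y [qy py]; symmetry; exact: bump_chart py.
have [_ _ _ /continuousP cpsi _] := chart_at_chart q.
have oC : open (~` (psi p @` square p r)) by apply: closed_openC; exact: square_closed.
have /open_subspaceP[U oU UE] := cpsi _ oC.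
have UC y : img q y -> U y <-> ~ (psi p @` square p r) (psi q y).
  move=> qy; split=> H.
    by have : (U `&` img q) y by []; rewrite UE => -[].
  by have : ((psi q @^-1` (~` (psi p @` square p r))) `&` img q) y by []; rewrite -UE => -[].
exists U.
  split=> //; apply/(UC z qz) => -[y /square_img py yz]; apply: pz.
  by rewrite -yz; exact: psi_dom.
apply: (class_C_ext (f := fun=> 0)); last first.
  exact: class_C_cst (relopen_accessible (relopen_openI rI oU)).
by move=> y [qy Uy]; rewrite /local /= bump0//; exact/(UC y qy).
Qed.

End Bump.
End SurfaceBump.

Section GreenFormula.
Context {R : realType} (S : surface R) (X : S -> 'rV[R]_3).
Hypothesis immX : immersion 4 X.
Implicit Types (p q : S) (z : R * R).

Local Notation img p := (cimg (chart_at p)).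
Local Notation phi p := (cmap (chart_at p)).
Local Notation psi p := (cinv (chart_at p)).
Local Notation loc p f := (local (chart_at p) f).
Local Notation borel := (g_sigma_algebraType (@open S)).

Variable mu : {measure set borel -> \bar R}.
Hypothesis amu : area_measure X mu.

Lemma surface_C_scale k (a : S -> R) (V : S -> 'rV[R]_5) :
  surface_C k a -> surface_C k V -> surface_C k (fun q => a q *: V q).
Proof.
by move=> Ca CV p; exact: class_C_scale (relopen_accessible (img_relopen p)) (Ca p) (CV p).
Qed.

Lemma pairingDr (Y V W : S -> 'rV[R]_5) p : surface_C 1 Y -> surface_C 1 V ->
  surface_C 1 W ->
  pairing X Y (fun q => V q + W q) p = pairing X Y V p + pairing X Y W p.
Proof.
move=> CY CV CW; have pp := phi_img (chart_at_dom p).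
have rI := img_relopen p.
have CVW : surface_C 1 (fun q => V q + W q).
  by move=> q; exact: class_C_add (relopen_accessible (img_relopen q)) (CV q) (CW q).
have E1 := local_pairing immX CY CVW pp; have E2 := local_pairing immX CY CV pp.
have E3 := local_pairing immX CY CW pp.
rewrite -(local_center (pairing X Y _) p) -(local_center (pairing X Y V) p).
rewrite -(local_center (pairing X Y W) p).
apply: (etrans E1); apply: (etrans _ (esym (congr2 +%R E2 E3))).
have E b : pd (img p) b (fun y => loc p V y + loc p W y) (phi p p)
    = pd (img p) b (loc p V) (phi p p) + pd (img p) b (loc p W) (phi p p).
  apply: (pd_eq rI pp).
  exact: has_derivD (pd_has_deriv b (CV p) pp) (pd_has_deriv b (CW p) pp).
have {}E b : pd (img p) b (loc p (fun q => V q + W q)) (phi p p)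
    = pd (img p) b (loc p V) (phi p p) + pd (img p) b (loc p W) (phi p p) := E b.
by rewrite /dirichlet !E /trace_at /metric_trace !minkDr; ring.
Qed.

Definition green (Y V : S -> 'rV[R]_5) : Prop :=
  (\int[mu]_(q in setT) (pairing X Y V q + mink (laplace X Y q) (V q))%:E = 0)%E.

Lemma green_sum (Y V W : S -> 'rV[R]_5) : surface_C 2 Y -> surface_C 1 V ->
  surface_C 1 W -> green Y V -> green Y W -> green Y (fun q => V q + W q).
Proof.
move=> CY CV CW gV gW; have CY1 : surface_C 1 Y by move=> q; exact: class_C_pred (CY q).
have cG (U : S -> 'rV[R]_5) : surface_C 1 U ->
    mu.-integrable (setT : set borel)
      (EFin \o (fun q => pairing X Y U q + mink (laplace X Y q) (U q))).
  move=> CU; have CU0 : surface_C 0 U by move=> q; exact: class_C_pred (CU q).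
  apply: (continuous_integrable immX amu) => q.
  apply: cvgD; first exact: (pairing_continuous immX CY1 CU).
  exact: (mink_laplace_continuous immX CY CU0).
have HH := integralD measurableT (cG V CV) (cG W CW).
rewrite /green; apply: etrans (_ : _ = (0 + 0)%E) (adde0 0%E).
rewrite -{1}gV -gW; apply: etrans HH; apply: eq_integral => q _ /=.
by rewrite -EFinD pairingDr// minkDr addrACA.
Qed.

(** Cut V off with one bump at a time: b V is supported in a box, and (1 - b)
    V is supported where one of the remaining bumps equals 1. *)
Lemma green_finite (Y : S -> 'rV[R]_5) (r : S -> R) (s : seq S) (V : S -> 'rV[R]_5) :
  surface_C 2 Y -> (forall p, p \in s -> admissible p (r p)) -> surface_C 1 V ->
  (forall q, (forall p, p \in s -> bump p (r p) q <> 1) -> V q = 0) -> green Y V.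
Proof.
move=> CY; have CY1 : surface_C 1 Y by move=> q; exact: class_C_pred (CY q).
elim: s V => [|p s IH] V adm CV V0.
  have {}V0 q : V q = 0 by exact: V0.
  rewrite /green; apply: integral0_eq => q _.
  rewrite (pairing_vanish immX CY1 CV closed0 (fun r _ => V0 r) (fun f : set0 q => f)).
  by rewrite V0 -[X in mink _ X](scale0r (Y q)) minkZr mul0r addr0.
have ap : admissible p (r p) by apply: adm; rewrite mem_head.
have Cb : surface_C 1 (bump p (r p)).
  by move=> q; exact: class_C_pred (bump_surface_C ap q).
have Cc : surface_C 1 (fun q => 1 - bump p (r p) q).
  move=> q; have aq := relopen_accessible (img_relopen q).
  exact: class_C_sub aq (class_C_cst 1 (1 : R) aq) (Cb q).
have CV1 := surface_C_scale Cb CV; have CV2 := surface_C_scale Cc CV.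
suff : green Y (fun q => bump p (r p) q *: V q + (1 - bump p (r p) q) *: V q).
  by under eq_fun do rewrite -scalerDl addrC subrK scale1r.
apply: green_sum => //.
  have [r0 rb I] := ap.
  apply: (@green_box _ _ _ immX mu amu Y _ (psi p @` square p (r p)) p
    ((phi p p).1 - 2 * r p) ((phi p p).1 + 2 * r p)
    ((phi p p).2 - 2 * r p) ((phi p p).2 + 2 * r p)) => //.
  - lra.
  - lra.
  - lra.
  - by move=> z z1 z2; apply: I; rewrite ler_distl.
  - exact: square_closed.
  - move=> _ [z [z1 z2] <-]; exists z => //.
    by split; rewrite /= in_itv /= -ltr_distl; lra.
  - by move=> q Cq; rewrite (bump0 ap Cq) scale0r.
apply: IH => // [q qs|q Hq]; first by apply: adm; rewrite inE qs orbT.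
have [->|b1] := eqVneq (bump p (r p) q) 1; first by rewrite subrr scale0r.
rewrite V0 ?scaler0// => p'; rewrite inE => /predU1P[->|]; last exact: Hq.
exact/eqP.
Qed.

(** Finitely many of the open sets where a bump equals 1 cover the support. *)
Theorem green_formula (Y V : S -> 'rV[R]_5) (K : set S) :
  surface_C 2 Y -> surface_C 1 V -> compact K -> K `<=` @surface_interior R S ->
  (forall q, ~ K q -> V q = 0) -> green Y V.
Proof.
move=> CY CV cK KS V0.
have [r Hr] : {r : S -> R & forall p, surface_interior p -> admissible p (r p)}.
  apply: (@choice _ _ (fun p s => surface_interior p -> admissible p s)) => p.
  have [p0|p0] := pselect (surface_interior p); last by exists 0.
  by have [r _ ?] := admissible_ex p0 ltr01; exists r.
pose U p := psi p @` (open_box ((phi p p).1 - 2 / 5 * r p) ((phi p p).1 + 2 / 5 * r p)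
    ((phi p p).2 - 2 / 5 * r p) ((phi p p).2 + 2 / 5 * r p)).
have UP p z : open_box ((phi p p).1 - 2 / 5 * r p) ((phi p p).1 + 2 / 5 * r p)
    ((phi p p).2 - 2 / 5 * r p) ((phi p p).2 + 2 / 5 * r p) z ->
    `|z.1 - (phi p p).1| < 2 / 5 * r p /\ `|z.2 - (phi p p).2| < 2 / 5 * r p.
  by move=> []; rewrite /= !in_itv /= -!ltr_distl.
move: cK; rewrite compact_cover => /(_ S (@surface_interior R S) U).
case=> [p p0|p Kp|D' DS cov].
- have [r0 rb I] := Hr p p0.
  apply: chart_image_open.
    exists (open_box ((phi p p).1 - 2 / 5 * r p) ((phi p p).1 + 2 / 5 * r p)
      ((phi p p).2 - 2 / 5 * r p) ((phi p p).2 + 2 / 5 * r p)).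
      exact: open_box_open.
    apply/seteqP; split=> [z Qz|z []//]; split=> //.
    have [_] := UP _ _ Qz; rewrite ltr_norml => /andP[z2 _].
    by rewrite /half_plane /=; lra.
  move=> z Qz; have [z1 z2] := UP _ _ Qz; apply: I; lra.
- exists p; first exact: KS.
  have [r0 rb I] := Hr p (KS _ Kp).
  exists (phi p p); last exact: phiK (chart_at_dom p).
  by split; rewrite /= in_itv /=; apply/andP; split; lra.
apply: (@green_finite Y r (finmap.enum_fset D')) => // [p pD|q Hq].
  by apply: Hr; have := DS p pD; rewrite inE.
apply: V0 => Kq; have [p pD [z Qz zq]] := cov q Kq.
have [z1 z2] := UP _ _ Qz.
have p0 : surface_interior p by have := DS p pD; rewrite inE.
apply: (Hq p pD); rewrite -zq; apply: (bump_psi1 (Hr p p0)); lra.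
Qed.

End GreenFormula.

(** * Families of functions depending on time *)

Lemma open_reachable {R : realType} (J : set R) (t : R) : open J -> J t -> reachable J (1 : R) t.
Proof.
move=> oJ Jt; apply: (@accessible_reachable _ _ [:: 1 : R]); rewrite ?mem_head//.
move=> e _ s Js; apply: nbhs_at_right; apply: line_near; exact: open_nbhs_nbhs.
Qed.

Lemma open_time {R : realType} (eps : R) : open [set t : R | - eps < t < eps].
Proof.
have -> : [set t : R | - eps < t < eps] = `]- eps, eps[%classic.
  by apply/seteqP; split=> t; rewrite /= in_itv.
exact: interval_open.
Qed.

Section TimeSlices.
Context {R : realType}.
Variables (I : set R) (D : set (R * R)).
Hypotheses (oI : open I) (rD : relopen D).
Implicit Types (t : R) (z : R * R).

Lemma relopen_accessible3 : accessible dirs3 (I `*` D).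
Proof.
move=> e eB [t z] [/= It Dz].
have nI : \forall h \near (0 : R), I (h *: e.1 + t).
  by apply: line_near; exact: open_nbhs_nbhs.
have nD : \forall h \near 0^'+, D (h *: e.2 + z).
  move: eB; rewrite !inE => /or3P[] /eqP -> /=.
  - by near=> h; rewrite scaler0 add0r.
  - exact: (relopen_accessible rD dir1_in Dz).
  - exact: (relopen_accessible rD dir2_in Dz).
have {}nI : \forall h \near 0^'+, I (h *: e.1 + t) by exact: nbhs_at_right.
by near=> h; split => /=; [near: h|near: h].
Unshelve. all: by end_near. Qed.

Definition time_dir : R * (R * R) := (1, 0).
Definition space_dir (b : bool) : R * (R * R) := (0, coord_dir b).

Lemma time_dir_in : time_dir \in @dirs3 R.
Proof. by rewrite mem_head. Qed.

Lemma space_dir_in b : space_dir b \in @dirs3 R.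
Proof. by rewrite !inE; case: b; rewrite eqxx ?orbT. Qed.

Section Target.
Context {W : normedModType R}.
Implicit Types F : R * (R * R) -> W.

(** Moving along (0, e) leaves the time unchanged, so the derivatives of F in
    space are those of its time slices, as functions on D. *)
Lemma space_quotient F e t z : I t ->
  quotient_along (I `*` D) F (0, e) (t, z) = quotient_along D (fun y => F (t, y)) e z.
Proof.
move=> It; have E (h : R) : h *: ((0, e) : R * (R * R)) + (t, z) = (t, h *: e + z).
  by congr pair; rewrite /= scaler0 add0r.
have SE : [set h : R | (I `*` D) (h *: (0, e) + (t, z))] = [set h : R | D (h *: e + z)].
  apply/seteqP; split=> [h|h Dh].
    by change ((I `*` D) (h *: (0, e) + (t, z)) -> D (h *: e + z)); rewrite E => -[].
  by change ((I `*` D) (h *: (0, e) + (t, z))); rewrite E.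
by rewrite /quotient_along SE; under eq_fun do rewrite E.
Qed.

Lemma time_quotient F t z : D z ->
  quotient_along (I `*` D) F time_dir (t, z) = quotient_along I (fun s => F (s, z)) 1 t.
Proof.
move=> Dz; have E (h : R) : h *: time_dir + (t, z) = (h *: 1 + t, z).
  by congr pair; rewrite /= scaler0 add0r.
have SE : [set h : R | (I `*` D) (h *: time_dir + (t, z))] = [set h : R | I (h *: 1 + t)].
  apply/seteqP; split=> [h|h Dh].
    by change ((I `*` D) (h *: time_dir + (t, z)) -> I (h *: 1 + t)); rewrite E => -[].
  by change ((I `*` D) (h *: time_dir + (t, z))); rewrite E.
by rewrite /quotient_along SE; under eq_fun do rewrite E.
Qed.

Lemma space_deriv F b t z : I t ->
  deriv_along (I `*` D) F (space_dir b) (t, z) = pd D b (fun y => F (t, y)) z.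
Proof. by move=> It; rewrite pdE /deriv_along space_quotient. Qed.

Lemma time_deriv F t z : D z ->
  deriv_along (I `*` D) F time_dir (t, z) = deriv_along I (fun s => F (s, z)) 1 t.
Proof. by move=> Dz; rewrite /deriv_along time_quotient. Qed.

Lemma slice_map_continuous t : continuous (fun z : R * R => (t, z)).
Proof.
move=> z; have c : (fun=> t) @ nbhs z --> nbhs t by exact: cvg_cst.
have d : id @ nbhs z --> nbhs z by exact: cvg_id.
exact: (cvg_pair c d).
Qed.

Lemma class_slice k F t : I t -> class_C dirs3 k (I `*` D) F ->
  class_C dirs2 k D (fun z => F (t, z)).
Proof.
move=> It; elim: k F => [|k IH] F CF; have cF : {within D, continuous (fun z => F (t, z))} by
  (apply: (continuous_within_map (A' := I `*` D) _ _ (class_C_continuous CF)) => //;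
   apply: continuous_subspaceT; exact: slice_map_continuous).
  by split.
have ed e : e \in dirs2 -> ((0, e) : R * (R * R)) \in dirs3.
  by rewrite !inE => /orP[] /eqP ->; rewrite eqxx ?orbT.
apply: (class_C_succ (df := fun e y => deriv_along (I `*` D) F (0, e) (t, y))
  (relopen_accessible rD) cF).
  move=> e eB x Dx; rewrite /has_deriv -(space_quotient F e x It).
  have ID : (I `*` D) (t, x) by [].
  exact: class_C_has_deriv CF (ed e eB) ID.
by move=> e eB; apply: IH; exact: class_C_deriv CF (ed e eB).
Qed.

End Target.

Let square3 b t z : I t -> D z -> exists2 d : R, 0 < d &
  forall s u, 0 <= s <= d -> 0 <= u <= d ->
    (I `*` D) (s *: space_dir b + (u *: time_dir + (t, z))).
Proof.
move=> It Dz; have [d d0 dD] := relopen_box rD Dz.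
have /nbhs_ballP[d' d'0 dI] := open_nbhs_nbhs (conj oI It).
have z0 := relopen_half rD Dz.
have [m [m0 md md']] : exists m, [/\ 0 < m, m < d & m < d'].
  exists (Num.min d d' / 2).
  have m0 : 0 < Num.min d d' by rewrite lt_min d0.
  have m1 : Num.min d d' <= d by rewrite ge_min lexx.
  have m2 : Num.min d d' <= d' by rewrite ge_min lexx orbT.
  by split; lra.
exists m => // s u /andP[s0 sm] /andP[u0 um]; split => /=.
  apply: dI; rewrite /ball /= scaler0 add0r [u *: 1]mulr1 opprD addrCA subrr addr0.
  by rewrite normrN ger0_norm//; lra.
rewrite scaler0 add0r; case: b => /=.
  by rewrite dir2_line; apply: dD => /=; rewrite ?subrr ?normr0// ?addrK ?ger0_norm//; lra.
by rewrite dir1_line; apply: dD => /=; rewrite ?subrr ?normr0// ?addrK ?ger0_norm//; lra.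
Qed.

Variables (n : nat) (F : R * (R * R) -> 'rV[R]_n).
Hypothesis CF : class_C dirs3 2 (I `*` D) F.

Definition time_velocity : R * (R * R) -> 'rV[R]_n := deriv_along (I `*` D) F time_dir.

Lemma class_time_velocity : class_C dirs3 1 (I `*` D) time_velocity.
Proof. exact: class_C_deriv CF time_dir_in. Qed.

Let deriv3_row (G : R * (R * R) -> 'rV[R]_n) e t z i : I t -> D z -> e \in dirs3 ->
  class_C dirs3 1 (I `*` D) G ->
  deriv_along (I `*` D) (fun y => G y 0 i) e (t, z) = deriv_along (I `*` D) G e (t, z) 0 i.
Proof.
move=> It Dz ed CG; have ID : (I `*` D) (t, z) by [].
apply: deriv_alongE; first exact: accessible_reachable relopen_accessible3 ed ID.
by have /has_deriv_rowP := class_C_has_deriv CG ed ID; exact.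
Qed.

(** Equality of mixed partial derivatives, coordinate by coordinate. *)
Lemma time_space_mixed b t z : I t -> D z ->
  deriv_along (I `*` D) (deriv_along (I `*` D) F (space_dir b)) time_dir (t, z)
  = pd D b (fun y => time_velocity (t, y)) z.
Proof.
move=> It Dz; rewrite -(space_deriv _ b z It); apply/rowP => i.
have [d d0 dD] := square3 b It Dz; have a3 := relopen_accessible3.
have CFi := proj1 (class_C_row 2 F a3) CF i.
have ID : (I `*` D) (t, z) by [].
have M := mixed_partials (space_dir_in b) time_dir_in ID d0 dD CFi.
have C1 : class_C dirs3 1 (I `*` D) F := class_C_pred CF.
have row e y : e \in dirs3 -> (I `*` D) y ->
    deriv_along (I `*` D) (fun y => F y 0 i) e y = deriv_along (I `*` D) F e y 0 i.
  by case: y => s y ed [/= Is Dy]; exact: deriv3_row.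
have L := deriv3_row i It Dz time_dir_in (class_C_deriv CF (space_dir_in b)).
have L' := deriv3_row i It Dz (space_dir_in b) class_time_velocity.
have E := @deriv_along_ext _ _ _ (I `*` D) _ _ time_dir (t, z) ID
  (fun y yD => row (space_dir b) y (space_dir_in b) yD).
have E' := @deriv_along_ext _ _ _ (I `*` D) _ _ (space_dir b) (t, z) ID
  (fun y yD => row time_dir y time_dir_in yD).
exact (etrans (esym L) (etrans (esym E) (etrans M (etrans E' L')))).
Qed.

Lemma has_deriv_pd_time b t z : I t -> D z ->
  has_deriv I (fun s => pd D b (fun y => F (s, y)) z) 1 t
    (pd D b (fun y => time_velocity (t, y)) z).
Proof.
move=> It Dz; have ID : (I `*` D) (t, z) by [].
have H := class_C_has_deriv (class_C_deriv CF (space_dir_in b)) time_dir_in ID.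
rewrite (time_space_mixed b It Dz) in H.
rewrite /has_deriv (time_quotient _ _ Dz) in H.
by apply: has_deriv_ext H => // s Is; exact: space_deriv.
Qed.

Lemma has_deriv_time t z : I t -> D z ->
  has_deriv I (fun s => F (s, z)) 1 t (time_velocity (t, z)).
Proof.
move=> It Dz; have ID : (I `*` D) (t, z) by [].
have := class_C_has_deriv CF time_dir_in ID.
by rewrite /has_deriv (time_quotient _ _ Dz).
Qed.

Lemma pd_jointly_continuous b :
  {within I `*` D, continuous (fun tz : R * (R * R) => pd D b (fun y => F (tz.1, y)) tz.2)}.
Proof.
have C := class_C_continuous (class_C_deriv CF (space_dir_in b)).
by apply: continuous_within_ext C => -[t z] [/= It Dz]; exact: space_deriv.
Qed.

Lemma pd_velocity_jointly_continuous b :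
  {within I `*` D,
    continuous (fun tz : R * (R * R) => pd D b (fun y => time_velocity (tz.1, y)) tz.2)}.
Proof.
have C := class_C_continuous (class_C_deriv class_time_velocity (space_dir_in b)).
by apply: continuous_within_ext C => -[t z] [/= It Dz]; exact: space_deriv.
Qed.

End TimeSlices.

(** * The derivative of the energy along a variation *)

Section EnergyVariation.
Context {R : realType} (S : surface R) (X : S -> 'rV[R]_3).
Hypothesis immX : immersion 4 X.
Implicit Types (p q : S) (z : R * R) (t : R).

Local Notation dom p := (cdom (chart_at p)).
Local Notation img p := (cimg (chart_at p)).
Local Notation phi p := (cmap (chart_at p)).
Local Notation loc p f := (local (chart_at p) f).
Local Notation xl p := (local (chart_at p) X).
Local Notation borel := (g_sigma_algebraType (@open S)).

Lemma has_deriv_metric_trace {V : normedModType R} (D : set V) (e x : V)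
    (g11 g12 g22 w : R) (m11 m12 m21 m22 : V -> R) (d11 d12 d21 d22 : R) :
  has_deriv D m11 e x d11 -> has_deriv D m12 e x d12 ->
  has_deriv D m21 e x d21 -> has_deriv D m22 e x d22 ->
  has_deriv D (fun y => metric_trace g11 g12 g22 w (m11 y) (m12 y) (m21 y) (m22 y)) e x
    (metric_trace g11 g12 g22 w d11 d12 d21 d22).
Proof.
move=> h11 h12 h21 h22.
have H := has_derivD (has_derivB (has_derivZl (c:=g22) h11)
  (has_derivZl (c:=g12) (has_derivD h12 h21))) (has_derivZl (c:=g11) h22).
have H' := has_derivM H (has_deriv_cst_scalar D (w ^+ 2)^-1 e x).
rewrite mulr0 addr0 in H'.
exact: H'.
Qed.

Variables (co eps : R) (Y : S -> 'rV[R]_5) (Z : R -> S -> 'rV[R]_5).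
Hypotheses (eps0 : 0 < eps) (vZ : Defs.variation eps Y Z).

Let I : set R := [set t | - eps < t < eps].
Local Notation F p := (fun tz : R * (R * R) => loc p (Z tz.1) tz.2).

Let oI : open I := @open_time R eps.

Let rI p : relopen (img p) := img_relopen p.

Let CF p : class_C dirs3 2 (I `*` img p) (F p).
Proof. by case: vZ. Qed.

(** Defined without reference to a chart, so that it is a map on the surface
    by construction. *)
Definition velocity t p : 'rV[R]_5 := deriv_along I (fun s => Z s p) 1 t.

Lemma local_velocity t p z : img p z ->
  loc p (velocity t) z = time_velocity I (img p) (F p) (t, z).
Proof. by move=> pz; rewrite /time_velocity (time_deriv _ _ _ pz). Qed.

Lemma variation_surface_C t : I t -> surface_C 2 (Z t).
Proof.
move=> It p; apply: class_C_ext (class_slice (rI p) It (CF p)).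
by move=> z _.
Qed.

Lemma velocity_surface_C t : I t -> surface_C 1 (velocity t).
Proof.
move=> It p; apply: class_C_ext (class_slice (rI p) It (class_time_velocity (CF p))).
by move=> z pz; rewrite (local_velocity _ pz).
Qed.

Lemma has_deriv_variation t p : I t ->
  has_deriv I (fun s => Z s p) 1 t (velocity t p).
Proof.
move=> It; have pp := phi_img (chart_at_dom p).
have := has_deriv_time (CF p) It pp; rewrite -(local_velocity _ pp) local_center.
by apply: has_deriv_ext => // s _; exact: local_center.
Qed.

Definition energy_density t p : R := dnorm2 X (Z t) p + 4%:R * co * potential (Z t p).

(** The derivative of [energy_density] in time: the squared norm is quadratic
    and its polar form is the pairing. *)
Definition energy_rate t p : R :=
  2 * pairing X (Z t) (velocity t) p + 4 * co * mink (velocity t p) lvec.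

Lemma local_energy_rate t p z : I t -> img p z ->
  loc p (energy_rate t) z
  = 2 * dirichlet (img p) (xl p) (fun y => F p (t, y))
          (fun y => time_velocity I (img p) (F p) (t, y)) z
    + 4 * co * mink (time_velocity I (img p) (F p) (t, z)) lvec.
Proof.
move=> It pz; rewrite -(local_velocity _ pz).
have CZ1 : surface_C 1 (Z t) by move=> q; exact: class_C_pred (variation_surface_C It q).
have E := local_pairing immX CZ1 (velocity_surface_C It) pz.
have Eb b : pd (img p) b (loc p (velocity t)) z
    = pd (img p) b (fun y => time_velocity I (img p) (F p) (t, y)) z.
  by apply: (pd_ext b pz) => y py; exact: local_velocity.
rewrite /dirichlet !Eb in E.
exact (congr1 (fun u => 2 * u + 4 * co * mink (loc p (velocity t) z) lvec) E).
Qed.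

Let trace_double (e f g w c : R) (F1 F2 V1 V2 y v : 'rV[R]_5) :
  metric_trace e f g w (mink V1 F1 + mink F1 V1) (mink V1 F2 + mink F1 V2)
    (mink V2 F1 + mink F2 V1) (mink V2 F2 + mink F2 V2)
  + c * (mink v lvec + mink y 0)
  = 2 * metric_trace e f g w (mink F1 V1) (mink F1 V2) (mink F2 V1) (mink F2 V2)
    + c * mink v lvec.
Proof.
have -> : mink y 0 = 0 by rewrite -[X in mink y X](scale0r y) minkZr mul0r.
by rewrite /metric_trace !(minkC V1) !(minkC V2); ring.
Qed.

Lemma energy_density_is_derive t p : I t ->
  is_derive t 1 (energy_density ^~ p) (energy_rate t p).
Proof.
move=> It; have pp := phi_img (chart_at_dom p).
apply: (@has_deriv_is_derive _ I); first exact: open_nbhs_nbhs.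
rewrite -(local_center (energy_rate t) p) (local_energy_rate It pp).
have dp b := @has_deriv_pd_time _ _ _ oI (rI p) _ _ (CF p) b _ _ It pp.
have dm b b' := has_deriv_mink (dp b) (dp b').
have d1 := has_deriv_metric_trace (g11 := met11 (img p) (xl p) (phi p p))
  (g12 := met12 (img p) (xl p) (phi p p)) (g22 := met22 (img p) (xl p) (phi p p))
  (w := density (img p) (xl p) (phi p p)) (dm false false) (dm false true)
  (dm true false) (dm true true).
have dl := has_deriv_mink (@has_deriv_variation t p It) (has_deriv_cst I lvec 1 t).
have H := has_derivD d1 (has_derivZl (c:=4 * co) dl).
have Eq s : norm2 (img p) (xl p) (loc p (Z s)) (phi p p) + 4 * co * mink (Z s p) lvec
    = energy_density s p.
  by rewrite /energy_density (dnorm2_center immX) potentialE.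
have H2 := has_deriv_ext (g := energy_density ^~ p) It (fun s _ => Eq s) H.
have E := trace_double (met11 (img p) (xl p) (phi p p))
  (met12 (img p) (xl p) (phi p p)) (met22 (img p) (xl p) (phi p p))
  (density (img p) (xl p) (phi p p)) (4 * co)
  (pd (img p) false (fun y => F p (t, y)) (phi p p))
  (pd (img p) true (fun y => F p (t, y)) (phi p p))
  (pd (img p) false (fun y => time_velocity I (img p) (F p) (t, y)) (phi p p))
  (pd (img p) true (fun y => time_velocity I (img p) (F p) (t, y)) (phi p p))
  (Z t p) (velocity t p).
have H3 := eq_ind _ (has_deriv I (energy_density ^~ p) 1 t) H2 _ E.
have V : velocity t p = time_velocity I (img p) (F p) (t, phi p p).
  by rewrite -(local_velocity _ pp) local_center.
by rewrite V in H3.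
Qed.

Let pullback p (f : R * R -> R) : {within img p, continuous f} ->
  class_C dirs3 0 (I `*` img p) (fun tz => f tz.2).
Proof.
move=> cf; split=> //; apply: (continuous_within_map (A' := img p) _ _ cf) => [x [] //|].
by apply: continuous_subspaceT => x; exact: cvg_snd.
Qed.

Let local_rate p (tz : R * (R * R)) : R :=
  2 * dirichlet (img p) (xl p) (fun y => F p (tz.1, y))
        (fun y => time_velocity I (img p) (F p) (tz.1, y)) tz.2
  + 4 * co * mink (time_velocity I (img p) (F p) tz) lvec.

Let local_rate_continuous p : {within I `*` img p, continuous (local_rate p)}.
Proof.
have a3 := relopen_accessible3 oI (rI p).
have Cx := xl_class immX p; have d0 := @metric_det_gt0 _ _ _ immX p.
have cF b : class_C dirs3 0 (I `*` img p)
    (fun tz => pd (img p) b (fun y => F p (tz.1, y)) tz.2).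
  by split=> //; exact: (pd_jointly_continuous (CF p)).
have cV b : class_C dirs3 0 (I `*` img p)
    (fun tz => pd (img p) b (fun y => time_velocity I (img p) (F p) (tz.1, y)) tz.2).
  by split=> //; exact: (pd_velocity_jointly_continuous (CF p)).
have m b b' := class_C_mink a3 (cF b) (cV b').
have c11 := pullback (class_C_continuous (class_met11 (rI p) Cx)).
have c12 := pullback (class_C_continuous (class_met12 (rI p) Cx)).
have c22 := pullback (class_C_continuous (class_met22 (rI p) Cx)).
have cw : class_C dirs3 0 (I `*` img p)
    (fun tz => (density (img p) (xl p) tz.2 ^+ 2)^-1).
  have Cd := class_density (rI p) Cx d0; have aI := relopen_accessible (rI p).
  have n0 z : img p z -> density (img p) (xl p) z * density (img p) (xl p) z != 0.
    by move=> pz; rewrite mulf_neq0// lt0r_neq0// (density_gt0 d0 pz).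
  exact: pullback (class_C_continuous (class_C_inv aI n0 (class_C_mul aI Cd Cd))).
have ctr := class_C_mul a3 (class_C_add a3 (class_C_sub a3
  (class_C_mul a3 c22 (m false false))
  (class_C_mul a3 c12 (class_C_add a3 (m false true) (m true false))))
  (class_C_mul a3 c11 (m true true))) cw.
have cv : class_C dirs3 0 (I `*` img p) (time_velocity I (img p) (F p)).
  exact: class_C_pred (class_time_velocity (CF p)).
have cl := class_C_mink a3 cv (class_C_cst 0 (lvec : 'rV[R]_5) a3).
have H := class_C_add a3 (class_C_mul a3 (class_C_cst 0 (2 : R) a3) ctr)
  (class_C_mul a3 (class_C_cst 0 (4 * co) a3) cl).
exact: class_C_continuous H.
Qed.

Lemma energy_rate_continuous t p : I t ->
  {for (t, p), continuous (fun tq : R * S => energy_rate tq.1 tq.2)}.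
Proof.
move=> It; have [odom _ cphi _ _] := chart_at_chart p.
have cm : {within I `*` dom p, continuous (fun tq : R * S => (tq.1, phi p tq.2))}.
  have c2 : {within I `*` dom p, continuous (fun tq : R * S => phi p tq.2)}.
    apply: (continuous_within_map (A' := dom p) _ _ cphi) => [x [] //|].
    by apply: continuous_subspaceT => x; exact: cvg_snd.
  have c1 : {within I `*` dom p, continuous (fun tq : R * S => tq.1)}.
    by apply: continuous_subspaceT => x; exact: cvg_fst.
  by move=> x; exact: cvg_pair (c1 x) (c2 x).
have c : {within I `*` dom p, continuous (fun tq : R * S => local_rate p (tq.1, phi p tq.2))}.
  have sub x : (I `*` dom p) x -> (I `*` img p) (x.1, phi p x.2).
    by move=> [Ix px]; split=> //; exact: phi_img.
  exact: continuous_within_map sub cm (@local_rate_continuous p).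
have {}c : {within I `*` dom p, continuous (fun tq : R * S => energy_rate tq.1 tq.2)}.
  apply: subspace_eq_continuous c => -[s q]; rewrite inE => -[/= Is pq].
  have E := local_energy_rate Is (phi_img pq).
  have E' := congr1 (energy_rate s) (phiK pq).
  exact (etrans (esym E) E').
have oID : open (I `*` dom p).
  apply: openI; apply: open_comp => //.
    by move=> x _; exact: (@cvg_fst _ _ (nbhs x.1) (nbhs x.2) _).
  by move=> x _; exact: (@cvg_snd _ _ (nbhs x.1) (nbhs x.2) _).
have tp : (t, p) \in I `*` dom p.
  by rewrite inE; split => //; exact: chart_at_dom.
by move: c; rewrite continuous_open_subspace// => /(_ _ tp).
Qed.

Let half_time (t : R) : - (eps / 2) <= t <= eps / 2 -> I t.
Proof.
have e0 : 0 < eps := eps0.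
rewrite /I /= => /andP[t1 t2]; apply/andP; split; lra.
Qed.

(** By joint continuity on a compact time interval times the compact surface;
    this constant dominates the difference quotients of the density. *)
Lemma energy_rate_bounded : exists2 M : R, 0 <= M &
  forall t p, - (eps / 2) <= t <= eps / 2 -> `|energy_rate t p| <= M.
Proof.
pose K : set (R * S) := `[- (eps / 2), eps / 2]%classic `*` setT.
have cK : compact K.
  apply: compact_setX; [exact: segment_compact|exact: surface_compact].
have cfK : compact ((fun tq : R * S => energy_rate tq.1 tq.2) @` K).
  apply: continuous_compact => //.
  apply/subspace_continuousP => -[t p] [/= tI _]; apply: cvg_within_filter.
  by apply: energy_rate_continuous; move: tI; rewrite in_itv; exact: half_time.
have [M [Mr HM]] := compact_bounded cfK.
exists (`|M| + 1); first by rewrite addr_ge0.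
move=> t p tI; apply: (HM (`|M| + 1)).
  by rewrite (le_lt_trans (ler_norm M))// ltrDl.
by exists (t, p) => //; split => //=; rewrite in_itv.
Qed.

Lemma energy_density_continuous t : I t -> continuous (energy_density t).
Proof.
move=> It; have CZ := variation_surface_C It.
have CZ1 : surface_C 1 (Z t) by move=> q; exact: class_C_pred (CZ q).
have cl : continuous (fun p => mink (Z t p) lvec).
  apply: chart_continuous => p; have aI := relopen_accessible (rI p).
  exact: class_C_continuous (class_C_mink aI (CZ p) (class_C_cst 2 (lvec : 'rV[R]_5) aI)).
move=> p; apply: cvgD; first exact: (dnorm2_continuous immX CZ1).
rewrite potentialE; under eq_fun do rewrite potentialE.
by apply: cvgM; [exact: cvg_cst|exact: cl].
Qed.

Variable mu : {measure set borel -> \bar R}.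
Hypothesis amu : area_measure X mu.

(** Differentiation under the integral sign; a constant bound is integrable as
    the area is finite. *)
Lemma energy_is_derive :
  is_derive (0 : R) (1 : R) (fun t => energy co X mu (Z t))
    (\int[mu]_(p in [set: borel]) energy_rate 0 p)%R.
Proof.
have [M M0 HM] := energy_rate_bounded; have e0 : 0 < eps := eps0.
have Hh (t : R) : `]- (eps / 2), eps / 2[%classic t -> - (eps / 2) <= t <= eps / 2.
  by rewrite /= in_itv /= => /andP[t1 t2]; apply/andP; split; exact: ltW.
have Ih t tI := half_time (Hh t tI).
have H0 : `]- (eps / 2), eps / 2[%classic (0 : R).
  by rewrite /= in_itv /=; apply/andP; split; lra.
have iG : mu.-integrable (setT : set borel) (EFin \o (fun=> M : R)).
  by apply: (continuous_integrable immX amu) => p; exact: cvg_cst.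
have dE t p : I t -> partial1of2 energy_density t p = energy_rate t p.
  by move=> It; rewrite partial1of2E; have [_ ->] := energy_density_is_derive p It.
have G_ub t (p : borel) : `]- (eps / 2), eps / 2[%classic t -> setT p ->
    `|partial1of2 energy_density t p| <= M.
  by move=> tI _; rewrite (dE _ _ (Ih t tI)); apply: HM; exact: Hh.
have H := @cvg_differentiation_under_integral R _ borel mu energy_density setT
  measurableT 0 (- (eps / 2)) (eps / 2) H0
  (fun t tI => continuous_integrable immX amu (energy_density_continuous (Ih t tI)))
  (fun t p tI _ => @ex_derive _ _ _ _ _ _ _ (energy_density_is_derive p (Ih t tI)))
  (fun=> M) (fun _ => M0) iG G_ub.
have {H} : h^-1 *: (energy co X mu (Z (h + 0)) - energy co X mu (Z 0)) @[h --> 0^']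
    --> (\int[mu]_(p in [set: borel]) partial1of2 energy_density 0 p)%R by exact: H.
have -> : (\int[mu]_(p in [set: borel]) partial1of2 energy_density 0 p)%R
    = (\int[mu]_(p in [set: borel]) energy_rate 0 p)%R.
  by apply: eq_Rintegral => p _; exact: dE (Ih 0 H0).
move=> H; apply: (@has_deriv_is_derive _ setT); first by near=> t.
apply: cvg_within_filter.
by under eq_fun do rewrite [_ *: 1]mulr1.
Unshelve. all: by end_near. Qed.

End EnergyVariation.

(** * Criticality of the conformal Gauss map *)

Section FirstVariation.
Context {R : realType} (S : surface R) (X : S -> 'rV[R]_3).
Hypothesis immX : immersion 4 X.
Implicit Types (p q : S) (z : R * R) (t : R).
Variable co : R.

Local Notation img p := (cimg (chart_at p)).
Local Notation borel := (g_sigma_algebraType (@open S)).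
Local Notation Y := (conformal_gauss_map co X).
Local Notation el := (helfrich_el X co).

Let rI p : relopen (img p) := img_relopen p.

Lemma helfrich_el_continuous : continuous el.
Proof.
apply: chart_continuous => p.
have C := class_euler_lagrange (rI p) (xl_class immX p) (@metric_det_gt0 _ _ _ immX p) co.
apply: continuous_within_ext (class_C_continuous C) => z pz.
by rewrite (local_helfrich_el immX co pz).
Qed.

Lemma cone_pairing_continuous (V : S -> 'rV[R]_5) : surface_C 0 V ->
  continuous (fun p => mink (cone (X p)) (V p)).
Proof.
move=> CV; apply: chart_continuous => p; have aI := relopen_accessible (rI p).
have C := class_cone (rI p) (xl_class immX p) (leq0n 4).
exact: class_C_continuous (class_C_mink aI C (CV p)).
Qed.

Section AlongVariation.
Variables (eps : R) (Z : R -> S -> 'rV[R]_5).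
Hypotheses (eps0 : 0 < eps) (vZ : Defs.variation eps Y Z).

Let I : set R := [set t | - eps < t < eps].
Let I0 : I 0.
Proof. by have e0 : 0 < eps := eps0; rewrite /I /=; apply/andP; split; lra. Qed.
Local Notation V := (velocity eps Z 0).

Let Z0 : Z 0 = Y. Proof. by case: vZ. Qed.

Let dV p : has_deriv I (fun s => Z s p) 1 0 (V p).
Proof. exact: has_deriv_variation vZ _ _ I0. Qed.

(** Differentiate the equation of de Sitter space along the variation. *)
Lemma velocity_tangent p : mink (Y p) (V p) = 0.
Proof.
have H := has_deriv_mink (@dV p) (@dV p).
have [_ dS _ _] := vZ.
have H' := has_deriv_ext I0 (g := fun=> 1 : R) (fun s Is => dS s p Is) H.
have := has_deriv_unique (open_reachable (@open_time R eps) I0) H'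
  (has_deriv_cst_scalar I 1 1 0).
by rewrite Z0 (minkC (V p)) => E; lra.
Qed.

Lemma velocity_support (K : set S) p :
  (forall t p, I t -> ~ K p -> Z t p = Y p) -> ~ K p -> V p = 0.
Proof.
move=> ZK Kp.
have H := has_deriv_ext I0 (g := fun=> Y p) (fun s Is => ZK s p Is Kp) (@dV p).
exact: has_deriv_unique (open_reachable (@open_time R eps) I0) H (has_deriv_cst I (Y p) 1 0).
Qed.

Variable mu : {measure set borel -> \bar R}.
Hypothesis amu : area_measure X mu.

Let split_rate (a c e f g : R) (cn y d2 v l : 'rV[R]_5) :
  d2 + f *: y - (2%:R * c) *: (l - g *: y) = e *: cn -> mink y v = 0 ->
  2 * a + 4 * c * mink v l = 2 * (a + mink d2 v) + (-2) * (e * mink cn v).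
Proof.
move=> E yv; have : mink (d2 + f *: y - (2%:R * c) *: (l - g *: y)) v = mink (e *: cn) v.
  by rewrite E.
rewrite !minklin yv !mulr0 => H.
have -> : e * mink cn v = mink d2 v - 2 * c * mink l v by rewrite -H; ring.
by rewrite (minkC v l); ring.
Qed.

(** Green's formula trades the pairing for the Laplacian of the Gauss map. In
    the tension identity the multiples of Y do not contribute, as the velocity
    is tangent to de Sitter space, and the light-like vector is compensated by
    the gradient of the potential. *)
Lemma first_variation : is_derive (0 : R) (1 : R) (fun t => energy co X mu (Z t))
  (-2 * (\int[mu]_(p in [set: borel]) (el p * mink (cone (X p)) (V p)))%R).
Proof.
have CY := gauss_map_surface_C immX co.
have CV := velocity_surface_C vZ I0.
have CY1 : surface_C 1 Y by move=> q; exact: class_C_pred (CY q).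
have CV0 : surface_C 0 V by move=> q; exact: class_C_pred (CV q).
have [K [cK KS ZK]] : exists K : set S, [/\ compact K, K `<=` @surface_interior R S &
        forall t p, I t -> ~ K p -> Z t p = Y p] by case: vZ.
have G := green_formula immX amu CY CV cK KS (fun p Kp => velocity_support ZK Kp).
pose g p := pairing X Y V p + mink (laplace X Y p) (V p).
pose h p := el p * mink (cone (X p)) (V p).
have cg : continuous g.
  move=> p; apply: cvgD; first exact: (pairing_continuous immX CY1 CV).
  exact: (mink_laplace_continuous immX CY CV0).
have ch : continuous h.
  move=> p; apply: cvgM; first exact: helfrich_el_continuous.
  exact: cone_pairing_continuous CV0 p.
have D := energy_is_derive immX co eps0 vZ amu.
rewrite [X in is_derive _ _ _ X](_ : _ = (\int[mu]_(p in [set: borel])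
  energy_rate X co eps Z 0 p)%R)//.
have rateE p : energy_rate X co eps Z 0 p = 2 * g p + (-2) * h p.
  rewrite /energy_rate Z0.
  exact: split_rate (tension_identity immX co p) (velocity_tangent p).
have ig := continuous_integrable immX amu cg.
have ih := continuous_integrable immX amu ch.
have mul_int (c : R) (f : S -> R) : continuous f ->
    mu.-integrable (setT : set borel) (EFin \o (fun p => c * f p)).
  move=> cf; apply: (continuous_integrable immX amu) => p.
  by apply: cvgM; [exact: cvg_cst|exact: cf].
have E1 := RintegralD measurableT (mul_int 2 g cg) (mul_int (-2) h ch).
have E2 := RintegralZl 2 measurableT ig; have E3 := RintegralZl (-2) measurableT ih.
have E0 : (\int[mu]_(p in [set: borel]) g p)%R = 0 by rewrite /Rintegral [X in fine X]G.
transitivity (\int[mu]_(p in [set: borel]) (2 * g p + (-2) * h p))%R; last first.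
  by apply: eq_Rintegral => p _; rewrite rateE.
apply: etrans (esym E1); apply: etrans (esym (congr2 +%R E2 E3)).
by rewrite E0 mulr0 add0r.
Qed.

End AlongVariation.
End FirstVariation.

(** * Testing criticality with null rotations *)

Section NullRotation.
Context {R : realType}.
Implicit Types (x y : 'rV[R]_5) (i : 'I_3).

Definition space_vec i : 'rV[R]_5 := mk5 (delta_mx 0 i) 0 0.

Lemma dot_delta (u : 'rV[R]_3) i : dot u (delta_mx 0 i) = u 0 i.
Proof.
rewrite /dot (bigD1 i)//= big1 => [|j ji]; first by rewrite mxE !eqxx mulr1 addr0.
by rewrite mxE eqxx (negbTE ji) mulr0.
Qed.

Lemma mink_space_vec (u : 'rV[R]_3) (a b : R) i : mink (mk5 u a b) (space_vec i) = u 0 i.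
Proof. by rewrite mink_mk5 dot_delta; ring. Qed.

Let ll : mink lvec lvec = 0 :> R.
Proof. by rewrite mink_mk5 dot0l; ring. Qed.

Let le i : mink lvec (space_vec i) = 0.
Proof. by rewrite mink_space_vec mxE. Qed.

Let ee i : mink (space_vec i) (space_vec i) = 1.
Proof. by rewrite mink_space_vec mxE !eqxx. Qed.

(** An infinitesimal Lorentz transformation annihilating the light-like vector;
    on the light cone it generates a translation of Euclidean space. *)
Definition null_rotation i y : 'rV[R]_5 :=
  mink y lvec *: space_vec i - mink y (space_vec i) *: lvec.

(** The exponential of the null rotation, quadratic in s because the rotation is
    nilpotent of order 3. It stays in de Sitter space without normalization. *)
Definition null_flow i (s : R) y : 'rV[R]_5 :=
  y + s *: null_rotation i y + (s ^+ 2 / 2) *: null_rotation i (null_rotation i y).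

Lemma null_rotation2 i y : null_rotation i (null_rotation i y) = - mink y lvec *: lvec.
Proof.
have Nl : mink (null_rotation i y) lvec = 0.
  by rewrite /null_rotation !minklin (minkC (space_vec i)) le ll; ring.
have Ne : mink (null_rotation i y) (space_vec i) = mink y lvec.
  by rewrite /null_rotation !minklin le ee; ring.
by rewrite {1}/null_rotation Nl Ne scale0r sub0r scaleNr.
Qed.

Lemma null_flow_isometry i s y : mink (null_flow i s y) (null_flow i s y) = mink y y.
Proof.
rewrite /null_flow null_rotation2 /null_rotation !minklin.
rewrite (minkC lvec y) (minkC (space_vec i) y) (minkC (space_vec i) lvec) le ll ee.
by field.
Qed.

(** The multiples of the cone cancel: tested against this rotation, the null
    vector field of the tension identity reads off a coordinate of the normal. *)
Lemma mink_cone_null_rotation i (X v : 'rV[R]_3) (h : R) :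
  mink (cone X) (null_rotation i (h *: cone X + tlift X v)) = v 0 i.
Proof.
rewrite /null_rotation !minklin mink_cone_lvec mink_tlift_lvec.
by rewrite !mink_space_vec; ring.
Qed.

Lemma class_C_null_rotation {V : normedModType R} (B : seq V) k (D : set V) i
    (f : V -> 'rV[R]_5) : accessible B D -> class_C B k D f ->
  class_C B k D (fun z => null_rotation i (f z)).
Proof.
move=> aD Cf; have Cl := class_C_cst k (lvec : 'rV[R]_5) aD.
have Ce := class_C_cst k (space_vec i) aD.
exact: class_C_sub aD (class_C_scale aD (class_C_mink aD Cf Cl) Ce)
  (class_C_scale aD (class_C_mink aD Cf Ce) Cl).
Qed.

End NullRotation.

Section Converse.
Context {R : realType} (S : surface R) (X : S -> 'rV[R]_3).
Hypothesis immX : immersion 4 X.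
Implicit Types (p q : S) (z : R * R) (t : R).
Variable co : R.

Local Notation img p := (cimg (chart_at p)).
Local Notation phi p := (cmap (chart_at p)).
Local Notation psi p := (cinv (chart_at p)).
Local Notation loc p f := (local (chart_at p) f).
Local Notation xl p := (local (chart_at p) X).
Local Notation borel := (g_sigma_algebraType (@open S)).
Local Notation Y := (conformal_gauss_map co X).
Local Notation el := (helfrich_el X co).
Local Notation leb2 := (@lebesgue_measure R \x @lebesgue_measure R)%E.

Let rI p : relopen (img p) := img_relopen p.

Lemma normal_coordinate_continuous i : continuous (fun p => normal X p 0 i).
Proof.
apply: chart_continuous => p; have aI := relopen_accessible (rI p).
have C := proj1 (class_C_row 3 (nu (img p) (xl p)) aI) (nu_class immX p) i.
apply: continuous_within_ext (class_C_continuous C) => z pz.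
by rewrite -(local_normal immX pz).
Qed.

Lemma normal_unit p : dot (normal X p) (normal X p) = 1.
Proof.
have pp := phi_img (chart_at_dom p).
have := nu_unit (@metric_det_gt0 _ _ _ immX p) pp.
by rewrite -(local_normal immX pp) local_center.
Qed.

Section NullVariation.
Variables (p0 : S) (r : R) (i : 'I_3).
Hypothesis adm : admissible p0 r.
Local Notation b := (bump p0 r).

Definition null_variation t q : 'rV[R]_5 := null_flow i (t * b q) (Y q).

Lemma null_variationP : Defs.variation 1 Y null_variation.
Proof.
have YE q : null_flow i 0 (Y q) = Y q.
  by rewrite /null_flow expr2 !mul0r !scale0r !addr0.
split.
- by apply/funext => q; rewrite /null_variation mul0r YE.
- move=> t q _; rewrite /null_variation /deSitter /= null_flow_isometry.
  exact: conformal_gauss_map_deSitter.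
- move=> p; have oI := @open_time R 1.
  have a3 := relopen_accessible3 oI (rI p).
  have sub (tz : R * (R * R)) : ([set t : R | - 1 < t < 1] `*` img p) tz -> img p tz.2 by case.
  have C2 : class_C dirs3 2 ([set t : R | - 1 < t < 1] `*` img p)
      (fun tz : R * (R * R) => tz.2).
    by apply: (class_C_linear 2 a3) => [z|//]; exact: cvg_snd.
  have C1 : class_C dirs3 2 ([set t : R | - 1 < t < 1] `*` img p)
      (fun tz : R * (R * R) => tz.1).
    by apply: (class_C_linear 2 a3) => [z|//]; exact: cvg_fst.
  have CY := class_C_comp_row (rI p) a3 sub (gauss_map_surface_C immX co p) C2.
  have Cb := class_C_comp (rI p) a3 sub (bump_surface_C adm p) C2.
  have Cs := class_C_mul a3 C1 Cb.
  have CN := class_C_null_rotation i a3 CY.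
  have CNN := class_C_null_rotation i a3 CN.
  have Cs2 := class_C_mul a3 (class_C_mul a3 Cs Cs) (class_C_cst 2 (2^-1 : R) a3).
  have H := class_C_add a3 (class_C_add a3 CY (class_C_scale a3 Cs CN))
    (class_C_scale a3 Cs2 CNN).
  exact: H.
- exists (psi p0 @` square p0 r); split.
  + apply: continuous_compact (@square_compact _ _ p0 r).
    have [_ _ _ cpsi _] := chart_at_chart p0.
    exact: continuous_subspaceW (square_img adm) cpsi.
  + move=> _ [z [z1 z2] <-]; have [r0 rb _] := adm.
    apply: surface_interior_psi; first by apply: (square_img adm).
    by move: z2; rewrite ler_norml => /andP[z2 _]; lra.
  + by move=> t q _ Cq; rewrite /null_variation (bump0 adm Cq) mulr0 YE.
Qed.

Lemma null_variation_velocity q :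
  velocity 1 null_variation 0 q = b q *: null_rotation i (Y q).
Proof.
pose I : set R := [set t : R | - 1 < t < 1].
have oI : open I := @open_time R 1.
have I0 : I 0 by rewrite /I /=; apply/andP; split; lra.
apply: deriv_alongE; first exact: open_reachable.
have did : has_deriv I (fun t : R => t) 1 0 (1 : R).
  exact: (@has_deriv_linear _ _ _ I (fun t : R => t) 1 0).
have ds := has_derivM did (has_deriv_cst_scalar I (b q) 1 0).
have d2 := has_derivM (has_derivM ds ds) (has_deriv_cst_scalar I 2^-1 1 0).
have cst v := has_deriv_cst I (v : 'rV[R]_5) 1 0.
have H := has_derivD (has_derivD (cst (Y q)) (has_derivZ ds (cst (null_rotation i (Y q)))))
  (has_derivZ d2 (cst (null_rotation i (null_rotation i (Y q))))).
have E (N M : 'rV[R]_5) (c : R) : 0 + ((1 * c + 0 * 0) *: N + (0 * c) *: 0)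
  + ((((1 * c + 0 * 0) * (0 * c) + 0 * c * (1 * c + 0 * 0)) * 2^-1 + 0 * c * (0 * c) * 0) *: M
     + (0 * c * (0 * c) / 2) *: 0) = c *: N.
  by rewrite !(mul0r, mulr0, addr0, add0r, mul1r, scale0r, scaler0).
exact (eq_ind _ (has_deriv I (fun t => null_variation t q) 1 0) H _ (E _ _ _)).
Qed.

Lemma null_variation_rate q :
  mink (cone (X q)) (velocity 1 null_variation 0 q) = b q * normal X q 0 i.
Proof.
rewrite null_variation_velocity minkZr; congr (_ * _).
exact: mink_cone_null_rotation.
Qed.

End NullVariation.

Variable mu : {measure set borel -> \bar R}.
Hypothesis amu : area_measure X mu.

(** The area measure charges every neighbourhood of an interior point. *)
Lemma positive_integral (g : S -> R) p : surface_interior p -> continuous g ->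
  (forall q, 0 <= g q) -> 0 < g p -> (0 < \int[mu]_(q in setT) (g q)%:E)%E.
Proof.
move=> p0 cg g0 gp; have pp := phi_img (chart_at_dom p).
have d0 := @metric_det_gt0 _ _ _ immX p.
pose h z := loc p g z * density (img p) (xl p) z.
have Cd := class_density (rI p) (xl_class immX p) d0.
have [_ _ _ cpsi _] := chart_at_chart p.
have cl : {within img p, continuous (loc p g)}.
  by move=> z; apply: continuous_comp (cpsi z) (cg _).
have ch : {within img p, continuous h}.
  by move=> z; apply: cvgM; [exact: cl|exact: class_C_continuous Cd z].
have hp : 0 < h (phi p p).
  by rewrite /h local_center mulr_gt0// (density_gt0 d0 pp).
have h2 : 0 < h (phi p p) / 2 by exact: divr_gt0.
move/subspace_continuousP: (ch) => /(_ _ pp) /cvgrPdist_lt/(_ _ h2).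
rewrite near_withinE => /box_near[d dd0 dh].
have [r rd [r0 rb I]] := admissible_ex p0 dd0.
set a := (phi p p).1 in I dh; set c := (phi p p).2 in rb I dh.
have ar : a - r < a + r by lra.
have cr : c - r < c + r by lra.
pose Q := open_box (a - r) (a + r) (c - r) (c + r).
have QP z : Q z -> `|z.1 - a| < r /\ `|z.2 - c| < r.
  by move=> []; rewrite /= !in_itv /= -!ltr_distl.
have Qp : Q `<=` img p by move=> z /QP[z1 z2]; apply: I; lra.
have rQ : relopen Q.
  exists Q; first exact: open_box_open.
  apply/seteqP; split=> [z Qz|z []//]; split=> //.
  by have [_] := QP z Qz; rewrite ltr_norml => /andP[z2 _]; rewrite /half_plane /=; lra.
have mg := continuous_borel cg.
have mA := open_borel (chart_image_open rQ Qp).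
have mQ := relopen_measurable rQ.
apply: (@lt_le_trans _ _ (\int[mu]_(q in psi p @` Q) (g q)%:E)%E); last first.
  apply: ge0_subset_integral => //; first exact/measurable_EFinP.
  by move=> q _; rewrite lee_fin.
rewrite (chart_integral immX amu rQ Qp (measurable_funTS mg)).
apply: (@lt_le_trans _ _ ((h (phi p p) / 2)%:E * leb2 Q)%E).
  rewrite (open_box_measure ar cr) -EFinM lte_fin mulr_gt0// mulr_gt0//; lra.
rewrite -(@integral_cst _ _ _ leb2 Q mQ).
have hm : measurable_fun Q h.
  by apply: continuous_relopen_measurable => //; exact: continuous_subspaceW Qp ch.
apply: ge0_le_integral => //.
- by move=> z _; rewrite lee_fin ltW.
- exact/measurable_EFinP.
- move=> z Qz; rewrite lee_fin; have [z1 z2] := QP z Qz.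
  have : `|h (phi p p) - h z| < h (phi p p) / 2.
    by apply: dh; [lra|lra|exact: Qp].
  by rewrite ltr_norml -/(h z) => /andP[_ H]; lra.
Qed.

(** Were the Euler-Lagrange expression nonzero at an interior point, the null
    rotation in a direction not orthogonal to the normal, localized near the
    point, would change the energy to first order. *)
Theorem critical_helfrich : energy_critical co X mu Y -> helfrich_critical co X.
Proof.
move=> [_ _ crit] p p0; change (el p = 0); apply/eqP/negP => /negP elp.
have [i ni] : exists i, normal X p 0 i != 0.
  apply: contrapT => /forallNP n0; have := normal_unit p.
  rewrite /dot big1 => [/esym/eqP|i _]; first by rewrite oner_eq0.
  by move: (n0 i) => /negP/negPn/eqP ->; rewrite mul0r.
have [s [sE cs]] : exists s : S -> R,
    (forall q, s q = el q * normal X q 0 i) /\ continuous s.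
  exists (fun q => el q * normal X q 0 i); split=> //.
  have ce : continuous el by exact: helfrich_el_continuous.
  have cn : continuous (fun q => normal X q 0 i) by exact: normal_coordinate_continuous.
  by move=> q; exact: (cvgM (ce q) (cn q)).
have sp : 0 < s p * s p by rewrite -expr2 exprn_even_gt0//= sE mulf_neq0.
have pp := phi_img (chart_at_dom p).
have [_ _ _ cpsi _] := chart_at_chart p.
have cl : {within img p, continuous (loc p (fun q => s p * s q))}.
  move=> z; apply: cvgM; first exact: cvg_cst.
  by apply: continuous_comp (cpsi z) (cs _).
move/subspace_continuousP: cl => /(_ _ pp) /cvgrPdist_lt/(_ _ sp).
rewrite near_withinE => /box_near[d d0 ds].
have [r rd adm] := admissible_ex p0 d0; have [r0 rb I] := adm.
pose g q := s p * (s q * bump p r q).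
have cb : continuous (bump p r).
  by apply: chart_continuous => q; exact: class_C_continuous (bump_surface_C adm q).
have cg : continuous g.
  move=> q; apply: cvgM; first exact: cvg_cst.
  by apply: cvgM; [exact: cs|exact: cb].
have g0 q : 0 <= g q.
  have [[z [z1 z2] zq]|Cq] := pselect ((psi p @` square p r) q); last first.
    by rewrite /g (bump0 adm Cq) !mulr0.
  rewrite /g mulrA mulr_ge0 ?bump_ge0//.
  have : `|loc p (fun q => s p * s q) (phi p p) - loc p (fun q => s p * s q) z| < s p * s p.
    apply: ds; [lra|lra|]; apply: (square_img adm); by split.
  rewrite local_center ltr_norml => /andP[_ H].
  have {}H : s p * s p - s p * s (psi p z) < s p * s p := H.
  by rewrite -zq; lra.
have gp : 0 < g p by rewrite /g (bump_center adm) mulr1.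
have := positive_integral p0 cg g0 gp.
have D := first_variation immX ltr01 (null_variationP i adm) amu.
have D' := crit 1 _ ltr01 (null_variationP i adm).
have {D D'} int0 : (\int[mu]_(q in [set: borel]) (s q * bump p r q))%R = 0.
  have := etrans (esym (@derive_val _ _ _ _ _ _ _ D)) (@derive_val _ _ _ _ _ _ _ D').
  move/eqP; rewrite mulf_eq0 => /orP[/eqP|/eqP E]; first by lra.
  rewrite -[RHS]E; apply: eq_Rintegral => q _.
  by rewrite null_variation_rate// sE; ring.
have csb : continuous (fun q => s q * bump p r q).
  by move=> q; apply: cvgM; [exact: cs|exact: cb].
have isb := continuous_integrable immX amu csb.
have ig := continuous_integrable immX amu cg.
have E := RintegralZl (s p) measurableT isb.
rewrite int0 mulr0 in E.
rewrite -(fineK (integrable_fin_num measurableT ig)) lte_fin.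
by rewrite [X in 0 < X]E ltxx.
Qed.

(** The integrand of the first variation is zero, also at the boundary. *)
Theorem helfrich_energy_critical : helfrich_critical co X -> energy_critical co X mu Y.
Proof.
move=> crit; have el0 := helfrich_el_vanishes immX crit.
split; [exact: gauss_map_surface_C|exact: conformal_gauss_map_deSitter|].
move=> eps Z eps0 vZ.
have D := first_variation immX eps0 vZ amu.
rewrite [X in is_derive _ _ _ X](_ : _ = -2 * (\int[mu]_(p in [set: borel])
  (el p * mink (cone (X p)) (velocity eps Z 0 p)))%R)//.
rewrite (_ : (\int[mu]_(p in [set: borel]) _)%R = 0) ?mulr0//.
rewrite /Rintegral integral0_eq// => p _; by rewrite el0 mul0r.
Qed.

End Converse.

Unset Implicit Arguments.

Theorem theorem3p1 (R : realType) (S : surface R) (X : S -> 'rV[R]_3) (co : R)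
    (immX : immersion 4 X) :
  (helfrich_critical co X <->
   forall p : S,
     let Y := conformal_gauss_map co X in
     laplace X Y p + dnorm2 X Y p *: Y p
     = (2%:R * co) *: deSitter_proj (Y p) lvec)
  /\
  (forall mu : {measure set (g_sigma_algebraType (@open S)) -> \bar R},
     area_measure X mu ->
     (helfrich_critical co X <->
      energy_critical co X mu (conformal_gauss_map co X))).
Proof.
split; first exact: helfrich_critical_iff_tension immX co.
move=> mu amu; split; first exact: helfrich_energy_critical.
exact: critical_helfrich.
Qed.
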